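(* For any $L>0$ there is $v=v(L)>0$ depending only on $L$ with the following property. Let $n$ be a positive integer and let $A$ be an $n\times n$ random matrix with (jointly) independent real entries, each of zero mean, unit variance, and with distribution density bounded above by $L$. Then $$\mathbb P\big\{s_{\min}(A)\le t n^{-1/2}\big\}\le v t,\qquad t>0.$$
   Context: $s_{\min}(A)=\inf_{x\in S^{n-1}}\|Ax\|_2$ is the smallest singular value of $A$. *)

(* Defs.v *)
From HB Require Import structures.
From mathcomp Require Import all_boot all_order all_algebra.
From mathcomp Require Import all_classical all_reals all_analysis.

Set Implicit Arguments.
Unset Strict Implicit.
Unset Printing Implicit Defensive.

Import Order.TTheory GRing.Theory Num.Theory.
Import numFieldNormedType.Exports.

Local Open Scope classical_set_scope.
Local Open Scope ring_scope.

(* The library norm on matrices is the sup norm, hence this definition. *)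
Definition euclidean_norm (R : realType) (m : nat) (x : 'cV[R]_m) : R :=
  Num.sqrt (\sum_(i < m) x i 0 ^+ 2).

Definition unit_sphere (R : realType) (m : nat) : set 'cV[R]_m :=
  [set x | euclidean_norm x = 1].

Arguments unit_sphere : clear implicits.

Definition smin (R : realType) (n : nat) (A : 'M[R]_n) : R :=
  inf [set euclidean_norm (A *m x) | x in unit_sphere R n].

Definition mutually_independent d (T : measurableType d) (R : realType)
    (P : probability T R) (I : finType) (X : I -> {RV P >-> R}) : Prop :=
  forall (J : {set I}) (B : I -> set R),
    (forall i, i \in J -> measurable (B i)) ->
    P (\bigcap_(i in [set` J]) (X i @^-1` B i)) =
    (\prod_(i in J) P (X i @^-1` B i))%E.

Definition is_density d (T : measurableType d) (R : realType)
    (P : probability T R) (X : {RV P >-> R}) (f : R -> R) : Prop :=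
  [/\ measurable_fun setT f,
      forall x, 0 <= f x &
      forall B : set R, measurable B ->
        distribution P X B = (\int[lebesgue_measure]_(x in B) (f x)%:E)%E].

(* Main.v *)
(** Let N_m be the rows of the adjugate of A.  If s_min(A) <= t / sqrt n, then
    n det(A)^2 <= t^2 sum_m |N_m|^2.  Normalise rho_m^2 = n |N_m|^2 / sum |N|^2, so that
    the rho_m^2 have mean 1.  Weighting by 4^k the triples (i, j, l) such that
    rho_i >= 2^(k-1) and rho_j, rho_l <= 2, the total weight is at least of order n^3, so by
    Markov's inequality it is enough to bound the probability of one such triple by
    O(t 8^(-k)).  Freeze the other columns and project the three remaining ones onto an
    orthonormal triple orthogonal to the frozen columns: with p_i, p_j, p_l the projections
    and c the cross product of p_j and p_l, the event says that the products of p_i with c,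
    c x p_l and c x p_j are at most O(t 2^(-k)) |c|, O(2^(-k)) |c|^2 and O(2^(-k)) |c|^2.
    These are three linear forms in the column i, of determinant |c|^4 in the coordinates
    of the orthonormal triple, and E |c| <= 3.

    The small ball probability of three forms is bounded by the integral over R^3 of a
    product of moduli of characteristic functions.  The arithmetic-geometric mean
    inequality, averaged over triples of coordinates with weights proportional to the squared
    3 x 3 minors, reduces it to one-dimensional integrals of |phi|^(1/lambda), which are
    O(sqrt lambda) when the marginal weight lambda of the coordinate is at most 1/2.  To reach
    this, only the triples containing a suitable set S of at most three coordinates get a
    weight; the laws of the coordinates in S are first replaced by Laplace laws of scale N, at
    a cost O(N) each, which the integral O(1/N) of the corresponding factor compensates. *)

Require Import Defs.
From HB Require Import structures.
From mathcomp Require Import all_boot all_order all_algebra.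
From mathcomp Require Import all_classical all_reals all_analysis.
From mathcomp Require Import measurable_realfun ring lra zify.

Set Implicit Arguments.
Unset Strict Implicit.
Unset Printing Implicit Defensive.

Import Order.TTheory GRing.Theory Num.Theory.
Import numFieldNormedType.Exports.

Local Open Scope classical_set_scope.
Local Open Scope ring_scope.

(** * Product laws and resampling of coordinates *)

(** Why three columns: with the column i alone, rho_i >= 2^(k-1) only puts that column within O(t
    2^(-k)) of the span of the others, and the weights 4^k turn the resulting probabilities O(t
    2^(-k)) into a divergent series; a pair of columns gives O(t 4^(-k)) and loses log n. A triple
    is the first size for which the weighted series, with terms 2^(-k), converges. The three widths
    multiply to O(t 8^(-k)) |c|^5, so after division by |c|^4 no negative moment of |c| enters. The
    threshold 1/2 is Plancherel's: a density bounded by L makes |phi|^2 integrable, while |phi|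
    itself need not be. The gain sqrt lambda removes the dimension: with weights det_J^2 / Z the
    average of 1 / |det_J| alone is not O(Z^(-1/2)) uniformly in n, but the factors sqrt lambda
    allow a comparison with the product of the three marginals, whose total mass is 27. The scale N
    tends to infinity once the bound is free of it. *)

Lemma eq_le_refl d (T : porderType d) (x y : T) : x = y -> (x <= y)%O.
Proof. by move=> ->. Qed.

Lemma measurable_norm_le (R : realType) (e : R) :
  measurable ([set x : R | `|x| <= e] : set (measurableTypeR R)).
Proof.
rewrite (_ : [set _ | _] = `[-e, e]%classic); first exact: measurable_itv.
by apply/seteqP; split=> x /=; rewrite in_itv/= ler_norml.
Qed.

Lemma integral_probability_cst d (T : measurableType d) (R : realType)
    (P : probability T R) (r : R) : (\int[P]_x r%:E = r%:E)%E.
Proof.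
rewrite integral_cst// [X in (_ * X)%E](_ : _ = 1%E) ?mule1//; exact: probability_setT.
Qed.

Lemma bounded_integrable d (T : measurableType d) (R : realType)
    (P : probability T R) (f : T -> R) (M : R) :
  measurable_fun setT f -> (forall x, `|f x| <= M) ->
  P.-integrable setT (EFin \o f).
Proof.
move=> mf fM; apply: measurable_bounded_integrable => //.
  exact: (le_lt_trans (probability_le1 P measurableT) (ltry 1)).
by exists M; split; [exact: num_real|] => y My x _ /=; apply: (le_trans (fM x)); exact: ltW.
Qed.

Definition rectangles (R : realType) (K : finType) : set (set (K -> R)) :=
  [set A | exists2 B : K -> set R,
     (forall k, measurable (B k)) & A = [set x | forall k, B k (x k)]].

Arguments rectangles : clear implicits.

(** Points remain plain functions, while the alias carries the product sigma-algebra. Any finite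
    index type is allowed, so the entries of a matrix can be indexed by pairs. *)
Definition vec (R : realType) (K : finType) :=
  g_sigma_algebraType (rectangles R K).
HB.instance Definition _ (R : realType) (K : finType) :=
  Measurable.on (vec R K).

Arguments vec : clear implicits.

Section vec_measurability.
Context (R : realType) (K : finType).

Lemma setI_closed_rectangles : setI_closed (rectangles R K).
Proof.
move=> _ _ [B mB ->] [C mC ->]; exists (fun k => B k `&` C k).
  by move=> k; exact: measurableI.
apply/seteqP; split => [x [xB xC] k|x xBC]; first by split.
by split=> k; have [] := xBC k.
Qed.

Lemma measurable_rectangle (B : K -> set R) : (forall k, measurable (B k)) ->
  measurable ([set x | forall k, B k (x k)] : set (vec R K)).
Proof. by move=> mB; apply: sub_sigma_algebra; exists B. Qed.

Lemma measurable_coord (k : K) : measurable_fun setT (fun x : vec R K => x k).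
Proof.
move=> _ Y mY; rewrite setTI.
rewrite (_ : _ @^-1` _ = [set x | forall j, (if j == k then Y else setT) (x j)]).
  by apply: (@measurable_rectangle (fun j => if j == k then Y else setT)) => j; case: ifP.
apply/seteqP; split => [x Yx j|x /(_ k)]; last by rewrite eqxx.
by case: eqP => [->|].
Qed.

Lemma measurable_fun_vec d (T : measurableType d) (f : T -> vec R K) :
  (forall k, measurable_fun setT (fun t => f t k)) -> measurable_fun setT f.
Proof.
move=> mf; apply: (@measurability _ _ T (vec R K) setT f (rectangles R K)) => //.
move=> _ [_ [B mB ->] <-].
rewrite setTI (_ : _ @^-1` _ = \big[setI/setT]_(k : K) ((fun t => f t k) @^-1` B k)).
  apply: bigsetI_measurable => k _.
  by rewrite -[X in measurable X]setTI; exact: mf.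
rewrite -bigcap_seq; apply/seteqP; split => [t ft k _|t ft k]; first exact: ft.
by apply: ft; rewrite /= mem_index_enum.
Qed.

End vec_measurability.

(** Independence as a property of a given law. No product over [K] is constructed: every other law
    arises by pushing forward binary products along [mix] or [upd]. *)
Definition product_law (R : realType) (K : finType)
    (Q : probability (vec R K) R) (mu : K -> probability (measurableTypeR R) R) :=
  forall B : K -> set R, (forall k, measurable (B k)) ->
    Q [set x | forall k, B k (x k)] = (\prod_k mu k (B k))%E.

Section product_law.
Context (R : realType) (K : finType).
Implicit Types (Q : probability (vec R K) R).
Implicit Types (mu : K -> probability (measurableTypeR R) R).

(** Rectangles form a pi-system generating the sigma-algebra. *)
Lemma product_law_unique Q Q' mu : product_law Q mu -> product_law Q' mu ->
  forall A, measurable A -> Q A = Q' A.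
Proof.
move=> Qmu Q'mu.
move=> A; apply: (@measure_unique _ R (vec R K) (rectangles R K) (fun=> setT)) => //.
- exact: setI_closed_rectangles.
- by move=> _; exists (fun=> setT) => //; apply/seteqP; split.
- by apply/seteqP; split => // x _; exists 0%N.
- by move=> _ [B mB ->]; exact: etrans (Qmu B mB) (esym (Q'mu B mB)).
- by move=> _; rewrite (le_lt_trans (probability_le1 _ _))// ltry.
Qed.


Definition mix (I : {set K}) (z x : vec R K) : vec R K :=
  fun k => if k \in I then z k else x k.

Definition upd (k : K) (t : R) (x : vec R K) : vec R K :=
  fun j => if j == k then t else x j.

Lemma measurable_mix (I : {set K}) d (T : measurableType d) (f g : T -> vec R K) :
  measurable_fun setT f -> measurable_fun setT g ->
  measurable_fun setT (fun t => mix I (f t) (g t)).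
Proof.
move=> mf mg; apply: measurable_fun_vec => k; rewrite /mix; case: (k \in I).
  exact: (measurableT_comp (measurable_coord k) mf).
exact: (measurableT_comp (measurable_coord k) mg).
Qed.

Lemma measurable_upd (k : K) d (T : measurableType d)
    (f : T -> measurableTypeR R) (g : T -> vec R K) :
  measurable_fun setT f -> measurable_fun setT g ->
  measurable_fun setT (fun t => upd k (f t) (g t)).
Proof.
move=> mf mg; apply: measurable_fun_vec => j; rewrite /upd; case: (j == k) => //.
exact: (measurableT_comp (measurable_coord j) mg).
Qed.

Lemma measurable_mixl (I : {set K}) x : measurable_fun setT (fun z => mix I z x).
Proof. by apply: measurable_mix; [exact: measurable_id|exact: measurable_cst]. Qed.

Lemma measurable_updl (k : K) x :
  measurable_fun setT (fun t : measurableTypeR R => upd k t x).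
Proof. by apply: measurable_upd; [exact: measurable_id|exact: measurable_cst]. Qed.

Definition mixp (I : {set K}) (p : vec R K * vec R K) := mix I p.1 p.2.

Definition updp (k : K) (p : measurableTypeR R * vec R K) := upd k p.1 p.2.

Lemma measurable_mixp (I : {set K}) : measurable_fun setT (mixp I).
Proof. by apply: measurable_mix. Qed.

Lemma measurable_updp (k : K) : measurable_fun setT (updp k).
Proof. by apply: measurable_upd. Qed.

HB.instance Definition _ (I : {set K}) :=
  isMeasurableFun.Build _ _ _ _ _ (measurable_mixp I).
HB.instance Definition _ (k : K) :=
  isMeasurableFun.Build _ _ _ _ _ (measurable_updp k).

Definition mix_law (I : {set K}) Q : probability (vec R K) R :=
  distribution (Q \x Q)%E (mixp I).

Definition upd_law (k : K) (nu : probability (measurableTypeR R) R) Q :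
  probability (vec R K) R := distribution (nu \x Q)%E (updp k).

Lemma mix_product_law I Q mu : product_law Q mu -> product_law (mix_law I Q) mu.
Proof.
move=> Qmu B mB.
pose B1 k := if k \in I then B k else setT.
pose B2 k := if k \in I then setT else B k.
have mB1 k : measurable (B1 k) by rewrite /B1; case: (k \in I).
have mB2 k : measurable (B2 k) by rewrite /B2; case: (k \in I).
transitivity ((Q \x Q)%E ([set x : vec R K | forall k, B1 k (x k)] `*`
    [set x : vec R K | forall k, B2 k (x k)])).
  congr ((Q \x Q)%E _); apply/seteqP; split => [[z x]/= zx|[z x]/= [zB xB] k].
    by split=> k; have := zx k; rewrite /mixp/mix /B1 /B2/=; case: (k \in I).
  by have := zB k; have := xB k; rewrite /mixp/mix /B1 /B2/=; case: (k \in I).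
rewrite product_measure1E; [|exact: measurable_rectangle..].
rewrite [X in (X * _)%E](Qmu B1 mB1) [X in (_ * X)%E](Qmu B2 mB2) -big_split/=.
apply: eq_bigr => k _; rewrite /B1 /B2; case: (k \in I).
  by rewrite probability_setT mule1.
by rewrite probability_setT mul1e.
Qed.

Lemma upd_product_law k nu Q mu : product_law Q mu ->
  product_law (upd_law k nu Q) (fun j => if j == k then nu else mu j).
Proof.
move=> Qmu B mB.
pose B2 j := if j == k then setT else B j.
have mB2 j : measurable (B2 j) by rewrite /B2; case: (j == k).
transitivity ((nu \x Q)%E (B k `*` [set x : vec R K | forall j, B2 j (x j)])).
  congr ((nu \x Q)%E _); apply/seteqP; split => [[z x]/= zx|[z x]/= [zB xB] j].
    split; first by have := zx k; rewrite /updp/upd/= eqxx.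
    by move=> j; have := zx j; rewrite /updp/upd /B2/=; case: eqP.
  by have := xB j; rewrite /updp/upd /B2/=; case: eqP => [->|].
rewrite product_measure1E; [|exact: mB|exact: measurable_rectangle].
rewrite [X in (_ * X)%E](Qmu B2 mB2) (bigD1 k)//= [RHS](bigD1 k)//= /B2 eqxx.
rewrite probability_setT mul1e; congr (_ * _)%E.
by apply: eq_bigr => j /negPf ->.
Qed.

(* Resampling the coordinates of [I] by an independent copy does not change the
   law; this is how one conditions on the coordinates outside [I]. *)
Lemma integral_mix (I : {set K}) Q mu (f : vec R K -> \bar R) : product_law Q mu ->
  measurable_fun setT f -> (forall x, 0 <= f x)%E ->
  (\int[Q]_x f x = \int[Q]_x \int[Q]_z f (mix I z x))%E.
Proof.
move=> Qmu mf f0.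
transitivity (\int[mix_law I Q]_x f x)%E.
  by apply: eq_measure_integral => A mA _; exact: (product_law_unique Qmu (mix_product_law I Qmu)).
rewrite ge0_integral_pushforward//.
rewrite preimage_setT fubini_tonelli2//.
exact: (measurableT_comp mf (@measurable_mixp I)).
by move=> x; exact: f0.
Qed.

Lemma measure_mix (I : {set K}) Q mu (A : set (vec R K)) : product_law Q mu -> measurable A ->
  (Q A = \int[Q]_x Q [set z | A (mix I z x)])%E.
Proof.
move=> Qmu mA.
transitivity (\int[Q]_x (\1_A x)%:E)%E; first by rewrite integral_indic// setIT.
rewrite (integral_mix I Qmu)//; last first.
  exact/measurable_EFinP/measurable_indic.
apply: eq_integral => x _.
transitivity (\int[Q]_z (\1_[set z | A (mix I z x)] z)%:E)%E; first exact: eq_integral.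
rewrite integral_indic// ?setIT//.
rewrite -[X in measurable X]setTI.
exact: measurable_mixl.
Qed.

Lemma integral_upd k (nu : probability (measurableTypeR R) R) Q (f : vec R K -> \bar R) :
  measurable_fun setT f -> (forall x, 0 <= f x)%E ->
  (\int[upd_law k nu Q]_x f x = \int[Q]_x \int[nu]_t f (upd k t x))%E.
Proof.
move=> mf f0.
rewrite ge0_integral_pushforward// preimage_setT fubini_tonelli2//.
  exact: (measurableT_comp mf (@measurable_updp k)).
by move=> x; exact: f0.
Qed.

Lemma upd_law_id k Q mu : product_law Q mu ->
  forall A, measurable A -> upd_law k (mu k) Q A = Q A.
Proof.
move=> Qmu; apply: (@product_law_unique _ _ mu) => // B mB.
rewrite (upd_product_law k (mu k) Qmu)//; apply: eq_bigr => j _.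
by case: eqP => [->|].
Qed.

Lemma measure_upd k (nu : probability (measurableTypeR R) R) Q (A : set (vec R K)) :
  measurable A ->
  (upd_law k nu Q A = \int[Q]_x nu [set t | A (upd k t x)])%E.
Proof.
move=> mA.
transitivity (\int[upd_law k nu Q]_x (\1_A x)%:E)%E; first by rewrite integral_indic// setIT.
rewrite integral_upd//; last exact/measurable_EFinP/measurable_indic.
apply: eq_integral => x _.
transitivity (\int[nu]_z (\1_[set z | A (upd k z x)] z)%:E)%E; first exact: eq_integral.
rewrite integral_indic// ?setIT//.
rewrite -[X in measurable X]setTI.
exact: measurable_updl.
Qed.

Lemma measurable_upd_section k (A : set (vec R K)) x : measurable A ->
  measurable ([set t | A (upd k t x)] : set (measurableTypeR R)).
Proof.
move=> mA; rewrite -[X in measurable X]setTI.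
exact: measurable_updl.
Qed.

Lemma measurable_measure_upd k (nu : probability (measurableTypeR R) R)
    (A : set (vec R K)) : measurable A ->
  measurable_fun setT (fun x => nu [set t | A (upd k t x)]).
Proof.
move=> mA; have mA' : measurable (updp k @^-1` A).
  by rewrite -[X in measurable X]setTI; exact: measurable_updp.
rewrite (_ : (fun x => _) = nu \o ysection (updp k @^-1` A)).
  exact: measurable_fun_ysection.
by apply/funext => x /=; congr (nu _); apply/seteqP; split => t; rewrite /ysection/= inE.
Qed.

Lemma measurable_measure_mix (I : {set K}) Q (A : set (vec R K)) : measurable A ->
  measurable_fun setT (fun x => Q [set z | A (mix I z x)]).
Proof.
move=> mA; have mA' : measurable (mixp I @^-1` A).
  by rewrite -[X in measurable X]setTI; exact: measurable_mixp.
rewrite (_ : (fun x => _) = Q \o ysection (mixp I @^-1` A)).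
  exact: measurable_fun_ysection.
by apply/funext => x /=; congr (Q _); apply/seteqP; split => t; rewrite /ysection/= inE.
Qed.

(** Tonelli in the coordinate [k] transfers the domination of one marginal to the joint law. This is
    the step by which one law is traded for another at the cost of a factor [c]. *)
Lemma measure_upd_le k Q mu (nu : probability (measurableTypeR R) R) (c : R)
    (B : set R) (A : set (vec R K)) : 0 <= c ->
  product_law Q mu -> measurable A -> measurable B ->
  (forall C : set R, measurable C -> (mu k (C `&` B) <= c%:E * nu C)%E) ->
  (Q (A `&` [set x | B (x k)]) <= c%:E * upd_law k nu Q A)%E.
Proof.
move=> c0 Qmu mA mB muB.
have mAB : measurable (A `&` [set x | B (x k)] : set (vec R K)).
  by apply: measurableI => //; rewrite -[X in measurable X]setTI; exact: measurable_coord.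
rewrite -(upd_law_id k Qmu)// !measure_upd// -ge0_integralZl//; last first.
  exact: measurable_measure_upd.
apply: ge0_le_integral => //.
- exact: measurable_measure_upd.
- by apply: measurable_funeM; exact: measurable_measure_upd.
move=> x _; apply: le_trans (muB _ _); last exact: measurable_upd_section.
rewrite le_measure ?inE//.
- exact: (@measurable_upd_section k _ x mAB).
- by apply: measurableI => //; exact: measurable_upd_section.
- by move=> t /=; rewrite {2}/upd eqxx.
Qed.

Lemma Rintegral_upd k Q mu (f : vec R K -> R) (M : R) : product_law Q mu ->
  measurable_fun setT f -> (forall x, `|f x| <= M) ->
  \int[Q]_x f x = \int[Q]_x \int[mu k]_t f (upd k t x).
Proof.
move=> Qmu mf fM.
rewrite /Rintegral; congr fine.
transitivity (\int[upd_law k (mu k) Q]_x (f x)%:E)%E.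
  by apply: eq_measure_integral => A mA _; apply/esym; exact: upd_law_id.
have mfu : measurable_fun setT (f \o updp k).
  exact: (measurableT_comp mf (@measurable_updp k)).
have iu : (mu k \x Q)%E.-integrable setT (EFin \o (f \o updp k)).
  apply: (@bounded_integrable _ _ R (mu k \x Q)%E (f \o updp k) M) => // -[t x]; exact: fM.
transitivity (\int[mu k \x Q]_p (f (updp k p))%:E)%E.
  apply: (@integral_distribution _ _ _ _ R (mu k \x Q)%E (updp k) (EFin \o f) _ iu).
  exact/measurable_EFinP.
rewrite -integral21_prod_meas1//=.
apply: eq_integral => x _.
rewrite /fubini_G/= fineK//.
apply: integrable_fin_num => //.
apply: (@bounded_integrable _ (measurableTypeR R) R (mu k) (fun t => f (upd k t x)) M) => //.
exact: (measurableT_comp mf (@measurable_updl k x)).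
Qed.

End product_law.

(** * Changes of variables *)

Section affine.
Context (R : realType).
Local Notation leb := (@lebesgue_measure R).

Definition affine (m a : R) : measurableTypeR R -> measurableTypeR R :=
  fun x => m * x + a.

Lemma measurable_affine m a : measurable_fun setT (affine m a).
Proof. exact: measurable_funD. Qed.

HB.instance Definition _ m a :=
  isMeasurableFun.Build _ _ _ _ (affine m a) (measurable_affine m a).

(** Uniqueness of Lebesgue measure reduces the claim to intervals []u, v]]; a negative slope
    reverses them, which is why the two signs are treated apart. *)
Lemma lebesgue_affine (m a : R) : m != 0 -> forall A, measurable A ->
  leb A = (`|m|%:E * leb (affine m a @^-1` A))%E.
Proof.
move=> m0 A mA.
have nm0 : 0 <= `|m| by [].
pose push := measure_function_pushforward__canonical__measure_function_Measure
  leb (measurable_affine m a).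
pose mu : {measure set (measurableTypeR R) -> \bar R} := mscale (NngNum nm0) push.
rewrite (@lebesgue_measure_unique R mu) => [//| |//].
move=> _ [[u v] /= uv <-].
rewrite [RHS](_ : _ = (`|m|%:E * leb (affine m a @^-1` [set` `]u, v]]))%E)//.
have [mp|mn] := ltP 0 m.
  rewrite (_ : affine m a @^-1` _ = `](u - a) / m, (v - a) / m]%classic).
    rewrite !lebesgue_measure_itv/= !lte_fin ltr_pM2r ?invr_gt0// ltrD2r.
    case: ifPn => _; last by rewrite mule0.
    rewrite -!EFinD -EFinM gtr0_norm//; congr EFin; field; exact: m0.
  apply/seteqP; split => x /=; rewrite /affine !in_itv/=;
    by rewrite ltr_pdivrMr// ler_pdivlMr// ltrBlDr lerBrDr (mulrC x).
have {}mn : m < 0 by rewrite lt_neqAle m0.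
rewrite (_ : affine m a @^-1` _ = `[(v - a) / m, (u - a) / m[%classic).
  rewrite !lebesgue_measure_itv/= !lte_fin ltr_nM2r ?invr_lt0// ltrD2r.
  case: ifPn => _; last by rewrite mule0.
  rewrite -!EFinD -EFinM ltr0_norm//; congr EFin; field; exact: m0.
apply/seteqP; split => x /=; rewrite /affine !in_itv/=;
  by rewrite ler_ndivrMr// ltr_ndivlMr// ltrBlDr lerBrDr (mulrC x) andbC.
Qed.

Lemma integral_affine (m a : R) (f : measurableTypeR R -> \bar R) : m != 0 ->
  measurable_fun setT f -> (forall x, 0 <= f x)%E ->
  (\int[leb]_x f (m * x + a)%R = `|m|^-1%:E * \int[leb]_x f x)%E.
Proof.
move=> m0 mf f0.
have nm0 : 0 <= `|m| by [].
pose push := measure_function_pushforward__canonical__measure_function_Measure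
  leb (measurable_affine m a).
pose mu : {measure set (measurableTypeR R) -> \bar R} := mscale (NngNum nm0) push.
have -> : (\int[leb]_x f x = \int[mu]_x f x)%E.
  by apply: eq_measure_integral => A mA _; exact: lebesgue_affine.
rewrite ge0_integral_mscale// ge0_integral_pushforward//.
by rewrite muleA -EFinM mulVf ?normr_eq0// mul1e preimage_setT.
Qed.

End affine.

Section linear_change_of_variables.
Context (R : realType).
Local Notation leb := (@lebesgue_measure R).
Local Notation rT := (measurableTypeR R).

Lemma tonelli_swap (H : rT -> rT -> \bar R) :
  measurable_fun setT (fun p : rT * rT => H p.1 p.2) ->
  (forall x y, 0 <= H x y)%E ->
  (\int[leb]_x \int[leb]_y H x y = \int[leb]_y \int[leb]_x H x y)%E.
Proof.
by move=> mH H0; exact: (fubini_tonelli (fun p : rT * rT => H p.1 p.2)).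
Qed.

Lemma tonelli_swap23 (H : rT -> rT -> rT -> \bar R) :
  measurable_fun setT (fun p : rT * rT * rT => H p.1.1 p.1.2 p.2) ->
  (forall x y z, 0 <= H x y z)%E ->
  (\int[leb]_x \int[leb]_y \int[leb]_z H x y z =
   \int[leb]_x \int[leb]_z \int[leb]_y H x y z)%E.
Proof.
move=> mH H0; apply: eq_integral => x _; apply: tonelli_swap => //.
have mx : measurable_fun setT (fun p : rT * rT => ((x, p.1), p.2)).
  by apply: measurable_fun_pair => //; apply: measurable_fun_pair.
exact: (measurableT_comp mH mx).
Qed.

Lemma tonelli_swap12 (H : rT -> rT -> rT -> \bar R) :
  measurable_fun setT (fun p : rT * rT * rT => H p.1.1 p.1.2 p.2) ->
  (forall x y z, 0 <= H x y z)%E ->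
  (\int[leb]_x \int[leb]_y \int[leb]_z H x y z =
   \int[leb]_y \int[leb]_x \int[leb]_z H x y z)%E.
Proof.
move=> mH H0; apply: tonelli_swap; last by move=> x y; exact: integral_ge0.
exact: (@measurable_fun_fubini_tonelli_F _ _ (rT * rT)%type rT R leb
  (fun p : rT * rT * rT => H p.1.1 p.1.2 p.2)).
Qed.

(** Gauss elimination with pivot [b2]: at fixed x the second form becomes the new variable z, and in
    terms of z the first form has slope det / b2 in x. *)
Lemma integral_linear2_pivot (g1 g2 : rT -> R) (a1 b1 r1 a2 b2 r2 : R) :
  b2 != 0 -> a1 * b2 - b1 * a2 != 0 ->
  measurable_fun setT g1 -> measurable_fun setT g2 ->
  (forall x, 0 <= g1 x) -> (forall x, 0 <= g2 x) ->
  (\int[leb]_x \int[leb]_y (g1 (a1 * x + b1 * y + r1) * g2 (a2 * x + b2 * y + r2))%:E =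
   `|a1 * b2 - b1 * a2|^-1%:E * (\int[leb]_x (g1 x)%:E * \int[leb]_x (g2 x)%:E))%E.
Proof.
move=> b20 det0 mg1 mg2 g10 g20.
pose c := (a1 * b2 - b1 * a2) / b2.
have c0 : c != 0 by rewrite mulf_neq0// invr_eq0.
pose h x z := (g1 (c * x + (b1 / b2 * (z - r2) + r1)) * g2 z)%:E.
have mh : measurable_fun setT (fun p : rT * rT => h p.1 p.2).
  apply/measurable_EFinP; apply: measurable_funM; last exact: measurableT_comp.
  apply: (measurableT_comp mg1); apply: measurable_funD; first exact: measurable_funM.
  apply: measurable_funD => //; apply: measurable_funM => //.
  exact: measurable_funB.
have h0 x z : (0 <= h x z)%E by rewrite lee_fin mulr_ge0.
have mh1 x : measurable_fun setT (h x).
  exact: (measurableT_comp mh (pair1_measurable x)).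
have mh2 z : measurable_fun setT (h^~ z).
  exact: (measurableT_comp mh (pair2_measurable z)).
transitivity (\int[leb]_x (`|b2|^-1%:E * \int[leb]_z h x z))%E.
  apply: eq_integral => x _.
  rewrite -(@integral_affine R b2 (a2 * x + r2) (h x))//; last exact: mh1.
  apply: eq_integral => y _; rewrite /h; congr (g1 _ * g2 _)%:E.
    by rewrite /c; field.
  by ring.
rewrite ge0_integralZl//; last 2 first.
- exact: (@measurable_fun_fubini_tonelli_F _ _ rT rT R leb (fun p => h p.1 p.2)).
- by move=> x _; exact: integral_ge0.
rewrite tonelli_swap//.
transitivity (`|b2|^-1%:E * \int[leb]_z ((`|c|^-1%:E * \int[leb]_x (g1 x)%:E) * (g2 z)%:E))%E.
  congr (_ * _)%E; apply: eq_integral => z _; rewrite /h.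
  under eq_integral do rewrite EFinM.
  rewrite ge0_integralZr//.
  - rewrite (@integral_affine R c _ (fun x => (g1 x)%:E))//.
    exact/measurable_EFinP.
  - apply/measurable_EFinP; apply: (measurableT_comp mg1).
    by apply: measurable_funD => //; exact: measurable_funM.
  - by move=> x _; rewrite lee_fin.
  - by rewrite lee_fin.
rewrite ge0_integralZl//; last 3 first.
- exact/measurable_EFinP.
- by move=> z _; rewrite lee_fin.
- by rewrite mule_ge0// ?lee_fin// integral_ge0// => x _; rewrite lee_fin.
rewrite !muleA; congr (_ * _ * _)%E.
by rewrite -EFinM /c normrM normfV invfM invrK mulrCA mulVf ?mulr1// normr_eq0.
Qed.

Lemma integral_linear2 (g1 g2 : rT -> R) (a1 b1 r1 a2 b2 r2 : R) :
  a1 * b2 - b1 * a2 != 0 ->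
  measurable_fun setT g1 -> measurable_fun setT g2 ->
  (forall x, 0 <= g1 x) -> (forall x, 0 <= g2 x) ->
  (\int[leb]_x \int[leb]_y (g1 (a1 * x + b1 * y + r1) * g2 (a2 * x + b2 * y + r2))%:E =
   `|a1 * b2 - b1 * a2|^-1%:E * (\int[leb]_x (g1 x)%:E * \int[leb]_x (g2 x)%:E))%E.
Proof.
move=> det0 mg1 mg2 g10 g20.
have [b20|] := eqVneq b2 0; last by move=> ?; exact: integral_linear2_pivot.
have a20 : a2 != 0 by apply: contraNneq det0 => ->; rewrite b20 !mulr0 subrr.
rewrite tonelli_swap; last 2 first.
- apply/measurable_EFinP; apply: measurable_funM.
  + apply: (measurableT_comp mg1); apply: measurable_funD => //.
    by apply: measurable_funD; exact: measurable_funM.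
  + apply: (measurableT_comp mg2); apply: measurable_funD => //.
    by apply: measurable_funD; exact: measurable_funM.
- by move=> x y; rewrite lee_fin mulr_ge0.
have det0' : b1 * a2 - a1 * b2 != 0 by rewrite -oppr_eq0 opprB.
rewrite -normrN opprB.
apply: etrans (integral_linear2_pivot r1 r2 a20 det0' mg1 mg2 g10 g20).
by apply: eq_integral => y _; apply: eq_integral => x _; rewrite (addrC (a1 * x)) (addrC (a2 * x)).
Qed.

Let lin (a b c x y z : R) := a * x + b * y + c * z.

Let measurable_lin a b c : measurable_fun setT (fun p : rT * rT * rT => lin a b c p.1.1 p.1.2 p.2).
Proof.
have m1 : measurable_fun setT (fun p : rT * rT * rT => p.1.1) by exact: measurableT_comp.
have m2 : measurable_fun setT (fun p : rT * rT * rT => p.1.2) by exact: measurableT_comp.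
by apply: measurable_funD; [apply: measurable_funD|]; exact: measurable_funM.
Qed.

Let measurable_prod3 (g1 g2 g3 : rT -> R) a1 b1 c1 a2 b2 c2 a3 b3 c3 :
  measurable_fun setT g1 -> measurable_fun setT g2 -> measurable_fun setT g3 ->
  measurable_fun setT (fun p : rT * rT * rT =>
    (g1 (lin a1 b1 c1 p.1.1 p.1.2 p.2) * g2 (lin a2 b2 c2 p.1.1 p.1.2 p.2)
     * g3 (lin a3 b3 c3 p.1.1 p.1.2 p.2))%:E).
Proof.
move=> m1 m2 m3; apply/measurable_EFinP.
by apply: measurable_funM; [apply: measurable_funM|];
  [exact: (measurableT_comp m1 (measurable_lin _ _ _))
  |exact: (measurableT_comp m2 (measurable_lin _ _ _))
  |exact: (measurableT_comp m3 (measurable_lin _ _ _))].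
Qed.

(** Elimination with pivot [c3]: the third form becomes z, which is moved to the outermost integral.
    The two remaining forms have the Schur complement as matrix, of determinant D / c3, and are
    handled by [integral_linear2]. *)
Lemma integral_linear3_pivot (g1 g2 g3 : rT -> R) (a1 b1 c1 a2 b2 c2 a3 b3 c3 D : R) :
  c3 != 0 -> D != 0 ->
  D = a1 * (b2 * c3 - b3 * c2) - b1 * (a2 * c3 - a3 * c2) + c1 * (a2 * b3 - a3 * b2) ->
  measurable_fun setT g1 -> measurable_fun setT g2 -> measurable_fun setT g3 ->
  (forall x, 0 <= g1 x) -> (forall x, 0 <= g2 x) -> (forall x, 0 <= g3 x) ->
  (\int[leb]_x \int[leb]_y \int[leb]_z
     (g1 (lin a1 b1 c1 x y z) * g2 (lin a2 b2 c2 x y z) * g3 (lin a3 b3 c3 x y z))%:E =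
   `|D|^-1%:E * (\int[leb]_x (g1 x)%:E * \int[leb]_x (g2 x)%:E * \int[leb]_x (g3 x)%:E))%E.
Proof.
move=> c30 D0 DE mg1 mg2 mg3 g10 g20 g30.
pose A1 := a1 - c1 * a3 / c3; pose B1 := b1 - c1 * b3 / c3.
pose A2 := a2 - c2 * a3 / c3; pose B2 := b2 - c2 * b3 / c3.
have dE : A1 * B2 - B1 * A2 = D / c3 by rewrite /A1 /A2 /B1 /B2 DE; field.
have d0 : A1 * B2 - B1 * A2 != 0 by rewrite dE mulf_neq0// invr_eq0.
pose h x y z := (g1 (lin A1 B1 (c1 / c3) x y z) * g2 (lin A2 B2 (c2 / c3) x y z) * g3 (lin 0 0 1 x y z))%:E.
have mh : measurable_fun setT (fun p : rT * rT * rT => h p.1.1 p.1.2 p.2) by exact: measurable_prod3.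
have h0 x y z : (0 <= h x y z)%E by rewrite lee_fin !mulr_ge0.
have mh1 x y : measurable_fun setT (h x y).
  exact: (measurableT_comp mh (pair1_measurable (x, y))).
have mI12 : measurable_fun setT (fun p : rT * rT => \int[leb]_z h p.1 p.2 z)%E.
  exact: (@measurable_fun_fubini_tonelli_F _ _ (rT * rT)%type rT R leb
    (fun p : rT * rT * rT => h p.1.1 p.1.2 p.2)).
have I12 x y : (0 <= \int[leb]_z h x y z)%E by exact: integral_ge0.
have mI1 : measurable_fun setT (fun x : rT => \int[leb]_y \int[leb]_z h x y z)%E.
  exact: (@measurable_fun_fubini_tonelli_F _ _ rT rT R leb
    (fun p : rT * rT => \int[leb]_z h p.1 p.2 z)%E).
transitivity (\int[leb]_x \int[leb]_y (`|c3|^-1%:E * \int[leb]_z h x y z))%E.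
  apply: eq_integral => x _; apply: eq_integral => y _.
  rewrite -(@integral_affine R c3 (a3 * x + b3 * y) (h x y))//; last exact: mh1.
  apply: eq_integral => z _; rewrite /h /lin /A1 /B1 /A2 /B2.
  by congr (g1 _ * g2 _ * g3 _)%:E; field.
transitivity (`|c3|^-1%:E * \int[leb]_x \int[leb]_y \int[leb]_z h x y z)%E.
  rewrite -ge0_integralZl//; last by move=> x _; exact: integral_ge0.
  apply: eq_integral => x _; rewrite ge0_integralZl//.
  exact: (measurableT_comp mI12 (pair1_measurable x)).
rewrite tonelli_swap23//.
have mh' : measurable_fun setT (fun p : rT * rT * rT => h p.1.1 p.2 p.1.2).
  have ms : measurable_fun setT (fun p : rT * rT * rT => ((p.1.1, p.2), p.1.2)).
    by apply: measurable_fun_pair; [apply: measurable_fun_pair|] => //; exact: measurableT_comp.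
  exact: (measurableT_comp mh ms).
rewrite (@tonelli_swap12 (fun x z y => h x y z))//.
transitivity (`|c3|^-1%:E * \int[leb]_z ((`|D / c3|^-1%:E * (\int[leb]_x (g1 x)%:E * \int[leb]_x (g2 x)%:E)) * (g3 z)%:E))%E.
  congr (_ * _)%E; apply: eq_integral => z _; rewrite -dE.
  rewrite -(integral_linear2 (c1 / c3 * z) (c2 / c3 * z) d0 mg1 mg2 g10 g20).
  have mg : measurable_fun setT (fun p : rT * rT => (g1 (A1 * p.1 + B1 * p.2 + c1 / c3 * z) * g2 (A2 * p.1 + B2 * p.2 + c2 / c3 * z))%:E).
    apply/measurable_EFinP; apply: measurable_funM.
    + apply: (measurableT_comp mg1); apply: measurable_funD => //.
      by apply: measurable_funD; exact: measurable_funM.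
    + apply: (measurableT_comp mg2); apply: measurable_funD => //.
      by apply: measurable_funD; exact: measurable_funM.
  rewrite -ge0_integralZr ?lee_fin//; last 2 first.
  - apply: (@measurable_fun_fubini_tonelli_F _ _ rT rT R leb (fun p : rT * rT => (g1 (A1 * p.1 + B1 * p.2 + c1 / c3 * z) * g2 (A2 * p.1 + B2 * p.2 + c2 / c3 * z))%:E)) => //.
    by move=> p; rewrite lee_fin mulr_ge0.
  - by move=> x _; apply: integral_ge0 => y _; rewrite lee_fin mulr_ge0.
  apply: eq_integral => x _; rewrite -ge0_integralZr ?lee_fin//; last 2 first.
  - exact: (measurableT_comp mg (pair1_measurable x)).
  - by move=> y _; rewrite lee_fin mulr_ge0.
  apply: eq_integral => y _; rewrite /h /lin -EFinM; congr (_ * _ * g3 _)%:E; ring.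
have i1 : (0 <= \int[leb]_x (g1 x)%:E)%E by apply: integral_ge0 => x _; rewrite lee_fin.
have i2 : (0 <= \int[leb]_x (g2 x)%:E)%E by apply: integral_ge0 => x _; rewrite lee_fin.
rewrite ge0_integralZl//; last 3 first.
- exact/measurable_EFinP.
- by move=> z _; rewrite lee_fin.
- by rewrite !mule_ge0// lee_fin.
rewrite !muleA; congr (_ * _ * _ * _)%E.
by rewrite -EFinM normrM normfV invfM invrK mulrCA mulVf ?mulr1// normr_eq0.
Qed.

Lemma integral_linear3 (g1 g2 g3 : rT -> R) (a1 b1 c1 a2 b2 c2 a3 b3 c3 D : R) :
  D != 0 ->
  D = a1 * (b2 * c3 - b3 * c2) - b1 * (a2 * c3 - a3 * c2) + c1 * (a2 * b3 - a3 * b2) ->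
  measurable_fun setT g1 -> measurable_fun setT g2 -> measurable_fun setT g3 ->
  (forall x, 0 <= g1 x) -> (forall x, 0 <= g2 x) -> (forall x, 0 <= g3 x) ->
  (\int[leb]_x \int[leb]_y \int[leb]_z
     (g1 (a1 * x + b1 * y + c1 * z) * g2 (a2 * x + b2 * y + c2 * z) *
      g3 (a3 * x + b3 * y + c3 * z))%:E =
   `|D|^-1%:E * (\int[leb]_x (g1 x)%:E * \int[leb]_x (g2 x)%:E * \int[leb]_x (g3 x)%:E))%E.
Proof.
move=> D0 DE mg1 mg2 mg3 g10 g20 g30.
have [c30|c30] := eqVneq c3 0; last exact: integral_linear3_pivot.
pose h x y z := (g1 (lin a1 b1 c1 x y z) * g2 (lin a2 b2 c2 x y z) * g3 (lin a3 b3 c3 x y z))%:E.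
have h0 x y z : (0 <= h x y z)%E by rewrite lee_fin !mulr_ge0.
have mh : measurable_fun setT (fun p : rT * rT * rT => h p.1.1 p.1.2 p.2) by exact: measurable_prod3.
have [b30|b30] := eqVneq b3 0.
  have a30 : a3 != 0 by apply: contraNneq D0 => a30; rewrite DE a30 b30 c30; apply/eqP; ring.
  transitivity (\int[leb]_y \int[leb]_x \int[leb]_z h x y z)%E; first exact: tonelli_swap12.
  transitivity (\int[leb]_y \int[leb]_z \int[leb]_x h x y z)%E.
    apply: (@tonelli_swap23 (fun y x z => h x y z)) => //.
    have ms : measurable_fun setT (fun p : rT * rT * rT => ((p.1.2, p.1.1), p.2)).
      by apply: measurable_fun_pair; [apply: measurable_fun_pair|] => //; exact: measurableT_comp.
    exact: (measurableT_comp mh ms).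
  have DE' : D = b1 * (c2 * a3 - c3 * a2) - c1 * (b2 * a3 - b3 * a2) + a1 * (b2 * c3 - b3 * c2).
    by rewrite DE; ring.
  apply: etrans (integral_linear3_pivot a30 D0 DE' mg1 mg2 mg3 g10 g20 g30).
  by apply: eq_integral => y _; apply: eq_integral => z _; apply: eq_integral => x _; rewrite /h /lin; congr (g1 _ * g2 _ * g3 _)%:E; ring.
transitivity (\int[leb]_x \int[leb]_z \int[leb]_y h x y z)%E; first exact: tonelli_swap23.
have DE' : - D = a1 * (c2 * b3 - c3 * b2) - c1 * (a2 * b3 - a3 * b2) + b1 * (a2 * c3 - a3 * c2).
  by rewrite DE; ring.
have D0' : - D != 0 by rewrite oppr_eq0.
rewrite -normrN.
apply: etrans (integral_linear3_pivot b30 D0' DE' mg1 mg2 mg3 g10 g20 g30).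
by apply: eq_integral => x _; apply: eq_integral => z _; apply: eq_integral => y _; rewrite /h /lin; congr (g1 _ * g2 _ * g3 _)%:E; ring.
Qed.

End linear_change_of_variables.

(** * The Laplace law *)

Section laplace.
Context (R : realType).
Local Notation leb := (@lebesgue_measure R).
Local Notation rT := (measurableTypeR R).

Definition laplace_pdf (x : R) : R := expR (- `|x|) / 2.

Lemma laplace_pdf_ge0 x : 0 <= laplace_pdf x.
Proof. by rewrite /laplace_pdf divr_ge0 ?expR_ge0. Qed.

Lemma continuous_laplace_pdf : continuous laplace_pdf.
Proof.
move=> x; apply: cvgM; last exact: cvg_cst.
apply: continuous_comp; last exact: continuous_expR.
apply: continuousN; exact: norm_continuous.
Qed.

Lemma measurable_laplace_pdf : measurable_fun setT laplace_pdf.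
Proof. by apply: continuous_measurable_fun; exact: continuous_laplace_pdf. Qed.


Lemma is_derive_scale (s x : R) : is_derive x 1 (fun t => s * t) s.
Proof.
have := @is_deriveZ R R^o R^o id s x 1 1 (is_derive_id x 1).
by rewrite /GRing.scale/= mulr1.
Qed.

Lemma is_derive_cos_scale (s x : R) :
  is_derive x 1 (fun t => cos (s * t)) (- (s * sin (s * x))).
Proof.
have := @is_derive1_comp R (@cos R) (fun t => s * t) x _ _ (is_derive_cos (s * x)) (is_derive_scale s x).
by move/is_derive_eq; apply; rewrite ?scaler_mul//= /GRing.scale/= ?mulrN ?mulNr mulrC.
Qed.

Lemma is_derive_sin_scale (s x : R) :
  is_derive x 1 (fun t => sin (s * t)) (s * cos (s * x)).
Proof.
have := @is_derive1_comp R (@sin R) (fun t => s * t) x _ _ (is_derive_sin (s * x)) (is_derive_scale s x).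
by move/is_derive_eq; apply; rewrite /GRing.scale/= mulrC.
Qed.

Lemma is_derive_expRN (x : R) : is_derive x 1 (fun t => expR (- t)) (- expR (- x)).
Proof.
have := @is_derive1_comp R (@expR R) (fun t => - t) x _ _ (is_derive_expR (- x)) (is_deriveN (is_derive_id x 1)).
by move/is_derive_eq; apply; rewrite /GRing.scale/= ?mulN1r ?mulrN1.
Qed.

(** An antiderivative of [expR (- x) * (1 + cos (s * x))] that vanishes at infinity. *)
Let F (s x : R) := - expR (- x) + expR (- x) * (s * sin (s * x) - cos (s * x)) / (1 + s ^+ 2).

Lemma is_derive_F (s x : R) : is_derive x 1 (F s) (expR (- x) * (1 + cos (s * x))).
Proof.
have s0 : 1 + s ^+ 2 != 0 by rewrite gt_eqF// ltr_pwDl// sqr_ge0.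
have dc := is_derive_cos_scale s x; have ds := is_derive_sin_scale s x.
have de := is_derive_expRN x.
apply: is_derive_eq.
rewrite /GRing.scale/=.
by field.
Qed.

Lemma cvg_F s : F s x @[x --> +oo] --> (0 : R).
Proof.
have s0 : 0 < 1 + s ^+ 2 by rewrite ltr_pwDl// sqr_ge0.
pose M := 1 + (`|s| + 1) / (1 + s ^+ 2).
have cM : expR (- x) * M @[x --> +oo] --> (0 : R).
  by rewrite -(mul0r M); apply: cvgM; [exact: cvgr_expR|exact: cvg_cst].
apply: (@squeeze_cvgr _ _ _ _ (fun x => - (expR (- x) * M)) (fun x => expR (- x) * M)) => //; last first.
  by rewrite -oppr0; exact: cvgN.
apply: nearW => x; rewrite -ler_norml /F /M [leRHS]mulrDr mulr1.
rewrite (le_trans (ler_normD _ _))// normrN ger0_norm ?expR_ge0// lerD2l.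
rewrite -mulrA normrM ger0_norm ?expR_ge0// ler_pM2l ?expR_gt0//.
rewrite normrM normfV (gtr0_norm s0) ler_pM2r ?invr_gt0//.
rewrite (le_trans (ler_normB _ _))// lerD ?cos_max// normrM.
by rewrite -[leRHS]mulr1 ler_wpM2l// sin_max.
Qed.

Let continuous_cos_scale (s : R) : continuous (fun x : R => cos (s * x)).
Proof.
move=> x; apply: continuous_comp; last exact: continuous_cos.
by apply: cvgM; [exact: cvg_cst|exact: cvg_id].
Qed.

Let continuous_G (s : R) : continuous (fun x : R => expR (- x) * (1 + cos (s * x))).
Proof.
move=> x; apply: cvgM.
  by apply: continuous_comp; [apply: cvgN; exact: cvg_id|exact: continuous_expR].
by apply: cvgD; [exact: cvg_cst|exact: continuous_cos_scale].
Qed.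

(** The summand 1 keeps the integrand nonnegative, as the fundamental theorem on the half-line
    applied here demands; [Rintegral_laplace_cos] takes it off again by linearity. *)
Lemma integral_laplace_pdf_cos s :
  (\int[leb]_x (laplace_pdf x * (1 + cos (s * x)))%:E = (1 + (1 + s ^+ 2)^-1)%:E)%E.
Proof.
have c1 t : 0 <= 1 + cos t :> R by rewrite -lerBlDl sub0r cos_geN1.
have mg : measurable_fun setT (fun x => laplace_pdf x * (1 + cos (s * x))).
  apply: measurable_funM; first exact: measurable_laplace_pdf.
  apply: measurable_funD => //; apply: continuous_measurable_fun.
  exact: continuous_cos_scale.
rewrite ge0_symfun_integralT; last 3 first.
- by move=> x; rewrite mulr_ge0// laplace_pdf_ge0.
- move=> x; apply: cvgM; first exact: continuous_laplace_pdf.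
  by apply: cvgD; [exact: cvg_cst|exact: continuous_cos_scale].
- by move=> x /=; rewrite /laplace_pdf normrN mulrN cosN.
rewrite -set_itvcy -ge0_integralZl//; last 2 first.
- by apply/measurable_EFinP; exact: measurable_funTS.
- by move=> x _; rewrite lee_fin mulr_ge0// laplace_pdf_ge0.
rewrite (eq_integral (fun x : rT => (expR (- x) * (1 + cos (s * x)))%:E)); last first.
  move=> x; rewrite inE/= in_itv/= andbT => x0; rewrite /laplace_pdf ger0_norm// -EFinM.
  by congr EFin; field.
rewrite (@ge0_continuous_FTC2y _ _ (F s) 0 0).
- rewrite sub0e -EFinN; congr EFin; rewrite /F !mulr0 oppr0 expR0 sin0 cos0 mulr0.
  by rewrite sub0r mul1r mulN1r opprD !opprK.
- by move=> x _; rewrite mulr_ge0 ?expR_ge0.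
- exact/continuous_subspaceT/continuous_G.
- exact: cvg_F.
- by move=> x _; have [] := is_derive_F s x.
- apply: cvg_at_right_filter; apply: differentiable_continuous.
  by apply/derivable1_diffP; have [] := is_derive_F s 0.
- by move=> x _; rewrite derive1E; have /(@derive_val _ _ _ _ _ _ _) -> := is_derive_F s x.
Qed.

Lemma integral_laplace_pdf : (\int[leb]_x (laplace_pdf x)%:E = 1)%E.
Proof.
have := integral_laplace_pdf_cos 0.
under eq_integral do rewrite mul0r cos0 EFinM.
rewrite ge0_integralZr//; last 2 first.
- by apply/measurable_EFinP; exact: measurable_laplace_pdf.
- by move=> x _; rewrite lee_fin laplace_pdf_ge0.
rewrite expr0n/= addr0 invr1 => H.
have : (0 <= \int[leb]_x (laplace_pdf x)%:E)%E.
  by apply: integral_ge0 => x _; rewrite lee_fin laplace_pdf_ge0.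
move: H; case: (integral _ _ _) => [r| |]//.
- by rewrite -EFinM => -[H] _; congr EFin; lra.
- by rewrite gt0_mulye// lte_fin.
Qed.

Definition laplace (V : set rT) : \bar R := (\int[leb]_(x in V) (laplace_pdf x)%:E)%E.

Let laplace0 : laplace set0 = 0%E.
Proof. by rewrite /laplace integral_set0. Qed.

Let laplace_ge0 A : (0 <= laplace A)%E.
Proof. by apply: integral_ge0 => x _; rewrite lee_fin laplace_pdf_ge0. Qed.

Let laplace_sigma_additive : semi_sigma_additive laplace.
Proof.
move=> /= G mG tG mUG; rewrite /laplace; apply: cvg_toP.
  apply: ereal_nondecreasing_is_cvgn => m n mn.
  apply: lee_sum_nneg_natr => // k _ _.
  by apply: integral_ge0 => /= x Fkx; rewrite lee_fin laplace_pdf_ge0.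
rewrite ge0_integral_bigcup//=.
- by apply/measurable_EFinP/measurable_funTS; exact: measurable_laplace_pdf.
- by move=> x _; rewrite lee_fin laplace_pdf_ge0.
Qed.

HB.instance Definition _ := isMeasure.Build _ _ _
  laplace laplace0 laplace_ge0 laplace_sigma_additive.

Let laplace_setT : laplace setT = 1%E.
Proof. exact: integral_laplace_pdf. Qed.

HB.instance Definition _ := @Measure_isProbability.Build _ _ R laplace laplace_setT.


Lemma laplace_le A : measurable A -> (laplace A <= 2^-1%:E * leb A)%E.
Proof.
move=> mA; rewrite -integral_cst//; apply: ge0_le_integral => //.
- by move=> x _; rewrite lee_fin laplace_pdf_ge0.
- by apply/measurable_EFinP/measurable_funTS; exact: measurable_laplace_pdf.
- by move=> x _; rewrite lee_fin /laplace_pdf ler_pdivrMr// mulVf// expR_le1 oppr_le0.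
Qed.

(** The Radon-Nikodym derivative of [laplace] agrees almost everywhere with [laplace_pdf], since
    both have the same integral over every measurable set. *)
Lemma integral_laplace (f : rT -> \bar R) : measurable_fun setT f ->
  (forall x, 0 <= f x)%E ->
  (\int[laplace]_x f x = \int[leb]_x (f x * (laplace_pdf x)%:E))%E.
Proof.
move=> mf f0.
have dom : laplace `<< leb.
  apply/null_content_dominatesP => A mA A0; apply/eqP; rewrite eq_le laplace_ge0 andbT.
  by have := laplace_le mA; rewrite A0 mule0.
rewrite -(Radon_Nikodym_SigmaFinite.change_of_variables dom f0)//.
have iR := Radon_Nikodym_SigmaFinite.f_integrable dom.
have mR := measurable_int _ iR.
have mL : measurable_fun setT (EFin \o laplace_pdf).
  by apply/measurable_EFinP; exact: measurable_laplace_pdf.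
apply: ae_eq_integral => //.
- exact: emeasurable_funM.
- exact: emeasurable_funM.
apply: ae_eqe_mul2l.
apply: integral_ae_eq => //.
by move=> E _ mE; rewrite -Radon_Nikodym_SigmaFinite.f_integral.
Qed.

Lemma le_integral_laplace (f : rT -> \bar R) : measurable_fun setT f ->
  (forall x, 0 <= f x)%E -> (\int[laplace]_x f x <= 2^-1%:E * \int[leb]_x f x)%E.
Proof.
move=> mf f0; rewrite integral_laplace// -ge0_integralZl//.
apply: ge0_le_integral => //.
- by move=> x _; rewrite mule_ge0// lee_fin laplace_pdf_ge0.
- by apply: emeasurable_funM => //; apply/measurable_EFinP; exact: measurable_laplace_pdf.
- exact: measurable_funeM.
move=> x _; rewrite muleC lee_wpmul2r// lee_fin.
by rewrite /laplace_pdf ler_pdivrMr// mulVf// expR_le1 oppr_le0.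
Qed.

Let measurable_scale (s : R) : measurable_fun setT (fun x : rT => s * x).
Proof. exact: measurable_funM. Qed.

Lemma measurable_cos : measurable_fun setT (@cos R).
Proof. by apply: continuous_measurable_fun; exact: continuous_cos. Qed.

Lemma measurable_sin : measurable_fun setT (@sin R).
Proof. by apply: continuous_measurable_fun; exact: continuous_sin. Qed.

Lemma integrable_cos_scale (P : probability rT R) s : P.-integrable setT (EFin \o (fun x => cos (s * x))).
Proof.
apply: (@bounded_integrable _ _ _ _ _ 1); last by move=> x; exact: cos_max.
exact: (measurableT_comp measurable_cos (measurable_scale s)).
Qed.

Lemma integrable_sin_scale (P : probability rT R) s : P.-integrable setT (EFin \o (fun x => sin (s * x))).
Proof.
apply: (@bounded_integrable _ _ _ _ _ 1); last by move=> x; exact: sin_max.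
exact: (measurableT_comp measurable_sin (measurable_scale s)).
Qed.

Lemma Rintegral_laplace_cos s : \int[laplace]_x cos (s * x) = (1 + s ^+ 2)^-1.
Proof.
have i1 : laplace.-integrable setT (EFin \o fun=> 1 : R).
  by apply: (@bounded_integrable _ _ _ _ _ 1) => // x; rewrite normr1.
apply: (@addrI _ (\int[laplace]_x 1)).
rewrite -RintegralD//; last exact: integrable_cos_scale.
rewrite [X in _ = X + _]Rintegral_cst// [X in fine X]laplace_setT mul1r.
rewrite /Rintegral integral_laplace.
- under eq_integral do rewrite -EFinM mulrC.
  by rewrite integral_laplace_pdf_cos.
- apply/measurable_EFinP; apply: measurable_funD => //.
  exact: (measurableT_comp measurable_cos (measurable_scale s)).
- by move=> x; rewrite lee_fin -lerBlDl sub0r cos_geN1.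
Qed.

Lemma laplaceN (A : set rT) : measurable A -> laplace [set x : R | A (- x)] = laplace A.
Proof.
move=> mA.
have mpdf : measurable_fun setT (fun x => (laplace_pdf x * \1_A x)%:E).
  apply/measurable_EFinP; apply: measurable_funM => //; exact: measurable_laplace_pdf.
have E B : measurable B -> laplace B = (\int[leb]_x (laplace_pdf x * \1_B x)%:E)%E.
  move=> mB; rewrite /laplace integral_mkcond; apply: eq_integral => x _.
  by rewrite epatch_indic EFinM.
rewrite !E//; last first.
  by rewrite -[X in measurable X]setTI; exact: oppr_measurable.
rewrite -[RHS]mul1e -[in RHS](invr1) -[in RHS](normr1 R) -[in RHS](normrN 1).
rewrite -(@integral_affine R (-1) 0 (fun x => (laplace_pdf x * \1_A x)%:E))//.
- by apply: eq_integral => x _; rewrite addr0 mulN1r /laplace_pdf normrN.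
- by move=> x; rewrite lee_fin mulr_ge0// laplace_pdf_ge0.
Qed.

Lemma Rintegral_laplace_sin s : \int[laplace]_x sin (s * x) = 0.
Proof.
suff : \int[laplace]_x sin (s * x) = - \int[laplace]_x sin (s * x).
  by move/eqP; rewrite -subr_eq0 opprK -mulr2n mulrn_eq0/= => /eqP.
rewrite -[RHS]mulN1r -RintegralZl//; last exact: integrable_sin_scale.
rewrite /Rintegral; congr fine.
pose push := measure_function_pushforward__canonical__measure_function_Measure
  laplace (measurable_affine (-1 : R) 0).
transitivity (\int[push]_x (sin (s * x))%:E)%E.
  apply: eq_measure_integral => A mA _; apply: etrans (esym (laplaceN mA)) _.
  congr (laplace _); apply/seteqP; split => x; rewrite /affine/= addr0 mulN1r//.
rewrite integral_pushforward//.
- rewrite preimage_setT; apply: eq_integral => x _.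
  by rewrite /affine/= addr0 mulN1r mulrN sinN mulN1r.
- apply/measurable_EFinP; exact: (measurableT_comp measurable_sin (measurable_scale s)).
- rewrite preimage_setT; apply: (@bounded_integrable _ _ _ _ _ 1); last by move=> x; exact: sin_max.
  apply: (measurableT_comp measurable_sin); apply: measurable_funM => //.
  exact: measurable_affine.
Qed.

(** The sine part vanishes by symmetry, so averaging over a Laplace phase multiplies cos t by a
    Cauchy kernel. Three such averages produce the kernel of [small_ball_fourier]. *)
Lemma Rintegral_laplace_cosD s t :
  \int[laplace]_x cos (t + s * x) = cos t / (1 + s ^+ 2).
Proof.
under eq_Rintegral do rewrite cosD.
rewrite RintegralB//; last 2 first.
- apply: (@bounded_integrable _ rT R laplace (fun x : rT => cos t * cos (s * x)) 1).
    apply: measurable_funM => //; exact: (measurableT_comp measurable_cos (measurable_scale s)).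
  by move=> x; rewrite normrM mulr_ile1// cos_max.
- apply: (@bounded_integrable _ rT R laplace (fun x : rT => sin t * sin (s * x)) 1).
    apply: measurable_funM => //; exact: (measurableT_comp measurable_sin (measurable_scale s)).
  by move=> x; rewrite normrM mulr_ile1// sin_max.
rewrite !RintegralZl//; [|exact: integrable_sin_scale|exact: integrable_cos_scale].
by rewrite Rintegral_laplace_cos Rintegral_laplace_sin mulr0 subr0.
Qed.

End laplace.

(** * Characteristic functions *)

Section bounded_fubini.
Context d1 d2 (T1 : measurableType d1) (T2 : measurableType d2) (R : realType).
Variables (P1 : probability T1 R) (P2 : probability T2 R).
Variables (f : T1 * T2 -> R) (M : R).
Hypotheses (mf : measurable_fun setT f) (fM : forall x, `|f x| <= M).

Let mf1 x : measurable_fun setT (fun y => f (x, y)).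
Proof. exact: (measurableT_comp mf (pair1_measurable x)). Qed.

Let mf2 y : measurable_fun setT (fun x => f (x, y)).
Proof. exact: (measurableT_comp mf (pair2_measurable y)). Qed.

Let if12 : (P1 \x P2)%E.-integrable setT (EFin \o f).
Proof. exact: (@bounded_integrable _ _ R (P1 \x P2)%E f M). Qed.

Lemma measurable_Rintegral : measurable_fun setT (fun x => \int[P2]_y f (x, y)).
Proof.
apply: (measurableT_comp (@fine_measurable R setT measurableT)).
exact: (measurable_fubini_F if12).
Qed.

Lemma Rintegral_swap :
  \int[P1]_x \int[P2]_y f (x, y) = \int[P2]_y \int[P1]_x f (x, y).
Proof.
rewrite /Rintegral; congr fine.
transitivity (\int[P1]_x \int[P2]_y (f (x, y))%:E)%E.
  apply: eq_integral => x _; rewrite fineK//; apply: integrable_fin_num => //.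
  exact: (@bounded_integrable _ _ _ P2 _ M).
rewrite (@Fubini _ _ _ _ _ P1 P2 (EFin \o f))//.
apply: eq_integral => y _; rewrite fineK//; apply: integrable_fin_num => //.
exact: (@bounded_integrable _ _ _ P1 _ M).
Qed.

End bounded_fubini.

Lemma Rintegral_prob_cst d (T : measurableType d) (R : realType) (P : probability T R)
    (r : R) : \int[P]_x r = r.
Proof.
rewrite Rintegral_cst// -[RHS]mulr1; congr (_ * _).
exact: (f_equal fine (probability_setT P)).
Qed.

Lemma Rintegral_bound d (T : measurableType d) (R : realType) (P : probability T R)
    (f : T -> R) (M : R) : measurable_fun setT f -> (forall x, `|f x| <= M) ->
  `|\int[P]_x f x| <= M.
Proof.
move=> mf fM; have fi := @bounded_integrable _ _ _ P _ M mf fM.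
apply: (le_trans (le_normr_Rintegral _ fi)) => //.
rewrite (le_trans (_ : _ <= \int[P]_x M))//.
  apply: le_Rintegral => //.
  - apply: (@bounded_integrable _ _ _ P _ M) => //.
      exact: (measurableT_comp (@normr_measurable R setT) mf).
    by move=> x; rewrite normr_id.
  - apply: (@bounded_integrable _ _ _ P _ M) => // x.
    by rewrite ger0_norm// (le_trans _ (fM x)).
by rewrite Rintegral_prob_cst.
Qed.

Section characteristic_function.
Context (R : realType).
Local Notation leb := (@lebesgue_measure R).
Local Notation rT := (measurableTypeR R).
Implicit Types (mu : probability rT R).

Definition cosI mu (s : R) : R := \int[mu]_x cos (s * x).
Definition sinI mu (s : R) : R := \int[mu]_x sin (s * x).
(* The squared modulus of the characteristic function of [mu]. *)
Definition chr2 mu (s : R) : R := cosI mu s ^+ 2 + sinI mu s ^+ 2.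

Lemma chr2_ge0 mu s : 0 <= chr2 mu s.
Proof. by rewrite addr_ge0 ?sqr_ge0. Qed.

Let msx : measurable_fun setT (fun p : rT * rT => p.1 * p.2 : rT).
Proof. exact: measurable_funM. Qed.

Lemma measurable_cosI mu : measurable_fun setT (cosI mu : rT -> rT).
Proof.
apply: (@measurable_Rintegral _ _ rT rT R mu mu (fun p => cos (p.1 * p.2)) 1).
  exact: (measurableT_comp (@measurable_cos R) msx).
by move=> x; exact: cos_max.
Qed.

Lemma measurable_sinI mu : measurable_fun setT (sinI mu : rT -> rT).
Proof.
apply: (@measurable_Rintegral _ _ rT rT R mu mu (fun p => sin (p.1 * p.2)) 1).
  exact: (measurableT_comp (@measurable_sin R) msx).
by move=> x; exact: sin_max.
Qed.

Lemma measurable_chr2 mu : measurable_fun setT (chr2 mu : rT -> rT).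
Proof.
apply: measurable_funD; apply: measurable_funX; [exact: measurable_cosI|exact: measurable_sinI].
Qed.

Lemma Rintegral_cosD mu t s :
  \int[mu]_x cos (s * x + t) = cosI mu s * cos t - sinI mu s * sin t.
Proof.
under eq_Rintegral do rewrite cosD.
have ic := integrable_cos_scale mu s; have jc := integrable_sin_scale mu s.
rewrite RintegralB//; last 2 first.
- exact: (integrableZr measurableT (cos t) ic).
- exact: (integrableZr measurableT (sin t) jc).
by rewrite !RintegralZr.
Qed.

Lemma Rintegral_sinD mu t s :
  \int[mu]_x sin (s * x + t) = sinI mu s * cos t + cosI mu s * sin t.
Proof.
under eq_Rintegral do rewrite sinD.
have ic := integrable_cos_scale mu s; have jc := integrable_sin_scale mu s.
rewrite RintegralD//; last 2 first.
- exact: (integrableZr measurableT (cos t) jc).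
- exact: (integrableZr measurableT (sin t) ic).
by rewrite !RintegralZr.
Qed.

(** Symmetrisation: the squared modulus is the characteristic function of the difference of two
    independent copies. *)
Lemma chr2_double mu s : chr2 mu s = \int[mu]_y \int[mu]_x cos (s * (x - y)).
Proof.
rewrite /chr2 !expr2 -[X in X + _]mulrC -[X in _ + X]mulrC.
under eq_Rintegral => y _.
  under eq_Rintegral do rewrite mulrBr.
  rewrite Rintegral_cosD cosN sinN mulrN opprK.
  over.
have ic := integrable_cos_scale mu s; have jc := integrable_sin_scale mu s.
rewrite RintegralD//; last 2 first.
- exact: (integrableZl measurableT (cosI mu s) ic).
- exact: (integrableZl measurableT (sinI mu s) jc).
by rewrite !RintegralZl.
Qed.

Let measurable_cosB s : measurable_fun setT (fun p : rT * rT => cos (s * (p.2 - p.1))).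
Proof.
apply: (measurableT_comp (@measurable_cos R)); apply: measurable_funM => //.
exact: measurable_funB.
Qed.

Lemma chr2_le1 mu s : chr2 mu s <= 1.
Proof.
rewrite chr2_double (le_trans (ler_norm _))//; apply: Rintegral_bound.
  apply: (@measurable_Rintegral _ _ rT rT R mu mu (fun p => cos (s * (p.2 - p.1))) 1) => //.
  by move=> x; exact: cos_max.
move=> y; apply: Rintegral_bound; last by move=> x; exact: cos_max.
exact: (measurableT_comp (@measurable_cosB s) (pair1_measurable y)).
Qed.

Section product.
Context (K : finType) (Q : probability (vec R K) R) (mu : K -> probability rT R).
Hypothesis Qmu : product_law Q mu.
Variable th : K -> R.

Let S (r : seq K) (x : vec R K) : R := \sum_(k <- r) th k * x k.

Lemma measurable_linear_form (r : seq K) : measurable_fun setT (S r : vec R K -> rT).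
Proof.
elim: r => [|k r ih].
  have -> : S [::] = fun=> 0 by apply/funext => x; rewrite /S big_nil.
  exact: measurable_cst.
have -> : S (k :: r) = fun x => th k * x k + S r x.
  by apply/funext => x; rewrite /S big_cons.
apply: measurable_funD => //; apply: measurable_funM => //.
exact: measurable_coord.
Qed.

Let mcos (r : seq K) : measurable_fun setT (fun x : vec R K => cos (S r x)).
Proof. exact: (measurableT_comp (@measurable_cos R) (measurable_linear_form r)). Qed.

Let msin (r : seq K) : measurable_fun setT (fun x : vec R K => sin (S r x)).
Proof. exact: (measurableT_comp (@measurable_sin R) (measurable_linear_form r)). Qed.

Let icos (r : seq K) : Q.-integrable setT (EFin \o (fun x : vec R K => cos (S r x))).
Proof. by apply: (@bounded_integrable _ _ _ _ _ 1) => // x; exact: cos_max. Qed.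

Let isin (r : seq K) : Q.-integrable setT (EFin \o (fun x : vec R K => sin (S r x))).
Proof. by apply: (@bounded_integrable _ _ _ _ _ 1) => // x; exact: sin_max. Qed.

Let S_upd k r t x : k \notin r -> S (k :: r) (upd k t x) = th k * t + S r x.
Proof.
move=> kr; rewrite /S big_cons {1}/upd eqxx; congr (_ + _).
apply: eq_big_seq => j jr; rewrite /upd; case: eqP => // jk.
by rewrite -jk jr in kr.
Qed.

(** Multiplicativity of the characteristic function under independence, with complex numbers written
    as pairs (cos, sin); the closing [ring] is |zw|^2 = |z|^2 |w|^2. *)
Lemma chr2_prod_seq (r : seq K) : uniq r ->
  (\int[Q]_x cos (S r x)) ^+ 2 + (\int[Q]_x sin (S r x)) ^+ 2 =
  \prod_(k <- r) chr2 (mu k) (th k).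
Proof.
elim: r => [_|k r ih /= /andP[kr /ih {}ih]].
  rewrite /S big_nil; under eq_Rintegral do rewrite big_nil cos0.
  under [in X in _ + X]eq_Rintegral do rewrite big_nil sin0.
  by rewrite !Rintegral_prob_cst expr1n expr0n addr0.
rewrite big_cons -ih (@Rintegral_upd R K k Q mu (fun x => cos (S (k :: r) x)) 1 Qmu)//; last by move=> x; exact: cos_max.
rewrite (@Rintegral_upd R K k Q mu (fun x => sin (S (k :: r) x)) 1 Qmu)//; last by move=> x; exact: sin_max.
under eq_Rintegral => x _.
  under eq_Rintegral do rewrite S_upd//.
  rewrite Rintegral_cosD.
  over.
under [in X in _ + X]eq_Rintegral => x _.
  under eq_Rintegral do rewrite S_upd//.
  rewrite Rintegral_sinD.
  over.
rewrite RintegralB//; last 2 first.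
- exact: (integrableZl measurableT (cosI (mu k) (th k)) (icos r)).
- exact: (integrableZl measurableT (sinI (mu k) (th k)) (isin r)).
rewrite RintegralD//; last 2 first.
- exact: (integrableZl measurableT (sinI (mu k) (th k)) (icos r)).
- exact: (integrableZl measurableT (cosI (mu k) (th k)) (isin r)).
rewrite !RintegralZl// /chr2; ring.
Qed.

Lemma Rintegral_cos_le :
  \int[Q]_x cos (\sum_k th k * x k) <= \prod_k Num.sqrt (chr2 (mu k) (th k)).
Proof.
rewrite -[leRHS]ger0_norm; last by apply: prodr_ge0 => k _; exact: sqrtr_ge0.
apply: (le_trans (ler_norm _)); rewrite -(ler_pXn2r (n := 2)) ?nnegrE// !real_normK ?num_real//.
rewrite -prodrXl (eq_bigr (fun k => chr2 (mu k) (th k))); last first.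
  by move=> k _; rewrite sqr_sqrtr// chr2_ge0.
have := chr2_prod_seq (index_enum_uniq K); rewrite /S => <-.
by rewrite lerDl sqr_ge0.
Qed.

End product.

End characteristic_function.

Section integral_chr2.
Context (R : realType).
Local Notation leb := (@lebesgue_measure R).
Local Notation rT := (measurableTypeR R).

(** Domination by Lebesgue measure replaces a density function, so that none has to be carried
    along. *)
Definition bounded_density (L : R) (mu : probability rT R) :=
  forall A : set rT, measurable A -> (mu A <= L%:E * leb A)%E.

Lemma le_integral_bounded_density L mu (f : rT -> \bar R) : 0 <= L ->
  bounded_density L mu -> measurable_fun setT f -> (forall x, 0 <= f x)%E ->
  (\int[mu]_x f x <= L%:E * \int[leb]_x f x)%E.
Proof.
move=> L0 muL mf f0.
pose m2 : {measure set rT -> \bar R} := mscale (NngNum L0) leb.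
apply: (@le_trans _ _ (\int[m2]_x f x)%E); last by rewrite ge0_integral_mscale.
by apply: ge0_le_measure_integral.
Qed.

Lemma continuous_cauchy : continuous (fun x : R => (1 + x ^+ 2)^-1).
Proof. exact: continuous_oneDsqrV. Qed.

Lemma cauchy_ge0 (x : R) : 0 <= (1 + x ^+ 2)^-1.
Proof. by rewrite invr_ge0 addr_ge0 ?sqr_ge0. Qed.

Lemma cauchy_le1 (x : R) : (1 + x ^+ 2)^-1 <= 1.
Proof. by rewrite invf_le1 ?lerDl ?sqr_ge0// ltr_pwDl ?sqr_ge0. Qed.

Lemma measurable_cauchy : measurable_fun setT (fun x : rT => (1 + x ^+ 2)^-1 : rT).
Proof. by apply: continuous_measurable_fun; exact: continuous_cauchy. Qed.

Lemma integral_cauchy : (\int[leb]_x ((1 + x ^+ 2)^-1)%:E = pi%:E)%E.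
Proof.
rewrite ge0_symfun_integralT; last 3 first.
- exact: cauchy_ge0.
- exact: continuous_cauchy.
- by move=> x /=; rewrite sqrrN.
rewrite -set_itvcy (_ : (\int[_]_(x in _) _ = (pi / 2)%:E)%E); last exact: integral0y_oneDsqr.
by rewrite -EFinM mulrC divfK.
Qed.

Lemma integral_cauchy_affine (m a : R) : 0 < m ->
  (\int[leb]_x ((1 + (m * x + a) ^+ 2)^-1)%:E = (pi / m)%:E)%E.
Proof.
move=> m0; rewrite (@integral_affine R m a (fun x => ((1 + x ^+ 2)^-1)%:E)) ?gt_eqF//.
- by rewrite integral_cauchy gtr0_norm// -EFinM mulrC.
- by apply/measurable_EFinP; exact: measurable_cauchy.
- by move=> x; rewrite lee_fin cauchy_ge0.
Qed.

Section chr2_L1.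
Variables (L : R) (mu : probability rT R).
Hypotheses (L0 : 0 <= L) (muL : bounded_density L mu).

(** By [chr2_double] and Fubini the Laplace average of cos(N u (x - y)) over u becomes the Cauchy
    kernel at N (x - y). Its integral in x against a density at most L is at most L pi / N,
    uniformly in y. *)
Let integral_laplace_chr2 (N : R) : 0 < N ->
  (\int[@laplace R]_u (chr2 mu (N * u))%:E <= (L * pi / N)%:E)%E.
Proof.
move=> N0.
have mchr : measurable_fun setT (fun u : rT => chr2 mu (N * u) : rT).
  apply: (measurableT_comp (@measurable_chr2 R mu)); exact: measurable_funM.
have ichr : (@laplace R).-integrable setT (EFin \o (fun u : rT => chr2 mu (N * u) : rT)).
  by apply: (@bounded_integrable _ _ _ _ _ 1) => // x; rewrite ger0_norm ?chr2_ge0// chr2_le1.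
rewrite -[leLHS]fineK; last exact: integrable_fin_num.
rewrite lee_fin -[X in X <= _]/(\int[@laplace R]_u (chr2 mu (N * u))).
have mB : measurable_fun setT (fun p : rT * rT * rT => cos (N * p.1.1 * (p.2 - p.1.2))).
  have m1 : measurable_fun setT (fun p : rT * rT * rT => p.1.1) by exact: measurableT_comp.
  have m2 : measurable_fun setT (fun p : rT * rT * rT => p.1.2) by exact: measurableT_comp.
  apply: (measurableT_comp (@measurable_cos R)); apply: measurable_funM.
    exact: measurable_funM.
  exact: measurable_funB.
under eq_Rintegral do rewrite chr2_double.
have mI : measurable_fun setT (fun p : rT * rT => \int[mu]_x cos (N * p.1 * (x - p.2))).
  apply: (@measurable_Rintegral _ _ (rT * rT)%type rT R (@laplace R \x mu)%E mu
    (fun p => cos (N * p.1.1 * (p.2 - p.1.2))) 1) => //.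
  by move=> x; exact: cos_max.
rewrite (@Rintegral_swap _ _ rT rT R (@laplace R) mu (fun p => \int[mu]_x cos (N * p.1 * (x - p.2))) 1)//; last first.
  move=> p; apply: Rintegral_bound; last by move=> x; exact: cos_max.
  exact: (measurableT_comp mB (pair1_measurable p)).
have E y : \int[@laplace R]_u \int[mu]_x cos (N * u * (x - y)) = \int[mu]_x (1 + (N * x + - (N * y)) ^+ 2)^-1.
  have mA : measurable_fun setT (fun p : rT * rT => cos (N * p.1 * (p.2 - y))).
    apply: (measurableT_comp mB (_ : measurable_fun setT (fun p : rT * rT => ((p.1, y), p.2)))).
    by apply: measurable_fun_pair => //; apply: measurable_fun_pair.
  rewrite (@Rintegral_swap _ _ rT rT R (@laplace R) mu (fun p => cos (N * p.1 * (p.2 - y))) 1)//; last first.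
    by move=> x; exact: cos_max.
  apply: eq_Rintegral => x _; rewrite -mulrBr -Rintegral_laplace_cos.
  by apply: eq_Rintegral => u _ /=; rewrite mulrAC.
under eq_Rintegral do rewrite E.
have mC : measurable_fun setT (fun p : rT * rT => (1 + (N * p.2 + - (N * p.1)) ^+ 2)^-1 : rT).
  apply: (measurableT_comp measurable_cauchy).
  by apply: measurable_funD; [exact: measurable_funM|apply: measurableT_comp => //; exact: measurable_funM].
have bC y x : `|(1 + (N * x + - (N * y)) ^+ 2)^-1| <= 1.
  by rewrite ger0_norm ?cauchy_ge0// cauchy_le1.
have mC1 y : measurable_fun setT (fun x : rT => (1 + (N * x + - (N * y)) ^+ 2)^-1 : rT).
  exact: (measurableT_comp mC (pair1_measurable y)).
apply: le_trans (ler_norm _) _; apply: Rintegral_bound.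
  by apply: (@measurable_Rintegral _ _ rT rT R mu mu (fun p => (1 + (N * p.2 + - (N * p.1)) ^+ 2)^-1) 1).
move=> y; rewrite ger0_norm; last by apply: Rintegral_ge0 => x _; exact: cauchy_ge0.
rewrite -lee_fin /Rintegral fineK; last first.
  by apply: integrable_fin_num => //; exact: (@bounded_integrable _ _ _ mu _ 1 (mC1 y) (bC y)).
apply: (le_trans (le_integral_bounded_density L0 muL _ _)).
- by apply/measurable_EFinP; exact: mC1.
- by move=> x; rewrite lee_fin cauchy_ge0.
by rewrite integral_cauchy_affine// -EFinM mulrA.
Qed.

Let I (n : nat) : set rT := `[- n.+1%:R, n.+1%:R]%classic.

(** On |s| <= N the weight 2e [laplace_pdf] (s / N) is at least 1; rescaling by N cancels the 1 / N
    of the smoothed bound. *)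
Let chr2_itv (n : nat) :
  (\int[leb]_(s in I n) (chr2 mu s)%:E <= (2 * expR 1 * (L * pi))%:E)%E.
Proof.
pose N : R := n.+1%:R; have N0 : 0 < N by rewrite ltr0n.
have mpdf : measurable_fun setT (fun s : rT => laplace_pdf (s / N) * chr2 mu s).
  apply: measurable_funM; last exact: measurable_chr2.
  by apply: (measurableT_comp (@measurable_laplace_pdf R)); exact: measurable_funM.
apply: (@le_trans _ _ ((2 * expR 1)%:E * \int[leb]_s (laplace_pdf (s / N) * chr2 mu s)%:E)%E).
  have e0 : (0 <= (2 * expR 1 : R)%:E)%E by rewrite lee_fin mulr_ge0// expR_ge0.
  rewrite integral_mkcond -ge0_integralZl//; last 2 first.
  - exact/measurable_EFinP.
  - by move=> s _; rewrite lee_fin mulr_ge0 ?laplace_pdf_ge0 ?chr2_ge0.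
  apply: ge0_le_integral => //.
  - move=> s _; rewrite patchE; case: ifP => // _; by rewrite lee_fin chr2_ge0.
  - apply/(measurable_restrictT _ _).1; first exact: measurable_itv.
    by apply/measurable_EFinP/measurable_funTS; exact: measurable_chr2.
  - by apply: measurable_funeM; exact/measurable_EFinP.
  move=> s _; rewrite patchE; case: ifPn => [|_]; last first.
    by rewrite -EFinM lee_fin !mulr_ge0 ?laplace_pdf_ge0 ?chr2_ge0 ?expR_ge0.
  rewrite inE /I/= in_itv/= -ler_norml => sN; rewrite -EFinM lee_fin mulrA.
  rewrite ler_peMl ?chr2_ge0// /laplace_pdf.
  rewrite (_ : 2 * expR 1 * _ = expR (1 - `|s / N|)); last by rewrite expRD; field.
  rewrite -[leLHS](@expR0 R) ler_expR subr_ge0.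
  by rewrite normrM normfV [X in _ / X]gtr0_norm// ler_pdivrMr// mul1r.
rewrite [leRHS]EFinM lee_wpmul2l//.
have -> : (\int[leb]_s (laplace_pdf (s / N) * chr2 mu s)%:E =
    N%:E * \int[leb]_u (chr2 mu (N * u) * laplace_pdf u)%:E)%E.
  have mh : measurable_fun setT (fun s : rT => (laplace_pdf (s / N) * chr2 mu s)%:E).
    exact/measurable_EFinP.
  have h0 s : (0 <= (laplace_pdf (s / N) * chr2 mu s)%:E)%E.
    by rewrite lee_fin mulr_ge0 ?laplace_pdf_ge0 ?chr2_ge0.
  have := integral_affine 0 (lt0r_neq0 N0) mh h0.
  rewrite gtr0_norm// => E.
  under [in RHS]eq_integral => u _.
    rewrite mulrC (_ : laplace_pdf u = laplace_pdf ((N * u + 0) / N)); last first.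
      by rewrite addr0 mulrC mulKf// gt_eqF.
    rewrite (_ : chr2 mu (N * u) = chr2 mu (N * u + 0)); last by rewrite addr0.
    over.
  by rewrite E muleA -EFinM divff ?gt_eqF// mul1e.
have := integral_laplace_chr2 N0; rewrite integral_laplace; last 2 first.
- apply/measurable_EFinP; apply: (measurableT_comp (@measurable_chr2 R mu)).
  exact: measurable_funM.
- by move=> x; rewrite lee_fin chr2_ge0.
under eq_integral do rewrite -EFinM.
move=> /(lee_wpmul2l (_ : (0 <= N%:E)%E)) H.
apply: (le_trans (H _)); first by rewrite lee_fin ltW.
by rewrite -EFinM mulrC divfK// gt_eqF.
Qed.

(** Plancherel's bound, with 2e pi L instead of 2 pi L: the Laplace smoothing replaces Fourier
    inversion and costs the factor e. *)
Lemma integral_chr2_le : (\int[leb]_s (chr2 mu s)%:E <= (2 * expR 1 * (L * pi))%:E)%E.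
Proof.
have cv := @ge0_nondecreasing_set_cvg_integral _ rT R
  I (EFin \o chr2 mu) leb.
have U : \bigcup_n I n = [set: rT].
  apply/seteqP; split => // x _; exists (Num.truncn `|x|) => //; rewrite /I/=.
  by rewrite in_itv/= -ler_norml ltW// truncnS_gt.
rewrite U in cv; apply: (cvge_le _ (cv _ _ _ _)).
- by apply: nearW => n; exact: chr2_itv.
- by move=> n m nm; apply/subsetPset => x; rewrite /I /= !in_itv/= -!ler_norml => /le_trans; apply;
    rewrite ler_nat.
- by move=> n; exact: measurable_itv.
- by move=> n; apply/measurable_EFinP/measurable_funTS; exact: measurable_chr2.
- by move=> n x _; rewrite lee_fin chr2_ge0.
Qed.

End chr2_L1.
End integral_chr2.

(** * Integrability of powers of characteristic functions *)

Lemma absz_shift (z : int) (M : nat) : (absz z <= M)%N ->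
  (absz (z + M%:Z)%R < M.*2.+1)%N /\ 0 <= z + M%:Z.
Proof. by move=> zM; split; lia. Qed.

Section chr2_decay.
Context (R : realType).
Local Notation leb := (@lebesgue_measure R).
Local Notation rT := (measurableTypeR R).

(** Monotonicity of cos on [0, pi] reduces to v = d; then 1 - cos d = 2 sin(d/2)^2, and the mean
    value theorem gives sin(d/2) >= cos(1) d/2. *)
Lemma one_sub_cos_ge (v d : R) : 0 <= d <= 1 -> d <= `|v| <= pi ->
  cos 1 ^+ 2 / 2 * d ^+ 2 <= 1 - cos v.
Proof.
move=> /andP[d0 d1] /andP[dv vpi].
have pi1 : 1 <= pi :> R by rewrite (le_trans _ (@pi_ge2 R))// ler1n.
apply: (@le_trans _ _ (1 - cos d)); last first.
  rewrite lerD2l lerN2 -(cos_norm v); move: dv; rewrite le_eqVlt => /predU1P[->//|dv].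
  by apply: ltW; rewrite ltr_cos// in_itv/= ?d0 ?normr_ge0 ?vpi// (le_trans d1).
have -> : 1 - cos d = sin (d / 2) ^+ 2 * 2.
  have {1}-> : d = (d / 2) *+ 2 by rewrite -mulr_natr divfK.
  by rewrite cos_mulr2n sin2cos2; ring.
move: d0; rewrite le_eqVlt => /predU1P[<-|d0].
  by rewrite expr0n/= mulr0 mul0r sin0 expr0n/= mul0r.
have d20 : 0 < d / 2 by rewrite divr_gt0.
have [x] := @MVT R (@sin R) (@cos R) 0 (d / 2) d20
  (fun x _ => is_derive_sin x) (continuous_subspaceT (@continuous_sin R)).
rewrite in_itv/= sin0 !subr0 => /andP[x0 xd] ->.
have x1 : x < 1 by rewrite (lt_le_trans xd)// ler_pdivrMr// mul1r (le_trans d1)// ler1n.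
have cx : cos 1 <= cos x.
  by apply: ltW; rewrite ltr_cos// in_itv/= ?ler01 ?pi1// (ltW x0)/= (le_trans (ltW x1)).
rewrite exprMn (_ : _ / 2 * _ = cos 1 ^+ 2 * (d / 2) ^+ 2 * 2); last by field.
rewrite ler_pM2r// ler_pM2r ?exprn_gt0// ler_pXn2r ?nnegrE//.
  exact/ltW/cos1_gt0.
exact/ltW/(lt_le_trans _ cx)/cos1_gt0.
Qed.

Let pi_div_2pi : pi / (pi *+ 2) = 2^-1 :> R.
Proof. by rewrite -[pi *+ 2]mulr_natr invfM mulrA divff ?gt_eqF ?pi_gt0// mul1r. Qed.

Lemma cos_nearest (u : R) :
  exists m : int, `|u - m%:~R * (pi *+ 2)| <= pi /\ cos u = cos (u - m%:~R * (pi *+ 2)).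
Proof.
have p0 : 0 < pi *+ 2 :> R by rewrite mulrn_wgt0// pi_gt0.
pose m := Num.floor (u / (pi *+ 2) + 2^-1).
exists m; split.
  have := floor_itv (u / (pi *+ 2) + 2^-1); rewrite -/m => /andP[m1 m2].
  have {m1} m1 : m%:~R * (pi *+ 2) <= u + pi.
    rewrite -ler_pdivlMr//; apply: (le_trans m1); rewrite mulrDl lerD2l.
    by rewrite pi_div_2pi.
  have {m2} m2 : u + pi < (m%:~R + 1) * (pi *+ 2).
    rewrite -ltr_pdivrMr//; move: m2; rewrite intrD; apply: le_lt_trans; rewrite mulrDl lerD2l.
    by rewrite pi_div_2pi.
  rewrite ler_norml; apply/andP; split.
    by rewrite lerBrDr addrC lerBlDr.
  by rewrite lerBlDr; move: m2; rewrite mulrDl mul1r mulr2n; lra.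
have P (n : nat) (w : R) : cos (w + n%:R * (pi *+ 2)) = cos w.
  by rewrite mulr_natl; exact: (periodicn (@cosD2pi R)).
case: m => n.
  by rewrite -[in LHS](subrK (n%:~R * (pi *+ 2)) u) P.
by rewrite NegzE mulrNz mulNr opprK P.
Qed.

Lemma Rintegral_ge_indic d (T : measurableType d) (P : probability T R)
    (f : T -> R) (M k : R) (G : set T) : measurable G ->
  measurable_fun setT f -> (forall x, `|f x| <= M) -> (forall x, 0 <= f x) ->
  (forall x, G x -> k <= f x) -> ((k%:E * P G)%E <= (\int[P]_x f x)%:E)%E.
Proof.
move=> mG mf fM f0 kf.
have fi := @bounded_integrable _ _ _ P _ M mf fM.
rewrite /Rintegral fineK; last exact: integrable_fin_num.
rewrite -integral_cst//.
apply: (@le_trans _ _ (\int[P]_(x in G) (f x)%:E)%E).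
  apply: le_integral => //; last by move=> x; rewrite inE => Gx; rewrite lee_fin kf.
    apply: (integrableS measurableT) => //; apply: (@bounded_integrable _ _ _ P (cst k) `|k|) => //.
  exact: (integrableS measurableT).
apply: ge0_subset_integral => //.
  exact/measurable_EFinP.
by move=> x _; rewrite lee_fin.
Qed.

(** * A quantitative gap between a characteristic function and 1 *)

Section gap.
Variables (L : R) (mu : probability rT R).
Hypotheses (L0 : 0 < L) (muL : bounded_density L mu).
Hypothesis (var1 : (\int[mu]_x (x ^+ 2)%:E <= 1)%E).

Let I : set rT := `[-2, 2]%classic.
Let mI : measurable I. Proof. exact: measurable_itv. Qed.

(** Chebyshev's inequality at distance 2. *)
Let mu_I : ((3 / 4)%:E <= mu I)%E.
Proof.
have mx2 : measurable_fun setT (fun x : rT => (x ^+ 2)%:E).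
  by apply/measurable_EFinP; apply: measurable_funX.
have H : (4%:E * mu (~` I) <= 1)%E.
  apply: le_trans var1; rewrite -integral_cst; last exact: measurableC.
  apply: (@le_trans _ _ (\int[mu]_(x in ~` I) (x ^+ 2)%:E)%E); last first.
    apply: ge0_subset_integral => //; first exact: measurableC.
    by move=> x _; rewrite lee_fin sqr_ge0.
  apply: ge0_le_integral => //.
  - exact: measurableC.
  - by move=> x _; rewrite lee_fin.
  - exact: (measurable_funTS mx2).
  move=> x; rewrite /I/= in_itv/= -ler_norml => /negP; rewrite -ltNge => x2.
  rewrite lee_fin -[leRHS](real_normK (num_real x)) (_ : 4 = 2 ^+ 2 :> R)//; last by ring.
  by rewrite ler_pXn2r ?nnegrE// ltW.
have := probability_setC mu mI; move: H.
have /fineK <- : mu I \is a fin_num by exact: fin_num_measure.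
have /fineK <- : mu (~` I) \is a fin_num by apply: fin_num_measure; exact: measurableC.
rewrite -EFinB -EFinM !lee_fin => H [E]; lra.
Qed.

(** The 32 makes the bad set in [chr2_gap] have measure at most 8 L delta <= 1/4. *)
Let delta : R := Num.min 1 ((32 * L)^-1).
Let delta_gt0 : 0 < delta. Proof. by rewrite lt_min ltr01 invr_gt0 mulr_gt0. Qed.

(** 3/16 is the product of the 1/2 of [one_sub_cos_ge], of the mass 1/2 of good points x, and of the
    mass 3/4 of points y. *)
Definition gap : R := 3 / 16 * cos 1 ^+ 2 * (Num.min 1 ((32 * L)^-1)) ^+ 2.

Lemma gap_gt0 : 0 < gap.
Proof.
apply: mulr_gt0; last exact/exprn_gt0/delta_gt0.
by apply: mulr_gt0; [lra|exact/exprn_gt0/cos1_gt0].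
Qed.

(** Neighbourhoods of the points x with s (x - y) in 2 pi Z; the natural number i encodes the
    integer i - M. *)
Let lat (s y r : R) (M i : nat) : set rT :=
  `[y + (i%:R - M%:R) * (pi *+ 2) / s - r, y + (i%:R - M%:R) * (pi *+ 2) / s + r]%classic.

Let mlat s y r M i : measurable (lat s y r M i). Proof. exact: measurable_itv. Qed.

Let near_lattice (s y r : R) (M : nat) : 0 <= r ->
  (mu (\big[setU/set0]_(i < M.*2.+1) lat s y r M i)
   <= (L * (M.*2.+1%:R * (r *+ 2)))%:E)%E.
Proof.
move=> r0; apply: le_trans.
  by apply: (@Boole_inequality _ _ _ mu (fun i : nat => lat s y r M i)).
apply: (@le_trans _ _ (\sum_(i < M.*2.+1) (L * (r *+ 2))%:E)%E).
  apply: lee_sum => i _; apply: le_trans (muL (@mlat _ _ _ _ _)) _.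
  rewrite /lat lebesgue_measure_itv/=; case: ifPn => _.
    by rewrite -EFinB -EFinM lee_fin ler_pM2l// mulr2n; lra.
  by rewrite mule0 lee_fin mulr_ge0// ?(ltW L0)// mulrn_wge0.
rewrite sumEFin lee_fin sumr_const card_ord -mulr_natl; lra.
Qed.

(** 1 - |phi|^2 is the mean of 1 - cos(s (x - y)). For y in [-2, 2], this is bounded below unless x
    is close to the lattice y + (2 pi / s) Z; the bounded density gives the part of that
    neighbourhood which matters mass at most 1/4, so half of the mass consists of good points x in
    [-2, 2]. *)
Lemma chr2_gap (s : R) : gap * Num.min 1 (s ^+ 2) <= 1 - chr2 mu s.
Proof.
have [->|s0] := eqVneq s 0.
  rewrite expr0n/= min_r ?ler01// mulr0 subr_ge0; exact: chr2_le1.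
have as0 : 0 < `|s| by rewrite normr_gt0.
have pi0 := @pi_gt0 R; have pi2 := @pi_ge2 R.
pose m := Num.min 1 `|s|; pose d := delta * m.
have m0 : 0 < m by rewrite lt_min ltr01.
have d0 : 0 < d by rewrite mulr_gt0.
have d1 : d <= 1.
  by apply: mulr_ile1; [exact: ltW|exact: ltW|rewrite /delta ge_min lexx|rewrite /m ge_min lexx].
(* For x, y in [-2, 2] the phase s (x - y) has modulus at most 4 |s|, so the multiple of 2 pi
   nearest to it has index at most M in modulus. *)
pose M := Num.truncn (4 * `|s| / (pi *+ 2) + 2^-1).
pose k := cos 1 ^+ 2 / 2 * d ^+ 2.
have k0 : 0 <= k by rewrite mulr_ge0 ?divr_ge0 ?sqr_ge0.
have M1 : M%:R <= 4 * `|s| / (pi *+ 2) + 2^-1.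
  have : 0 <= 4 * `|s| / (pi *+ 2) + 2^-1.
    by rewrite addr_ge0// divr_ge0 ?mulr_ge0// mulrn_wge0// ltW.
  by move=> /truncn_itv/andP[].
(* The factor m = min(1, |s|) in d keeps the total width linear in |s| for |s| < 1 too, where the
   number of lattice points stops shrinking. *)
have M2 : (M.*2.+1)%:R * d <= 4 * delta * `|s|.
  have H : (M.*2.+1)%:R <= 2 * `|s| + 2.
    rewrite -addn1 natrD -muln2 natrM; apply: (@le_trans _ _ ((4 * `|s| / (pi *+ 2) + 2^-1) * 2 + 1)).
      by rewrite lerD2r ler_pM2r.
    have : 4 * `|s| / (pi *+ 2) <= `|s|.
      have pp0 : 0 < pi *+ 2 :> R by rewrite mulrn_wgt0.
      rewrite ler_pdivrMr// mulr2n; nra.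
    by lra.
  apply: (@le_trans _ _ ((2 * `|s| + 2) * d)); first by rewrite ler_pM2r.
  rewrite (_ : (2 * `|s| + 2) * d = delta * ((2 * `|s| + 2) * m)); last by rewrite /d; ring.
  rewrite (_ : 4 * delta * `|s| = delta * (4 * `|s|)); last by ring.
  rewrite ler_pM2l// /m; have [s1|s1] := leP 1 `|s|; first by lra.
  by nra.
have key y : I y -> ((k / 2)%:E <= (\int[mu]_x (1 - cos (s * (x - y))))%:E)%E.
  move=> Iy.
  pose Bad := \big[setU/set0]_(i < M.*2.+1) lat s y (d / `|s|) M i.
  have mBad : measurable Bad by apply: bigsetU_measurable => i _; exact: mlat.
  have muBad : (mu Bad <= (1 / 4)%:E)%E.
    apply: (le_trans (@near_lattice s y (d / `|s|) M _)); first by rewrite divr_ge0 ?ltW.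
    rewrite lee_fin.
    have E : L * ((M.*2.+1)%:R * ((d / `|s|) *+ 2)) = L * 2 * ((M.*2.+1)%:R * d) / `|s|.
      by rewrite -mulr_natr; ring.
    rewrite E ler_pdivrMr//; apply: (@le_trans _ _ (L * 2 * (4 * delta * `|s|))).
      by rewrite ler_pM2l// mulr_gt0.
    rewrite (_ : L * 2 * _ = (8 * (L * delta)) * `|s|); last by ring.
    rewrite ler_pM2r//; suff : L * delta <= 1 / 32 by lra.
    apply: (@le_trans _ _ (L * (32 * L)^-1)); first by rewrite ler_pM2l// ge_min lexx orbT.
    by rewrite invfM mulrCA divff ?gt_eqF// mulr1 mul1r.
  have muG : ((1 / 2)%:E <= mu (I `\` Bad))%E.
    have mID : measurable (I `\` Bad) by exact: measurableD.
    have : (mu I <= mu (I `\` Bad) + mu Bad)%E.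
      rewrite -measureU//; last by rewrite setDKI.
      apply: le_measure; rewrite ?inE//; first exact: measurableU.
      by move=> x Ix; have [Bx|Bx] := pselect (Bad x); [right|left].
    move: mu_I muBad.
    have /fineK <- : mu I \is a fin_num by exact: fin_num_measure.
    have /fineK <- : mu (I `\` Bad) \is a fin_num by exact: fin_num_measure.
    have /fineK <- : mu Bad \is a fin_num by exact: fin_num_measure.
    by rewrite -EFinD !lee_fin; lra.
  have mcos : measurable_fun setT (fun x : rT => 1 - cos (s * (x - y))).
    apply: measurable_funB => //; apply: (measurableT_comp (@measurable_cos R)).
    by apply: measurable_funM => //; exact: measurable_funB.
  apply: le_trans (@Rintegral_ge_indic _ rT mu (fun x : rT => 1 - cos (s * (x - y))) 2 k (I `\` Bad) _ mcos _ _ _).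
  - rewrite -[k / 2]/(k * 2^-1) EFinM lee_wpmul2l//; apply: le_trans muG; by rewrite lee_fin; lra.
  - exact: measurableD.
  - move=> x; rewrite ger0_norm ?subr_ge0 ?cos_le1//.
    by have := cos_geN1 (s * (x - y)); lra.
  - by move=> x; rewrite subr_ge0 cos_le1.
  move=> x [Ix nBx].
  have [z [zpi ->]] := cos_nearest (s * (x - y)).
  apply: one_sub_cos_ge; first by rewrite (ltW d0).
  rewrite zpi andbT leNgt; apply/negP => zd; apply: nBx.
  have xy4 : `|s * (x - y)| <= 4 * `|s|.
    rewrite normrM mulrC ler_pM2r//; move: Ix Iy; rewrite /I/= !in_itv/= => /andP[? ?] /andP[? ?].
    by rewrite ler_norml; apply/andP; split; lra.
  have pp0 : 0 < pi *+ 2 :> R by rewrite mulrn_wgt0.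
  have zM : (`|z| <= M)%N.
    rewrite truncn_ge_nat; last by rewrite addr_ge0// divr_ge0 ?mulr_ge0 ?(ltW pp0).
    rewrite natr_absz intr_norm.
    have : `|z%:~R| * (pi *+ 2) <= 4 * `|s| + pi :> R.
      rewrite -[X in _ * X](gtr0_norm pp0) -normrM.
      rewrite -[z%:~R * _](subKr (s * (x - y))) (le_trans (ler_normB _ _))//.
      exact: lerD.
    rewrite -ler_pdivlMr// mulrDl => /le_trans; apply; rewrite lerD2l.
    by rewrite pi_div_2pi.
  have [i [iM zi]] : exists i : nat, (i < M.*2.+1)%N /\ z%:~R = i%:R - M%:R :> R.
    have [zM1 zM2] := absz_shift zM.
    exists (absz (z + M%:Z)); split => //.
    by rewrite natr_absz ger0_norm// intrD addrK.
  rewrite /Bad -bigcup_mkord; exists i => //; rewrite /lat/= in_itv/= -zi.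
  have E : x - y - z%:~R * (pi *+ 2) / s = (s * (x - y) - z%:~R * (pi *+ 2)) / s by field.
  have : `|x - y - z%:~R * (pi *+ 2) / s| <= d / `|s|.
    by rewrite E normrM normfV ler_pM2r ?invr_gt0// ltW.
  by rewrite ler_norml => /andP[? ?]; apply/andP; split; lra.
have c2 p : `|1 - cos p| <= 2 :> R.
  by rewrite ger0_norm ?subr_ge0 ?cos_le1//; have := cos_geN1 p; lra.
have mc : measurable_fun setT (fun p : rT * rT => 1 - cos (s * (p.2 - p.1)) : rT).
  apply: measurable_funB => //; apply: (measurableT_comp (@measurable_cos R)).
  by apply: measurable_funM => //; exact: measurable_funB.
have mI1 : measurable_fun setT (fun y : rT => \int[mu]_x (1 - cos (s * (x - y)))).
  by apply: (@measurable_Rintegral _ _ rT rT R mu mu (fun p => 1 - cos (s * (p.2 - p.1))) 2).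
have mc1 y : measurable_fun setT (fun x : rT => 1 - cos (s * (x - y)) : rT).
  exact: (measurableT_comp mc (pair1_measurable y)).
have -> : 1 - chr2 mu s = \int[mu]_y \int[mu]_x (1 - cos (s * (x - y))).
  have ione : mu.-integrable setT (EFin \o fun=> 1 : R).
    by apply: (@bounded_integrable _ _ _ mu _ 1) => // x; rewrite normr1.
  have mcc : measurable_fun setT (fun p : rT * rT => cos (s * (p.2 - p.1)) : rT).
    apply: (measurableT_comp (@measurable_cos R)).
    by apply: measurable_funM => //; exact: measurable_funB.
  have mcc1 y : measurable_fun setT (fun x : rT => cos (s * (x - y)) : rT).
    exact: (measurableT_comp mcc (pair1_measurable y)).
  rewrite chr2_double -[X in X - _](Rintegral_prob_cst mu 1) -RintegralB//; last first.
    apply: (@bounded_integrable _ rT R mu (fun y : rT => \int[mu]_x cos (s * (x - y))) 1).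
      apply: (@measurable_Rintegral _ _ rT rT R mu mu (fun p => cos (s * (p.2 - p.1))) 1) => //.
      by move=> p; exact: cos_max.
    by move=> y; apply: Rintegral_bound => [|x]; [exact: mcc1|exact: cos_max].
  apply: eq_Rintegral => y _.
  rewrite -[X in X - _](Rintegral_prob_cst mu 1) -RintegralB//.
  apply: (@bounded_integrable _ rT R mu (fun x : rT => cos (s * (x - y))) 1 (mcc1 y)).
  by move=> x; exact: cos_max.
have H := @Rintegral_ge_indic _ rT mu _ 2 (k / 2) I mI mI1.
rewrite -lee_fin; apply: le_trans (H _ _ _).
- apply: (@le_trans _ _ ((k / 2)%:E * (3 / 4)%:E)%E); last first.
    by rewrite lee_wpmul2l// lee_fin divr_ge0.
  rewrite -EFinM lee_fin /gap /k /d -/delta.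
  have -> : Num.min 1 (s ^+ 2) = m ^+ 2.
    rewrite /m -(real_normK (num_real s)).
    have [s1|s1] := leP 1 `|s|; first by rewrite expr1n min_l// exprn_ege1.
    by rewrite min_r// exprn_ile1// ltW.
  rewrite exprMn; apply: eq_le_refl; by field.
- by move=> y; apply: Rintegral_bound => [|x]; [exact: mc1|exact: c2].
- by move=> y; apply: Rintegral_ge0 => x _; rewrite subr_ge0 cos_le1.
- by move=> y Iy; rewrite -lee_fin; exact: key.
Qed.


Let powR_le_expR (z w q : R) : 0 <= q -> 0 <= z -> z <= 1 - w -> z `^ q <= expR (- (q * w)).
Proof.
move=> q0 z0 zw; rewrite /powR; case: eqP => [z00|/eqP zn0].
  by case: eqP => [->|_]; rewrite ?mul0r ?oppr0 ?expR0 ?expR_ge0.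
rewrite ler_expR -mulrN ler_wpM2l//.
have zp : 0 < z by rewrite lt_neqAle eq_sym zn0.
have := expR_ge1Dx (ln z); rewrite lnK ?posrE//; lra.
Qed.

Let powR_splitS (z q : R) : 1 <= q -> 0 <= z -> z `^ q = z * z `^ (q - 1).
Proof.
move=> q1 z0; have [->|zn0] := eqVneq z 0; first by rewrite powR0 ?mul0r// gt_eqF// (lt_le_trans ltr01).
have zp : 0 < z by rewrite lt_neqAle eq_sym zn0.
rewrite /powR (negbTE zn0) -[X in _ = X * _](@lnK R z) ?posrE// -expRD; congr expR; ring.
Qed.

(** Obtained from pi / a + (e^gap / a) 2e L pi with a = sqrt(gap / (2 lam)), after taking out sqrt
    lam. *)
Definition decay_cst : R :=
  (pi + expR gap * (2 * expR 1 * (L * pi))) / Num.sqrt gap * Num.sqrt 2.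

Lemma measurable_chr2_powR q : measurable_fun setT (fun s : rT => chr2 mu s `^ q : rT).
Proof. exact: (measurableT_comp (measurable_powR q) (@measurable_chr2 R mu)). Qed.

(* Near the origin the characteristic function is dominated by a Gaussian of
   variance [~ 1/q] (by [chr2_gap]); away from it, by a power of a constant
   smaller than 1, the remaining factor being integrable by [integral_chr2_le]. *)
Lemma integral_chr2_powR (lam : R) : 0 < lam -> lam <= 2^-1 ->
  (\int[leb]_s (chr2 mu s `^ (2 * lam)^-1)%:E <= (decay_cst * Num.sqrt lam)%:E)%E.
Proof.
move=> lam0 lam2; set q := (2 * lam)^-1.
have g0 := gap_gt0.
have q1 : 1 <= q by rewrite /q invf_ge1 ?mulr_gt0//; lra.
have q0 : 0 < q by rewrite (lt_le_trans ltr01).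
have gq0 : 0 < gap * q by rewrite mulr_gt0.
set a := Num.sqrt (gap * q); have a0 : 0 < a by rewrite sqrtr_gt0.
have a2 : a ^+ 2 = gap * q by rewrite sqr_sqrtr// ltW.
pose B := expR gap / a; have B0 : 0 <= B by rewrite divr_ge0 ?expR_ge0 ?ltW.
(* For s^2 <= 1 the bound exp(- gap q s^2) lies below the Cauchy kernel at a s. Beyond, one factor
   [chr2] is kept for integrability and the power q - 1 is at most e^gap / a, because exp(gap q) >=
   1 + a^2 >= a. *)
have pw s : chr2 mu s `^ q <= (1 + (a * s + 0) ^+ 2)^-1 + B * chr2 mu s.
  have z0 := chr2_ge0 mu s; have gp := chr2_gap s; have q0' := ltW q0.
  have Bz : 0 <= B * chr2 mu s by exact: mulr_ge0.
  have [s1|s1] := leP (s ^+ 2) 1.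
    rewrite min_r// in gp.
    have zw : chr2 mu s <= 1 - gap * s ^+ 2 by lra.
    apply: (le_trans (powR_le_expR q0' z0 zw)); rewrite -[leLHS]addr0; apply: lerD => //.
    rewrite expRN lef_pV2 ?posrE ?expR_gt0 ?ltr_pwDl ?sqr_ge0//.
    by apply: le_trans (expR_ge1Dx _); rewrite addr0 exprMn a2 lerD2l; lra.
  have m1 : Num.min 1 (s ^+ 2) = 1 by apply/min_idPl; exact: ltW.
  rewrite m1 mulr1 in gp.
  have zw : chr2 mu s <= 1 - gap by lra.
  rewrite powR_splitS// -[leLHS]add0r; apply: lerD; first exact: cauchy_ge0.
  rewrite mulrC ler_wpM2r//.
  have q10 : 0 <= q - 1 by lra.
  apply: (le_trans (powR_le_expR q10 z0 zw)).
  rewrite (_ : - _ = gap - gap * q); last by ring.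
  rewrite expRD expRN /B ler_wpM2l ?expR_ge0// lef_pV2 ?posrE ?expR_gt0//.
  apply: le_trans (expR_ge1Dx _); rewrite -a2; nra.
have mp := @measurable_chr2_powR q.
have mc : measurable_fun setT (fun s : rT => (1 + (a * s + 0) ^+ 2)^-1 : rT).
  by apply: (measurableT_comp (@measurable_cauchy R)); apply: measurable_funD => //; exact: measurable_funM.
have mBc : measurable_fun setT (fun s : rT => B * chr2 mu s : rT).
  by apply: measurable_funM => //; exact: measurable_chr2.
apply: (@le_trans _ _ (\int[leb]_s (((1 + (a * s + 0) ^+ 2)^-1)%:E + (B * chr2 mu s)%:E))%E).
  apply: ge0_le_integral => //.
  - by move=> s _; rewrite lee_fin powR_ge0.
  - exact/measurable_EFinP.
  - by apply: emeasurable_funD; exact/measurable_EFinP.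
  - by move=> s _; rewrite -EFinD lee_fin.
rewrite ge0_integralD//; last 4 first.
- by move=> s _; rewrite lee_fin cauchy_ge0.
- exact/measurable_EFinP.
- by move=> s _; rewrite lee_fin mulr_ge0 ?chr2_ge0.
- exact/measurable_EFinP.
rewrite integral_cauchy_affine//.
under eq_integral do rewrite EFinM.
rewrite ge0_integralZl//; last 2 first.
- by apply/measurable_EFinP; exact: measurable_chr2.
- by move=> s _; rewrite lee_fin chr2_ge0.
apply: (@le_trans _ _ ((pi / a)%:E + B%:E * (2 * expR 1 * (L * pi))%:E)%E).
  rewrite leeD2l// lee_wpmul2l//.
  by apply: integral_chr2_le => //; exact: ltW.
rewrite -EFinM -EFinD lee_fin /B /decay_cst.
have s2 : 0 < Num.sqrt 2 :> R by rewrite sqrtr_gt0.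
have sg : 0 < Num.sqrt gap by rewrite sqrtr_gt0.
have sl : 0 < Num.sqrt lam by rewrite sqrtr_gt0.
have aE : a = Num.sqrt gap * Num.sqrt q by rewrite /a sqrtrM// ltW.
have qE : Num.sqrt q = (Num.sqrt 2 * Num.sqrt lam)^-1.
  apply: (@mulIf _ (Num.sqrt 2 * Num.sqrt lam)); first by rewrite mulf_neq0// gt_eqF.
  rewrite mulVf ?mulf_neq0 ?gt_eqF// -!sqrtrM//; last exact: ltW.
  by rewrite /q mulVf ?sqrtr1// mulf_neq0// gt_eqF.
rewrite aE qE; apply: eq_le_refl; field; rewrite !gt_eqF//.
Qed.

End gap.
End chr2_decay.

(** * A Fourier bound for three linear forms *)

Lemma EFin_Rintegral d (T : measurableType d) (R : realType) (P : probability T R)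
    (f : T -> R) (M : R) : measurable_fun setT f -> (forall x, `|f x| <= M) ->
  ((\int[P]_x f x)%:E = \int[P]_x (f x)%:E)%E.
Proof.
move=> mf fM; rewrite /Rintegral fineK//; apply: integrable_fin_num => //.
exact: (@bounded_integrable _ _ _ P _ M).
Qed.

Lemma measurable_sqrtr (R : realType) :
  measurable_fun setT (Num.sqrt : measurableTypeR R -> measurableTypeR R).
Proof. by apply: continuous_measurable_fun; exact: sqrt_continuous. Qed.

Section iterated_Rintegral3.
Context d (T : measurableType d) (R : realType) (P : probability T R) (M : R).
Implicit Types f g : T * T * T -> R.

Let sect1 f x y : measurable_fun setT f -> measurable_fun setT (fun z => f (x, y, z)).
Proof.
move=> mf.
exact: (measurableT_comp mf (pair1_measurable (x, y))).
Qed.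

Let int1 f : measurable_fun setT f -> (forall p, `|f p| <= M) ->
  measurable_fun setT (fun p : T * T => \int[P]_z f (p, z)).
Proof. by move=> mf fM; exact: (@measurable_Rintegral _ _ _ _ R (P \x P)%E P f M). Qed.

Let int1_le f : measurable_fun setT f -> (forall p, `|f p| <= M) ->
  forall p : T * T, `|\int[P]_z f (p, z)| <= M.
Proof. by move=> mf fM [x y]; apply: Rintegral_bound => //; exact: sect1. Qed.

Let sect2 f x : measurable_fun setT f -> (forall p, `|f p| <= M) ->
  measurable_fun setT (fun y => \int[P]_z f (x, y, z)).
Proof.
move=> mf fM.
exact: (measurableT_comp (int1 mf fM) (pair1_measurable x)).
Qed.

Let int2 f : measurable_fun setT f -> (forall p, `|f p| <= M) ->
  measurable_fun setT (fun x => \int[P]_y \int[P]_z f (x, y, z)).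
Proof.
move=> mf fM.
exact: (@measurable_Rintegral _ _ _ _ R P P (fun p => \int[P]_z f (p, z)) M (int1 mf fM) (int1_le mf fM)).
Qed.

Let int2_le f : measurable_fun setT f -> (forall p, `|f p| <= M) ->
  forall x, `|\int[P]_y \int[P]_z f (x, y, z)| <= M.
Proof.
move=> mf fM x; apply: Rintegral_bound; first exact: sect2.
by move=> y; exact: (int1_le mf fM (x, y)).
Qed.

Lemma EFin_Rintegral3 f : measurable_fun setT f -> (forall p, `|f p| <= M) ->
  ((\int[P]_x \int[P]_y \int[P]_z f (x, y, z))%:E =
   \int[P]_x \int[P]_y \int[P]_z (f (x, y, z))%:E)%E.
Proof.
move=> mf fM; rewrite (EFin_Rintegral _ (int2 mf fM) (int2_le mf fM)).
apply: eq_integral => x _.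
rewrite (EFin_Rintegral _ (sect2 x mf fM) (fun y => int1_le mf fM (x, y))).
apply: eq_integral => y _; apply: (EFin_Rintegral _ (M := M)) => //; exact: sect1.
Qed.

Lemma le_Rintegral3 f g : measurable_fun setT f -> (forall p, `|f p| <= M) ->
  measurable_fun setT g -> (forall p, `|g p| <= M) -> (forall p, f p <= g p) ->
  \int[P]_x \int[P]_y \int[P]_z f (x, y, z) <= \int[P]_x \int[P]_y \int[P]_z g (x, y, z).
Proof.
move=> mf fM mg gM fg; apply: le_Rintegral => //.
- exact: (bounded_integrable P (int2 mf fM) (int2_le mf fM)).
- exact: (bounded_integrable P (int2 mg gM) (int2_le mg gM)).
move=> x _; apply: le_Rintegral => //.
- exact: (bounded_integrable P (sect2 x mf fM) (fun y => int1_le mf fM (x, y))).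
- exact: (bounded_integrable P (sect2 x mg gM) (fun y => int1_le mg gM (x, y))).
move=> y _; apply: le_Rintegral => //.
- by apply: (bounded_integrable P (M := M)) => //; exact: sect1.
- by apply: (bounded_integrable P (M := M)) => //; exact: sect1.
Qed.

End iterated_Rintegral3.

Section fourier.
Context (R : realType).
Local Notation leb := (@lebesgue_measure R).
Local Notation rT := (measurableTypeR R).
Local Notation zeta := (@laplace R).

Lemma le_integral_laplace3 (f : rT * rT * rT -> \bar R) : measurable_fun setT f ->
  (forall x, 0 <= f x)%E ->
  (\int[zeta]_x \int[zeta]_y \int[zeta]_z f (x, y, z) <=
   8^-1%:E * \int[leb]_x \int[leb]_y \int[leb]_z f (x, y, z))%E.
Proof.
move=> mf f0.
have h2 : (0 <= (2^-1 : R)%:E)%E by rewrite lee_fin invr_ge0.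
pose F1 (p : rT * rT) := (\int[zeta]_z f (p, z))%E.
pose F2 (p : rT * rT) := (\int[leb]_z f (p, z))%E.
have mF1 : measurable_fun setT F1 by exact: (measurable_fun_fubini_tonelli_F f mf f0).
have mF2 : measurable_fun setT F2 by exact: (measurable_fun_fubini_tonelli_F f mf f0).
have F10 p : (0 <= F1 p)%E by exact: integral_ge0.
have F20 p : (0 <= F2 p)%E by exact: integral_ge0.
have F12 p : (F1 p <= 2^-1%:E * F2 p)%E.
  apply: le_integral_laplace => //.
  exact: (measurableT_comp mf (pair1_measurable p)).
have m2 x : measurable_fun setT (fun y : rT => F2 (x, y)).
  exact: (measurableT_comp mF2 (pair1_measurable x)).
have m1 x : measurable_fun setT (fun y : rT => F1 (x, y)).
  exact: (measurableT_comp mF1 (pair1_measurable x)).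
have h4 : (0 <= (4^-1 : R)%:E)%E by rewrite lee_fin invr_ge0.
pose G1 x := (\int[zeta]_y F1 (x, y))%E; pose G2 x := (\int[leb]_y F2 (x, y))%E.
have mG1 : measurable_fun setT G1 by exact: (measurable_fun_fubini_tonelli_F F1 mF1 F10).
have mG2 : measurable_fun setT G2 by exact: (measurable_fun_fubini_tonelli_F F2 mF2 F20).
have G10 x : (0 <= G1 x)%E by exact: integral_ge0.
have G20 x : (0 <= G2 x)%E by exact: integral_ge0.
have H x : (G1 x <= 4^-1%:E * G2 x)%E.
  apply: (@le_trans _ _ (2^-1%:E * \int[leb]_y F1 (x, y))%E); first exact: le_integral_laplace.
  rewrite (_ : 4^-1 = 2^-1 * 2^-1 :> R); last by field.
  rewrite EFinM -muleA lee_wpmul2l//.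
  apply: (@le_trans _ _ (\int[leb]_y (2^-1%:E * F2 (x, y)))%E); last by rewrite ge0_integralZl.
  by apply: ge0_le_integral => //; exact: measurable_funeM.
rewrite -/G1.
apply: (@le_trans _ _ (2^-1%:E * \int[leb]_x G1 x)%E); first exact: le_integral_laplace.
rewrite (_ : 8^-1 = 2^-1 * 4^-1 :> R); last by field.
rewrite EFinM -muleA lee_wpmul2l//.
apply: (@le_trans _ _ (\int[leb]_x (4^-1%:E * G2 x))%E); last by rewrite ge0_integralZl.
by apply: ge0_le_integral => //; exact: measurable_funeM.
Qed.

Section small_ball_fourier.
Context (K : finType) (Q : probability (vec R K) R) (mu : K -> probability rT R).
Hypothesis Qmu : product_law Q mu.
Variables a b c : K -> R.

Let form (a : K -> R) (x : vec R K) : R := \sum_k a k * x k.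

Let measurable_form a0 : measurable_fun setT (form a0 : vec R K -> rT).
Proof. exact: measurable_linear_form. Qed.

(** The Cauchy kernel is the characteristic function of the Laplace law. Fubini therefore turns the
    mean of the product kernel into a Laplace average of the characteristic function of the three
    forms, which factors over the coordinates up to taking moduli. The 1/8 from the kernel on the
    cube cancels the 1/8 from the Laplace density being at most 1/2 in each of three variables. *)
Lemma small_ball_fourier :
  (Q [set x : vec R K | (`|\sum_k a k * x k| <= 1 /\ `|\sum_k b k * x k| <= 1 /\
                        `|\sum_k c k * x k| <= 1)%R]
   <= \int[leb]_x \int[leb]_y \int[leb]_z
        (\prod_k Num.sqrt (chr2 (mu k) (a k * x + b k * y + c k * z)))%R%:E)%E.
Proof.
pose A := [set x : vec R K | `|form a x| <= 1 /\ `|form b x| <= 1 /\ `|form c x| <= 1].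
rewrite -/A.
have mball a0 : measurable [set x : vec R K | `|form a0 x| <= 1].
  rewrite (_ : [set x | _] = form a0 @^-1` `[-1, 1]%classic).
    by rewrite -[X in measurable X]setTI; exact: measurable_form.
  by apply/seteqP; split => x /=; rewrite in_itv/= ler_norml.
have mA : measurable A by exact: (measurableI _ _ (mball a) (measurableI _ _ (mball b) (mball c))).
pose kap (y : R) := (1 + y ^+ 2)^-1.
pose G (x : vec R K) := kap (form a x) * kap (form b x) * kap (form c x).
have mkap a0 : measurable_fun setT (fun x : vec R K => kap (form a0 x) : rT).
  exact: (measurableT_comp (@measurable_cauchy R) (measurable_form a0)).
have mG : measurable_fun setT (G : vec R K -> rT).
  by apply: measurable_funM; [apply: measurable_funM|]; exact: mkap.
have kap0 y : 0 <= kap y := cauchy_ge0 y.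
have kap1 y : kap y <= 1 := cauchy_le1 y.
have kap2 y : `|y| <= 1 -> 2^-1 <= kap y.
  move=> y1; rewrite /kap lef_pV2 ?posrE ?ltr_pwDl ?sqr_ge0//.
  by rewrite -[leRHS]/(1 + 1) lerD2l -(real_normK (num_real y)) exprn_ile1.
have G0 x : 0 <= G x by rewrite !mulr_ge0.
have G1 x : `|G x| <= 1 by rewrite ger0_norm// !mulr_ile1// mulr_ge0.
(* Markov's inequality for the kernel, which is at least 1/8 on the cube *)
have step1 : (8^-1%:E * Q A <= (\int[Q]_x G x)%:E)%E.
  apply: (@Rintegral_ge_indic R _ _ Q G 1 8^-1 A mA mG G1 G0) => x [xa [xb xc]].
  rewrite (_ : 8^-1 = 2^-1 * 2^-1 * 2^-1 :> R); last by field.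
  apply: ler_pM; rewrite ?mulr_ge0 ?invr_ge0//; last exact: kap2.
  by apply: ler_pM; rewrite ?invr_ge0//; exact: kap2.
pose th (p : rT * rT * rT) k := a k * p.1.1 + b k * p.1.2 + c k * p.2.
have thE p x : \sum_k th p k * x k = form a x * p.1.1 + form b x * p.1.2 + form c x * p.2.
  rewrite /form !mulr_suml -!big_split/=; apply: eq_bigr => k _; rewrite /th; ring.
have m11 : measurable_fun setT (fun p : rT * rT * rT => p.1.1) by exact: measurableT_comp.
have m12 : measurable_fun setT (fun p : rT * rT * rT => p.1.2) by exact: measurableT_comp.
have mth k : measurable_fun setT (fun p => th p k).
  by apply: measurable_funD; [apply: measurable_funD|]; exact: measurable_funM.
have mC : measurable_fun setT (fun q : vec R K * (rT * rT * rT) => cos (\sum_k th q.2 k * q.1 k)).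
  apply: (measurableT_comp (@measurable_cos R)).
  apply: measurable_sum => k; apply: measurable_funM.
    exact: (measurableT_comp (mth k) (@measurable_snd _ _ _ _)).
  exact: (measurableT_comp (measurable_coord k) (@measurable_fst _ _ _ _)).
have C1 q : `|cos (\sum_k th q.2 k * q.1 k)| <= 1 :> R by exact: cos_max.
pose cs (x : vec R K) (s1 s2 s3 : rT) := cos (\sum_k th (s1, s2, s3) k * x k).
have step2 x : G x = \int[zeta]_s1 \int[zeta]_s2 \int[zeta]_s3 cs x s1 s2 s3.
  under eq_Rintegral => s1 _.
    under eq_Rintegral => s2 _.
      under eq_Rintegral do rewrite /cs thE/=.
      rewrite Rintegral_laplace_cosD.
      over.
    rewrite RintegralZr//=; last first.
      apply: (@bounded_integrable _ rT R zeta (fun y : rT => cos (form a x * s1 + form b x * y)) 1).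
        apply: (measurableT_comp (@measurable_cos R)).
        by apply: measurable_funD => //; exact: measurable_funM.
      by move=> y; exact: cos_max.
    rewrite Rintegral_laplace_cosD -mulrA.
    over.
  by rewrite RintegralZr ?Rintegral_laplace_cos ?mulrA//; exact: integrable_cos_scale.
pose H p := \prod_k Num.sqrt (chr2 (mu k) (th p k)).
have mH : measurable_fun setT (H : _ -> rT).
  apply: measurable_prod => k _.
  apply: (measurableT_comp (@measurable_sqrtr R)).
  exact: (measurableT_comp (@measurable_chr2 R (mu k)) (mth k)).
have H0 p : 0 <= H p by apply: prodr_ge0 => k _; exact: sqrtr_ge0.
have H1 p : `|H p| <= 1.
  rewrite ger0_norm//; apply: prodr_ile1 => k _; rewrite sqrtr_ge0/=.
  by rewrite -[leRHS]sqrtr1 ler_sqrt// chr2_le1.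
have mC4 : measurable_fun setT (fun q : vec R K * rT * rT * rT => cs q.1.1.1 q.1.1.2 q.1.2 q.2).
  have mq : measurable_fun setT (fun q : vec R K * rT * rT * rT => (q.1.1.1, (q.1.1.2, q.1.2, q.2))).
    apply: measurable_fun_pair; first by do 2 apply: measurableT_comp => //.
    apply: measurable_fun_pair => //; apply: measurable_fun_pair; last exact: measurableT_comp.
    by do 2 apply: measurableT_comp => //.
  exact: (measurableT_comp mC mq).
have cs1 (x : vec R K) s1 s2 s3 : `|cs x s1 s2 s3| <= 1 by exact: cos_max.
have mI3 : measurable_fun setT (fun q : vec R K * rT * rT => \int[zeta]_s3 cs q.1.1 q.1.2 q.2 s3).
  exact: (@measurable_Rintegral _ _ _ _ R (Q \x zeta \x zeta)%E zeta (fun q => cs q.1.1.1 q.1.1.2 q.1.2 q.2) 1).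
have bI3 (x : vec R K) s1 s2 : `|\int[zeta]_s3 cs x s1 s2 s3| <= 1.
  apply: Rintegral_bound => //; exact: (measurableT_comp mC4 (pair1_measurable (x, s1, s2))).
have mI2 : measurable_fun setT (fun q : vec R K * rT => \int[zeta]_s2 \int[zeta]_s3 cs q.1 q.2 s2 s3).
  exact: (@measurable_Rintegral _ _ _ _ R (Q \x zeta)%E zeta (fun q => \int[zeta]_s3 cs q.1.1 q.1.2 q.2 s3) 1).
have bI2 (x : vec R K) s1 : `|\int[zeta]_s2 \int[zeta]_s3 cs x s1 s2 s3| <= 1.
  apply: Rintegral_bound => //; exact: (measurableT_comp mI3 (pair1_measurable (x, s1))).
have step3 : \int[Q]_x G x = \int[zeta]_s1 \int[zeta]_s2 \int[zeta]_s3 \int[Q]_x cs x s1 s2 s3.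
  under eq_Rintegral do rewrite step2.
  rewrite (@Rintegral_swap _ _ _ _ R Q zeta (fun q => \int[zeta]_s2 \int[zeta]_s3 cs q.1 q.2 s2 s3) 1)//=.
  apply: eq_Rintegral => s1 _.
  have ms1 : measurable_fun setT (fun q : vec R K * rT => (q.1, s1, q.2)).
    by apply: measurable_fun_pair => //; apply: measurable_fun_pair.
  rewrite (@Rintegral_swap _ _ _ _ R Q zeta (fun q => \int[zeta]_s3 cs q.1 s1 q.2 s3) 1)//=; last first.
    exact: (measurableT_comp mI3 ms1).
  apply: eq_Rintegral => s2 _.
  have ms2 : measurable_fun setT (fun q : vec R K * rT => (q.1, s1, s2, q.2)).
    by do 2 apply: measurable_fun_pair => //; apply: measurable_fun_pair.
  rewrite (@Rintegral_swap _ _ _ _ R Q zeta (fun q => cs q.1 s1 s2 q.2) 1)//=.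
  exact: (measurableT_comp mC4 ms2).
have mq3 : measurable_fun setT (fun p : rT * rT * rT => \int[Q]_x cs x p.1.1 p.1.2 p.2).
  apply: (@measurable_Rintegral _ _ _ _ R (zeta \x zeta \x zeta)%E Q (fun q => cs q.2 q.1.1.1 q.1.1.2 q.1.2) 1) => //.
  have -> : (fun q : rT * rT * rT * vec R K => cs q.2 q.1.1.1 q.1.1.2 q.1.2) =
      (fun q : vec R K * (rT * rT * rT) => cos (\sum_k th q.2 k * q.1 k)) \o (fun q => (q.2, q.1)).
    by apply/funext => -[[[s1 s2] s3] x].
  by apply: measurableT_comp => //; exact: measurable_fun_pair.
have bq3 p : `|\int[Q]_x cs x p.1.1 p.1.2 p.2| <= 1.
  apply: Rintegral_bound => //.
  have mp : measurable_fun setT (fun x : vec R K => (x, (p.1.1, p.1.2, p.2))).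
    by apply: measurable_fun_pair.
  exact: (measurableT_comp mC mp).
have step4 : \int[Q]_x G x <= \int[zeta]_s1 \int[zeta]_s2 \int[zeta]_s3 H (s1, s2, s3).
  rewrite step3; apply: (@le_Rintegral3 _ _ R zeta 1 (fun p => \int[Q]_x cs x p.1.1 p.1.2 p.2) H) => //.
  by move=> p; exact: Rintegral_cos_le.
have step5 : ((\int[zeta]_s1 \int[zeta]_s2 \int[zeta]_s3 H (s1, s2, s3))%:E <=
    8^-1%:E * \int[leb]_x \int[leb]_y \int[leb]_z (H (x, y, z))%:E)%E.
  rewrite (EFin_Rintegral3 zeta mH H1).
  apply: (@le_integral_laplace3 (fun p => (H p)%:E)); first exact/measurable_EFinP.
  by move=> p; rewrite lee_fin.
have : (8^-1%:E * Q A <= 8^-1%:E * \int[leb]_x \int[leb]_y \int[leb]_z (H (x, y, z))%:E)%E.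
  by apply: le_trans step5; apply: (le_trans step1); rewrite lee_fin.
by rewrite lee_pmul2l// lte_fin invr_gt0.
Qed.

End small_ball_fourier.

End fourier.

(** * Geometric Brascamp-Lieb by the arithmetic-geometric mean inequality *)

(** Average the tangent line of exp at the mean m. *)
Lemma jensen_expR (R : realType) (I : finType) (w l : I -> R) :
  (forall i, 0 <= w i) -> \sum_i w i = 1 ->
  expR (\sum_i w i * l i) <= \sum_i w i * expR (l i).
Proof.
move=> w0 w1; set m := \sum_i w i * l i.
have H i : w i * (expR m * (1 + (l i - m))) <= w i * expR (l i).
  rewrite ler_wpM2l// [X in _ <= expR X](_ : l i = m + (l i - m)); last by ring.
  rewrite expRD ler_wpM2l ?expR_ge0//.
  exact: expR_ge1Dx.
apply: le_trans (ler_sum _ (fun i _ => H i)).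
apply: eq_le_refl.
under eq_bigr do rewrite mulrCA mulrDr mulr1 mulrBr.
rewrite -mulr_sumr big_split/= w1 sumrB -/m -mulr_suml w1 mul1r subrr addr0 mulr1//.
Qed.

Section weighted_amgm.
Context (R : realType) (K : finType).
Implicit Type J : K * K * K.

Definition mult J (k : K) : nat := ((J.1.1 == k) + (J.1.2 == k) + (J.2 == k))%N.

(** The expected number of occurrences of k in a random triple of law w; the total over k is 3, not
    1. *)
Definition marginal (w : K * K * K -> R) (k : K) : R := \sum_J w J * (mult J k)%:R.

Lemma marginal_ge0 w k : (forall J, 0 <= w J) -> 0 <= marginal w k.
Proof. by move=> w0; apply: sumr_ge0 => J _; rewrite mulr_ge0. Qed.

Lemma sum_mult J (h : K -> R) : h J.1.1 + h J.1.2 + h J.2 = \sum_k (mult J k)%:R * h k.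
Proof.
have E j : h j = \sum_k (j == k)%:R * h k.
  rewrite (bigD1 j)//= eqxx mul1r big1 ?addr0// => k kj.
  by rewrite eq_sym (negbTE kj) mul0r.
rewrite (E J.1.1) (E J.1.2) (E J.2) -!big_split/=; apply: eq_bigr => k _.
by rewrite /mult !natrD !mulrDl.
Qed.

Variable w : K * K * K -> R.
Hypotheses (w0 : forall J, 0 <= w J) (w1 : \sum_J w J = 1).
Let lam := marginal w.

Lemma sum_marginal : \sum_k lam k = 3.
Proof.
rewrite /lam /marginal exchange_big/= (eq_bigr (fun J => w J * 3)); last first.
  move=> J _; rewrite -mulr_sumr; congr (_ * _).
  have := sum_mult J (fun=> 1); under [in X in _ = X]eq_bigr do rewrite mulr1.
  by move=> <-; ring.
by rewrite -mulr_suml w1 mul1r.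
Qed.

Lemma marginal_gt0 J k : w J != 0 -> (0 < mult J k)%N -> 0 < lam k.
Proof.
move=> wJ mJ; rewrite /lam /marginal (bigD1 J)//= ltr_pwDl//.
  by rewrite mulr_gt0 ?ltr0n// lt_neqAle eq_sym wJ w0.
by apply: sumr_ge0 => I _; rewrite mulr_ge0.
Qed.

(** With h_k = ln(t_k) / (2 lam_k) the product is at most exp of the w-average of h over the entries
    of J, to which Jensen applies. Coordinates of zero marginal are dropped because t_k <= 1; a
    vanishing t_k with positive marginal makes the left side zero. *)
Lemma prod_sqrt_le_sum (t : K -> R) : (forall k, 0 <= t k <= 1) ->
  \prod_k Num.sqrt (t k) <= \sum_J w J * (t J.1.1 `^ (2 * lam J.1.1)^-1 *
    t J.1.2 `^ (2 * lam J.1.2)^-1 * t J.2 `^ (2 * lam J.2)^-1).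
Proof.
move=> t01; pose g k := t k `^ (2 * lam k)^-1.
rewrite [leRHS](_ : _ = \sum_J w J * (g J.1.1 * g J.1.2 * g J.2))//.
have rhs0 : 0 <= \sum_J w J * (g J.1.1 * g J.1.2 * g J.2).
  by apply: sumr_ge0 => J _; rewrite !mulr_ge0 ?powR_ge0.
have [/existsP[k /andP[lk /eqP tk]]|] := boolP [exists k, (lam k != 0) && (t k == 0)].
  by rewrite (bigD1 k)//= tk sqrtr0 mul0r.
rewrite negb_exists => /forallP H.
have tp k : lam k != 0 -> 0 < t k.
  move=> lk; have := H k; rewrite lk/= => tk.
  by rewrite lt_neqAle eq_sym tk; have /andP[] := t01 k.
pose h k := if lam k == 0 then 0 else (2 * lam k)^-1 * ln (t k).
have gh k : lam k != 0 -> g k = expR (h k).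
  by move=> lk; rewrite /g /h (negbTE lk) /powR gt_eqF// tp.
have RE : \sum_J w J * (g J.1.1 * g J.1.2 * g J.2) =
    \sum_J w J * expR (h J.1.1 + h J.1.2 + h J.2).
  apply: eq_bigr => J _; have [->|wJ] := eqVneq (w J) 0; first by rewrite !mul0r.
  have lJ k : (0 < mult J k)%N -> lam k != 0 by move=> /(marginal_gt0 wJ)/gt_eqF ->.
  by rewrite !expRD !gh// lJ// /mult eqxx ?addn_gt0 ?orbT.
rewrite RE; apply: le_trans (jensen_expR _ w0 w1).
have -> : \sum_J w J * (h J.1.1 + h J.1.2 + h J.2) = \sum_k lam k * h k.
  under eq_bigr do rewrite sum_mult mulr_sumr.
  rewrite exchange_big/=; apply: eq_bigr => k _.
  by rewrite /lam /marginal mulr_suml; apply: eq_bigr => J _; rewrite mulrA.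
rewrite (big_morph expR (@expRD R) (@expR0 R)).
apply: ler_prod => k _; rewrite sqrtr_ge0/=.
have /andP[tk0 tk1] := t01 k.
rewrite /h; have [->|lk] := eqVneq (lam k) 0.
  by rewrite mulr0 expR0 -[leRHS]sqrtr1 ler_sqrt.
have tk := tp _ lk.
have -> : lam k * ((2 * lam k)^-1 * ln (t k)) = ln (Num.sqrt (t k)).
  rewrite -{1}(sqr_sqrtr tk0) lnXn ?sqrtr_gt0//.
  by rewrite -mulr_natr; field.
by rewrite lnK// posrE sqrtr_gt0.
Qed.

End weighted_amgm.

Section integral_amgm.
Context (R : realType) (K : finType).
Local Notation leb := (@lebesgue_measure R).
Local Notation rT := (measurableTypeR R).

Section integral3.
Implicit Types f g : rT * rT * rT -> \bar R.

Let int1 f : measurable_fun setT f -> (forall p, 0 <= f p)%E ->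
  measurable_fun setT (fun p : rT * rT => \int[leb]_z f (p, z))%E.
Proof. by move=> mf f0; exact: measurable_fun_fubini_tonelli_F. Qed.

Let int1_ge0 f : (forall p, 0 <= f p)%E -> forall p : rT * rT, (0 <= \int[leb]_z f (p, z))%E.
Proof. by move=> f0 p; exact: integral_ge0. Qed.

Let int2 f : measurable_fun setT f -> (forall p, 0 <= f p)%E ->
  measurable_fun setT (fun x : rT => \int[leb]_y \int[leb]_z f (x, y, z))%E.
Proof.
move=> mf f0.
exact: (measurable_fun_fubini_tonelli_F (fun p => \int[leb]_z f (p, z))%E (int1 mf f0) (int1_ge0 f0)).
Qed.

Let sec1 f x : measurable_fun setT f -> (forall p, 0 <= f p)%E ->
  measurable_fun setT (fun y : rT => \int[leb]_z f (x, y, z))%E.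
Proof.
move=> mf f0.
exact: (measurableT_comp (int1 mf f0) (pair1_measurable x)).
Qed.

Let sec2 f p : measurable_fun setT f -> measurable_fun setT (fun z => f (p, z)).
Proof.
move=> mf.
exact: (measurableT_comp mf (pair1_measurable p)).
Qed.

Lemma le_integral3 f g : measurable_fun setT f -> measurable_fun setT g ->
  (forall p, 0 <= f p)%E -> (forall p, f p <= g p)%E ->
  (\int[leb]_x \int[leb]_y \int[leb]_z f (x, y, z) <=
   \int[leb]_x \int[leb]_y \int[leb]_z g (x, y, z))%E.
Proof.
move=> mf mg f0 fg; have g0 p : (0 <= g p)%E by exact: le_trans (fg p).
apply: ge0_le_integral => //.
- by move=> x _; apply: integral_ge0 => y _; exact: int1_ge0.
- exact: int2.
- exact: int2.
move=> x _; apply: ge0_le_integral => //.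
- by move=> y _; exact: int1_ge0.
- exact: sec1.
- exact: sec1.
by move=> y _; apply: ge0_le_integral => //; exact: sec2.
Qed.

Lemma integral3Zl (r : R) f : 0 <= r -> measurable_fun setT f -> (forall p, 0 <= f p)%E ->
  (\int[leb]_x \int[leb]_y \int[leb]_z (r%:E * f (x, y, z)) =
   r%:E * \int[leb]_x \int[leb]_y \int[leb]_z f (x, y, z))%E.
Proof.
move=> r0 mf f0; rewrite -ge0_integralZl//; last 2 first.
- exact: int2.
- by move=> x _; apply: integral_ge0 => y _; exact: int1_ge0.
apply: eq_integral => x _; rewrite -ge0_integralZl//; last 2 first.
- exact: sec1.
- by move=> y _; exact: int1_ge0.
by apply: eq_integral => y _; rewrite -ge0_integralZl//; exact: sec2.
Qed.

Lemma integral3_sum (J : finType) (f : J -> rT * rT * rT -> \bar R) :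
  (forall j, measurable_fun setT (f j)) -> (forall j p, 0 <= f j p)%E ->
  (\int[leb]_x \int[leb]_y \int[leb]_z (\sum_j f j (x, y, z)) =
   \sum_j \int[leb]_x \int[leb]_y \int[leb]_z f j (x, y, z))%E.
Proof.
move=> mf f0.
rewrite -ge0_integral_sum//; last 2 first.
- by move=> j; exact: int2.
- by move=> j x _; apply: integral_ge0 => y _; exact: int1_ge0.
apply: eq_integral => x _; rewrite -ge0_integral_sum//; last 2 first.
- by move=> j; exact: sec1.
- by move=> j y _; exact: int1_ge0.
by apply: eq_integral => y _; rewrite -ge0_integral_sum// => j; exact: sec2.
Qed.

End integral3.

Variables a b c : K -> R.

Definition det3 (J : K * K * K) : R :=
  a J.1.1 * (b J.1.2 * c J.2 - b J.2 * c J.1.2) -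
  b J.1.1 * (a J.1.2 * c J.2 - a J.2 * c J.1.2) +
  c J.1.1 * (a J.1.2 * b J.2 - a J.2 * b J.1.2).

(** After the pointwise inequality each triple J contributes a product of functions of three linear
    forms of determinant [det3 J], so a change of variables splits it into one-dimensional
    integrals. *)
Lemma integral_amgm (mu : K -> probability rT R) (w : K * K * K -> R) (I : K -> R) :
  (forall J, 0 <= w J) -> \sum_J w J = 1 -> (forall J, w J != 0 -> det3 J != 0) ->
  (forall k, 0 <= I k) ->
  (forall k, 0 < marginal w k ->
    (\int[leb]_s (chr2 (mu k) s `^ (2 * marginal w k)^-1)%:E <= (I k)%:E)%E) ->
  (\int[leb]_x \int[leb]_y \int[leb]_z
     (\prod_k Num.sqrt (chr2 (mu k) (a k * x + b k * y + c k * z)))%R%:E <=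
   (\sum_J w J * (`|det3 J|^-1 * (I J.1.1 * I J.1.2 * I J.2)))%R%:E)%E.
Proof.
move=> w0 w1 wd I0 HI.
pose g k (s : rT) : rT := chr2 (mu k) s `^ (2 * marginal w k)^-1.
have g0 k s : 0 <= g k s by exact: powR_ge0.
have mg k : measurable_fun setT (g k) by exact: measurable_chr2_powR.
pose th k (p : rT * rT * rT) : rT := a k * p.1.1 + b k * p.1.2 + c k * p.2.
have mth k : measurable_fun setT (th k).
  have m11 : measurable_fun setT (fun p : rT * rT * rT => p.1.1) by exact: measurableT_comp.
  have m12 : measurable_fun setT (fun p : rT * rT * rT => p.1.2) by exact: measurableT_comp.
  by apply: measurable_funD; [apply: measurable_funD|]; exact: measurable_funM.
pose G J (p : rT * rT * rT) := g J.1.1 (th J.1.1 p) * g J.1.2 (th J.1.2 p) * g J.2 (th J.2 p).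
have mG J : measurable_fun setT (G J : _ -> rT).
  by apply: measurable_funM; [apply: measurable_funM|]; exact: (measurableT_comp (mg _) (mth _)).
pose F (p : rT * rT * rT) : \bar R := (\prod_k Num.sqrt (chr2 (mu k) (th k p)))%:E.
have mF : measurable_fun setT F.
  apply/measurable_EFinP; apply: measurable_prod => k _.
  apply: (measurableT_comp (@measurable_sqrtr R)).
  exact: (measurableT_comp (@measurable_chr2 R (mu k)) (mth k)).
have F0 p : (0 <= F p)%E by rewrite lee_fin; apply: prodr_ge0 => k _; exact: sqrtr_ge0.
pose S (p : rT * rT * rT) : \bar R := (\sum_J (w J * G J p)%:E)%E.
have GG0 J p : 0 <= G J p by apply: mulr_ge0; [apply: mulr_ge0|]; exact: g0.
have G0 J p : 0 <= w J * G J p by apply: mulr_ge0.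
have mS : measurable_fun setT S.
  by apply: emeasurable_sum => J; apply/measurable_EFinP; exact: (measurable_funM (measurable_cst (w J)) (mG J)).
have S0 p : (0 <= S p)%E by apply: sume_ge0 => J _; rewrite lee_fin.
have FS p : (F p <= S p)%E.
  rewrite /F /S sumEFin lee_fin.
  apply: (@prod_sqrt_le_sum R K w w0 w1 (fun k => chr2 (mu k) (th k p))) => k.
  by rewrite chr2_ge0 chr2_le1.
apply: (le_trans (le_integral3 mF mS F0 FS)).
have -> : (\int[leb]_x \int[leb]_y \int[leb]_z S (x, y, z) =
    \sum_J (w J)%:E * \int[leb]_x \int[leb]_y \int[leb]_z (G J (x, y, z))%:E)%E.
  rewrite (@integral3_sum _ (fun J p => (w J * G J p)%:E)); last 2 first.
  - by move=> J; apply/measurable_EFinP; exact: (measurable_funM (measurable_cst (w J)) (mG J)).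
  - by move=> J p; rewrite lee_fin.
  have mGE J : measurable_fun setT (fun p => (G J p)%:E) by apply/measurable_EFinP; exact: mG.
  have GE J p : (0 <= (G J p)%:E)%E by rewrite lee_fin.
  by apply: eq_bigr => J _; exact: (integral3Zl (w0 J) (mGE J) (GE J)).
rewrite -sumEFin; apply: lee_sum => J _.
have [wJ|wJ] := eqVneq (w J) 0.
  by rewrite wJ !mul0r mul0e.
have E : (\int[leb]_x \int[leb]_y \int[leb]_z (G J (x, y, z))%:E =
   `|det3 J|^-1%:E * (\int[leb]_x (g J.1.1 x)%:E * \int[leb]_x (g J.1.2 x)%:E * \int[leb]_x (g J.2 x)%:E))%E.
  exact: (integral_linear3 (wd J wJ) (erefl _) (mg _) (mg _) (mg _) (g0 _) (g0 _) (g0 _)).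
rewrite {}E.
have il k : (0 < mult J k)%N -> (\int[leb]_x (g k x)%:E <= (I k)%:E)%E.
  by move=> mJ; apply: HI; exact: marginal_gt0 wJ mJ.
have i0 k : (0 <= \int[leb]_x (g k x)%:E)%E by apply: integral_ge0 => x _; rewrite lee_fin.
have il1 : (\int[leb]_x (g J.1.1 x)%:E <= (I J.1.1)%:E)%E by apply: il; rewrite /mult eqxx.
have il2 : (\int[leb]_x (g J.1.2 x)%:E <= (I J.1.2)%:E)%E.
  by apply: il; rewrite /mult eqxx addnC addnA addn1.
have il3 : (\int[leb]_x (g J.2 x)%:E <= (I J.2)%:E)%E.
  by apply: il; rewrite /mult eqxx addn1.
rewrite 4!EFinM; apply: lee_wpmul2l; first by rewrite lee_fin.
apply: lee_wpmul2l; first by rewrite lee_fin invr_ge0.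
have i12 := lee_pmul (i0 _) (i0 _) il1 il2.
exact: (lee_pmul (mule_ge0 (i0 _) (i0 _)) (i0 _) i12 il3).
Qed.

End integral_amgm.

(** * Replacing a law of bounded density by a scaled Laplace law *)

Section scaled_laplace.
Context (R : realType).
Local Notation leb := (@lebesgue_measure R).
Local Notation rT := (measurableTypeR R).
Variable N : R.
Hypothesis N0 : 0 < N.

Let scale_mfun : {mfun rT >-> rT} := HB.pack_for {mfun rT >-> rT} (affine N 0 : rT -> rT)
  (isMeasurableFun.Build _ _ _ _ (affine N 0 : rT -> rT) (measurable_affine N 0)).

Definition scaled_laplace : probability rT R := distribution (@laplace R) scale_mfun.

Lemma leb_le_laplace (E : set rT) : measurable E -> (forall x, E x -> `|x| <= 1) ->
  (leb E <= (2 * expR 1)%:E * laplace E)%E.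
Proof.
move=> mE E1.
have -> : laplace E = (\int[leb]_(x in E) (laplace_pdf x)%:E)%E by [].
rewrite -[leLHS]mul1e -integral_cst// -ge0_integralZl//; last 2 first.
- by apply/measurable_EFinP/measurable_funTS; exact: measurable_laplace_pdf.
- by move=> x _; rewrite lee_fin laplace_pdf_ge0.
apply: ge0_le_integral => //.
- apply/measurable_EFinP; apply: measurable_funM => //.
  by apply: measurable_funTS; exact: measurable_laplace_pdf.
move=> x Ex; rewrite -EFinM lee_fin /laplace_pdf.
rewrite (_ : 2 * expR 1 * (expR (- `|x|) / 2) = expR (1 - `|x|)); last by rewrite expRD; field.
by rewrite -[leLHS]expR0 ler_expR subr_ge0; exact: E1.
Qed.

(** The Laplace density of scale N is at least 1 / (2e N) on [-N, N]. *)
Lemma truncated_le_scaled_laplace (L : R) (mu : probability rT R) : 0 <= L ->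
  bounded_density L mu ->
  forall C : set rT, measurable C ->
  (mu (C `&` [set x : R | (`|x| <= N)%R]) <= (2 * expR 1 * L * N)%:E * scaled_laplace C)%E.
Proof.
move=> L0 muL C mC.
have mB : measurable ([set x : R | `|x| <= N] : set rT) by exact: measurable_norm_le.
have mCB : measurable (C `&` [set x : R | `|x| <= N] : set rT) by exact: measurableI.
apply: le_trans (muL _ mCB) _.
have mpre (A : set rT) : measurable A -> measurable (affine N 0 @^-1` A : set rT).
  by move=> mA; rewrite -[X in measurable X]setTI; exact: measurable_affine.
rewrite (@lebesgue_affine R N 0) ?gt_eqF// gtr0_norm//.
have H : (leb (affine N 0 @^-1` (C `&` [set x : R | (`|x| <= N)%R])) <=
   (2 * expR 1)%:E * scaled_laplace C)%E.
  apply: le_trans (leb_le_laplace _ _) _; first exact: mpre.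
    move=> x [_] /=; rewrite /affine addr0 normrM gtr0_norm// => h.
    by rewrite -(ler_pM2l N0) mulr1.
  apply: lee_wpmul2l; first by rewrite lee_fin mulr_ge0 ?expR_ge0.
  rewrite /scaled_laplace/= /distribution/= /pushforward/=.
  by apply: le_measure; rewrite ?inE; [exact: mpre|exact: mpre|move=> x []].
rewrite muleA -EFinM.
apply: le_trans (lee_wpmul2l _ H) _; first by rewrite lee_fin mulr_ge0// ltW.
by rewrite muleA -EFinM (_ : L * N * (2 * expR 1) = 2 * expR 1 * L * N)//; ring.
Qed.

Lemma chr2_scaled_laplace s : chr2 scaled_laplace s = ((1 + (N * s) ^+ 2)^-1) ^+ 2.
Proof.
have E (f : R -> R) : measurable_fun setT (f : rT -> rT) -> (forall x, `|f x| <= 1) ->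
    \int[scaled_laplace]_x f x = \int[@laplace R]_x f (affine N 0 x).
  move=> mf f1; rewrite /Rintegral; congr fine.
  have i1 : (@laplace R).-integrable setT (EFin \o (f \o (affine N 0 : rT -> rT))).
    apply: (@bounded_integrable _ rT R (@laplace R) (fun x : rT => f (affine N 0 x)) 1) => [|x].
      exact: (measurableT_comp mf (measurable_affine N 0)).
    exact: f1.
  have mEf : measurable_fun setT (EFin \o f : rT -> \bar R) by exact/measurable_EFinP.
  exact: (integral_distribution mEf i1).
have ms : measurable_fun setT (fun x : rT => s * x : rT) by exact: measurable_funM.
have mcos : measurable_fun setT (fun x : rT => cos (s * x) : rT).
  exact: (measurableT_comp (@measurable_cos R) ms).
have msin : measurable_fun setT (fun x : rT => sin (s * x) : rT).
  exact: (measurableT_comp (@measurable_sin R) ms).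
have cos1 x : `|cos (s * x)| <= 1 by rewrite ler_norml cos_geN1 cos_le1.
have sin1 x : `|sin (s * x)| <= 1 by rewrite ler_norml sin_geN1 sin_le1.
rewrite /chr2 /cosI /sinI (E _ mcos cos1) (E _ msin sin1).
under eq_Rintegral do rewrite /affine addr0 mulrA.
rewrite Rintegral_laplace_cos.
under eq_Rintegral do rewrite /affine addr0 mulrA.
by rewrite Rintegral_laplace_sin expr0n/= addr0 (mulrC s).
Qed.

(** The exponent 1/2 is (2 lam)^-1 at lam = 1, the marginal of the special coordinates: there |phi|
    itself has to be integrable, and for this law it is a Cauchy kernel. *)
Lemma integral_scaled_laplace : 
  (\int[leb]_s (chr2 scaled_laplace s `^ 2^-1)%:E = (pi / N)%:E)%E.
Proof.
rewrite -(@integral_cauchy_affine R N 0)//; apply: eq_integral => s _; congr EFin.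
rewrite chr2_scaled_laplace addr0 powR12_sqrt ?sqr_ge0// sqrtr_sqr ger0_norm//.
by rewrite invr_ge0 addr_ge0// sqr_ge0.
Qed.

(** The coordinates of [s] are replaced one at a time, each at the cost of a factor 2e L N. *)
Lemma truncate_product_law (K : finType) (L : R) (s : seq K)
    (mu : K -> probability rT R) (Q : probability (vec R K) R) : 0 <= L -> uniq s ->
  product_law Q mu -> (forall k, k \in s -> bounded_density L (mu k)) ->
  exists2 Q' : probability (vec R K) R,
    product_law Q' (fun k => if k \in s then scaled_laplace else mu k) &
    forall A : set (vec R K), measurable A ->
      (Q (A `&` [set x : vec R K | forall k, k \in s -> (`|x k| <= N)%R]) <=
       ((2 * expR 1 * L * N) ^+ size s)%:E * Q' A)%E.
Proof.
move=> L0; elim: s => [_ Qmu _|k s IH /= /andP[ks us] Qmu muL].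
  exists Q => [|A mA]; first exact: Qmu.
  by rewrite mul1e; apply: le_measure; rewrite ?inE//; apply: measurableI => //;
    rewrite (_ : [set _ | _] = setT)//; apply/seteqP; split.
have [|Q' Q'mu HQ'] := IH us Qmu; first by move=> j js; apply: muL; rewrite inE js orbT.
exists (upd_law k scaled_laplace Q').
  have := upd_product_law k scaled_laplace Q'mu.
  rewrite (_ : (fun j => _) = (fun j => if j \in k :: s then scaled_laplace else mu j))//.
  by apply/funext => j; rewrite inE; case: eqP.
move=> A mA.
have mB : measurable ([set x : R | `|x| <= N] : set rT) by exact: measurable_norm_le.
have mBk : measurable (A `&` [set x : vec R K | [set y : R | `|y| <= N] (x k)]).
  apply: measurableI => //; rewrite -[X in measurable X]setTI; exact: measurable_coord.
have c0 : 0 <= 2 * expR 1 * L * N by rewrite !mulr_ge0 ?expR_ge0// ltW.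
rewrite (_ : A `&` _ = (A `&` [set x : vec R K | [set y : R | `|y| <= N] (x k)]) `&`
    [set x : vec R K | forall k, k \in s -> `|x k| <= N]); last first.
  rewrite -setIA; congr setI; apply/seteqP; split=> x /=.
    by move=> h; split => [|j js]; apply: h; rewrite inE ?eqxx// js orbT.
  by move=> [h1 h2] j; rewrite inE => /predU1P[->//|/h2].
apply: le_trans (HQ' _ mBk) _.
rewrite exprSr EFinM -muleA; apply: lee_wpmul2l; first by rewrite lee_fin exprn_ge0.
apply: (measure_upd_le c0 Q'mu mA mB) => C mC; rewrite (negbTE ks).
by apply: truncated_le_scaled_laplace => //; apply: muL; rewrite inE eqxx.
Qed.

End scaled_laplace.

(** * Weights from a Gram determinant *)

Section determinant_weights.
Context (R : realType) (K : finType) (a b c : K -> R).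
Implicit Types (J : K * K * K) (S : {set K}).

Definition entries J : {set K} := [set J.1.1; J.1.2; J.2].

(** By Cauchy-Binet this is 6 times the Gram determinant of a, b, c: the sum runs over ordered
    triples, and those with a repetition contribute nothing. *)
Definition gram : R := \sum_J det3 a b c J ^+ 2.

Definition gram_over S : R := \sum_(J | S \subset entries J) det3 a b c J ^+ 2.

Lemma det3_uniq J : det3 a b c J != 0 -> [&& J.1.1 != J.1.2, J.1.1 != J.2 & J.1.2 != J.2].
Proof.
case: J => [[i j] k]; rewrite /det3/= => d0; apply/and3P; split; apply: contraNneq d0 => ->;
  apply/eqP; ring.
Qed.

Lemma mult_entries J k : det3 a b c J != 0 -> mult J k = (k \in entries J).
Proof.
move=> /det3_uniq; rewrite /mult !inE; case: J => [[i j] l]/= /and3P[ij il jl].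
rewrite !(eq_sym k); have [<-|_] := eqVneq i k.
  by rewrite [j == i]eq_sym [l == i]eq_sym (negbTE ij) (negbTE il).
have [<-|_] := eqVneq j k; first by rewrite [l == j]eq_sym (negbTE jl).
by case: eqP.
Qed.

(** The law on triples proportional to the squared minor, conditioned on containing S. *)
Definition weight S J : R := if S \subset entries J then det3 a b c J ^+ 2 / gram_over S else 0.

Lemma gram_over_ge0 S : 0 <= gram_over S.
Proof. by apply: sumr_ge0 => J _; exact: sqr_ge0. Qed.

Lemma weight_ge0 S J : 0 <= weight S J.
Proof. by rewrite /weight; case: ifP => // _; rewrite divr_ge0 ?sqr_ge0 ?gram_over_ge0. Qed.

Lemma weight_neq0 S J : weight S J != 0 -> det3 a b c J != 0 /\ S \subset entries J.
Proof.
rewrite /weight; case: ifP => [_|]; last by rewrite eqxx.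
by move=> h; split=> //; apply: contraNneq h => ->; rewrite expr0n mul0r.
Qed.

Lemma sum_weight S : 0 < gram_over S -> \sum_J weight S J = 1.
Proof.
move=> Z0; rewrite /weight -big_mkcond/= -mulr_suml -/(gram_over S) mulfV//.
exact: lt0r_neq0.
Qed.

(** A nonzero minor has distinct entries, so [mult] is an indicator and the marginal is the
    conditional probability that k belongs to J. *)
Lemma marginal_weight S k : marginal (weight S) k = gram_over (k |: S) / gram_over S.
Proof.
rewrite /marginal /gram_over mulr_suml [RHS]big_mkcond/=; apply: eq_bigr => J _.
have [d0|d0] := eqVneq (det3 a b c J) 0.
  by rewrite /weight d0 expr0n !mul0r; case: ifP; case: ifP; rewrite ?mul0r.
rewrite mult_entries// /weight finset.subUset finset.sub1set andbC.
by case: ifP => _ //=; [case: ifP => _; rewrite ?mulr1 ?mulr0|rewrite mul0r].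
Qed.

Lemma card_over S : 0 < gram_over S -> (#|S| <= 3)%N.
Proof.
move=> Z0; have [J SJ] : exists J, S \subset entries J.
  apply/existsP; apply: contraLR Z0; rewrite negb_exists => /forallP H.
  by rewrite -leNgt /gram_over big1// => J SJ; have := H J; rewrite SJ.
apply: leq_trans (subset_leq_card SJ) _; rewrite /entries.
apply: leq_trans (leq_card_setU _ _) _; rewrite cards1 addn1 ltnS.
by rewrite cards2; case: eqP.
Qed.

(* Maximality forces the marginal weights of the other coordinates to be at most 1/2. *)
Definition special_set : {set K} := [arg max_(S > finset.set0) (gram_over S * 2 ^+ #|S|)]%O.

Lemma special_set_max S : gram_over S * 2 ^+ #|S| <= gram_over special_set * 2 ^+ #|special_set|.
Proof. by rewrite /special_set; case: arg_maxP => // S' _; exact. Qed.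

Lemma gram_over0 : gram_over finset.set0 = gram.
Proof. by apply: eq_bigl => J; rewrite finset.sub0set. Qed.

Hypothesis Z0 : 0 < gram.
Local Notation S := special_set.

Lemma gram_special_gt0 : 0 < gram_over S.
Proof.
have := special_set_max finset.set0; rewrite gram_over0 cards0 mulr1 => h.
by rewrite -(@pmulr_lgt0 _ (2 ^+ #|S|)) ?exprn_gt0//; exact: lt_le_trans h.
Qed.

(** Comparison with the empty set in the maximum; a set contained in a triple has at most three
    elements, whence 8 = 2^3. *)
Lemma gram_special : gram <= 8 * gram_over S.
Proof.
have := special_set_max finset.set0; rewrite gram_over0 cards0 mulr1 => /le_trans; apply.
rewrite mulrC ler_wpM2r ?gram_over_ge0// (_ : 8 = 2 ^+ 3 :> R); last by rewrite -natrX.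
by rewrite ler_eXn2l ?ltr1n// card_over// gram_special_gt0.
Qed.

Lemma marginal_special k : k \in S -> marginal (weight S) k = 1.
Proof.
move=> kS; rewrite marginal_weight (finset.setUidPr _) ?finset.sub1set// divff//.
exact/lt0r_neq0/gram_special_gt0.
Qed.

Lemma marginal_notin_special k : k \notin S -> marginal (weight S) k <= 2^-1.
Proof.
move=> kS; rewrite marginal_weight ler_pdivrMr ?gram_special_gt0//.
have := special_set_max (k |: S); rewrite cardsU1 kS add1n exprS mulrA.
by rewrite ler_pM2r ?exprn_gt0//; lra.
Qed.

(** Write w_J = u^2 and the product of the three marginals as q^2. Then w_J / |det_J| = u /
    sqrt(Z_S), with Z_S the sum [gram_over S], and uq <= (u^2 + q^2) / 2. Over all J the squares u^2
    sum to 1 and the q^2 to 3^3 = 27, which gives 14. Since the full Gram sum is at most 8 Z_S <= 9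
    Z_S, the last factor is 3, and 42 = 14 * 3. *)
Lemma sum_weight_det :
  \sum_J weight S J * (`|det3 a b c J|^-1 * (Num.sqrt (marginal (weight S) J.1.1) *
    Num.sqrt (marginal (weight S) J.1.2) * Num.sqrt (marginal (weight S) J.2)))
  <= 42 / Num.sqrt gram.
Proof.
set l := marginal (weight S).
have l0 k : 0 <= l k by apply: marginal_ge0 => J; exact: weight_ge0.
have ZS0 := gram_special_gt0.
have sZS : 0 < Num.sqrt (gram_over S) by rewrite sqrtr_gt0.
have suml : \sum_J l J.1.1 * l J.1.2 * l J.2 = 27.
  rewrite -(pair_bigA _ (fun p k => l p.1 * l p.2 * l k))/=.
  rewrite -(pair_bigA _ (fun i j => \sum_k l i * l j * l k))/=.
  under eq_bigr => i _ do under eq_bigr => j _ do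
    rewrite -mulr_sumr (sum_marginal (sum_weight ZS0)).
  under eq_bigr => i _ do rewrite -mulr_suml -mulr_sumr (sum_marginal (sum_weight ZS0)).
  by rewrite -!mulr_suml (sum_marginal (sum_weight ZS0)); ring.
have T J : weight S J * (`|det3 a b c J|^-1 * (Num.sqrt (l J.1.1) * Num.sqrt (l J.1.2) * Num.sqrt (l J.2)))
    <= (Num.sqrt (gram_over S))^-1 * ((weight S J + l J.1.1 * l J.1.2 * l J.2) / 2).
  set p := l J.1.1 * l J.1.2 * l J.2; have p0 : 0 <= p by rewrite !mulr_ge0.
  have -> : Num.sqrt (l J.1.1) * Num.sqrt (l J.1.2) * Num.sqrt (l J.2) = Num.sqrt p.
    by rewrite /p !sqrtrM ?mulr_ge0.
  have [wJ|wJ] := eqVneq (weight S J) 0.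
    by rewrite wJ mul0r add0r mulr_ge0 ?invr_ge0 ?divr_ge0// ltW.
  have [d0 SJ] := weight_neq0 wJ.
  have -> : weight S J = (`|det3 a b c J| / Num.sqrt (gram_over S)) ^+ 2.
    by rewrite /weight SJ expr_div_n sqr_sqrtr ?(ltW ZS0)// real_normK// num_real.
  set u := `|det3 a b c J| / _; set q := Num.sqrt p.
  have -> : p = q ^+ 2 by rewrite sqr_sqrtr.
  rewrite [leLHS](_ : _ = (Num.sqrt (gram_over S))^-1 * (u * q)).
    rewrite ler_pM2l ?invr_gt0// ler_pdivlMr//.
    by have := sqr_ge0 (u - q); rewrite sqrrB; lra.
  by rewrite /u; field; rewrite normr_eq0 d0 gt_eqF.
apply: le_trans (ler_sum _ (fun J _ => T J)) _.
rewrite -mulr_sumr -mulr_suml big_split/= suml (sum_weight ZS0).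
rewrite ler_pdivlMr ?sqrtr_gt0// -mulrA mulrC ler_pdivrMr//.
have : Num.sqrt gram <= Num.sqrt (9 * gram_over S).
  rewrite ler_sqrt ?mulr_ge0 ?(ltW ZS0)//; have := gram_special; lra.
rewrite sqrtrM// (_ : 9 = 3 ^+ 2 :> R); last by rewrite -natrX.
rewrite sqrtr_sqr normr_nat; lra.
Qed.

End determinant_weights.

(** * Small ball probabilities of three linear forms *)

Section small_ball.
Context (R : realType) (K : finType).
Local Notation rT := (measurableTypeR R).
Variables (L : R) (mu : K -> probability rT R) (Q : probability (vec R K) R).
Hypotheses (L0 : 0 < L) (Qmu : product_law Q mu) (muL : forall k, bounded_density L (mu k)).
Hypothesis mu2 : forall k, (\int[mu k]_x (x ^+ 2)%:E <= 1)%E.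

(** The larger of the two costs of one coordinate: [decay_cst] for an ordinary one, and 2e L N times
    pi / N for one replaced by a Laplace law. *)
Definition unit_cst : R := Num.max (decay_cst L) (2 * expR 1 * L * pi).

Definition small_ball_cst : R := 42 * unit_cst ^+ 3.

Lemma unit_cst_gt0 : 0 < unit_cst.
Proof. by rewrite lt_max; apply/orP; right; rewrite !mulr_gt0 ?expR_gt0 ?pi_gt0. Qed.

Lemma small_ball_cst_gt0 : 0 < small_ball_cst.
Proof. by rewrite mulr_gt0// exprn_gt0// unit_cst_gt0. Qed.

Definition unit_forms (a b c : K -> R) : set (vec R K) :=
  [set x : vec R K | (`|\sum_k a k * x k| <= 1 /\ `|\sum_k b k * x k| <= 1 /\
                        `|\sum_k c k * x k| <= 1)%R].

Lemma measurable_norm_form_le (a : K -> R) (e : R) :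
  measurable [set x : vec R K | `|\sum_k a k * x k| <= e].
Proof.
have mE : measurable ([set x : R | `|x| <= e] : set rT) by exact: measurable_norm_le.
rewrite -[X in measurable X]setTI.
exact: (measurable_linear_form a (index_enum K) measurableT mE).
Qed.

Lemma measurable_unit_forms a b c : measurable (unit_forms a b c).
Proof.
rewrite (_ : unit_forms _ _ _ = [set x : vec R K | `|\sum_k a k * x k| <= 1] `&`
  ([set x : vec R K | `|\sum_k b k * x k| <= 1] `&`
   [set x : vec R K | `|\sum_k c k * x k| <= 1])); last by [].
by apply: measurableI; [|apply: measurableI]; exact: measurable_norm_form_le.
Qed.

Variables a b c : K -> R.
Hypothesis Z0 : 0 < gram a b c.
Local Notation S := (special_set a b c).
Local Notation lam := (marginal (weight a b c S)).

Let prod_units (p u1 u2 u3 U w d s1 s2 s3 : R) : p * (u1 * u2 * u3) = 1 ->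
  p * (w * (d * (U * (s1 * u1) * (U * (s2 * u2)) * (U * (s3 * u3))))) =
  U ^+ 3 * (w * (d * (s1 * s2 * s3))).
Proof. by move=> h; rewrite -[RHS]mul1r -h; ring. Qed.

(** The factor C^|S| paid for the replacement is returned by the one-dimensional integrals, which
    carry one C^-1 for each entry in S. The bound is therefore independent of N. *)
Lemma truncated_small_ball (N : R) : 0 < N ->
  (Q (unit_forms a b c `&` [set x : vec R K | forall k, k \in enum S -> (`|x k| <= N)%R])
    <= (small_ball_cst / Num.sqrt (gram a b c))%:E)%E.
Proof.
move=> N0; set C := 2 * expR 1 * L * N.
have C0 : 0 < C by rewrite !mulr_gt0 ?expR_gt0.
have [Q' Q'mu HQ'] := truncate_product_law N0 (ltW L0) (enum_uniq S) Qmu (fun k _ => muL k).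
apply: le_trans (HQ' _ (measurable_unit_forms a b c)) _; rewrite -/C.
set mu' := fun k : K => _ in Q'mu.
pose I k := unit_cst * (Num.sqrt (lam k) * (if k \in S then C^-1 else 1)).
have U0 := unit_cst_gt0.
have I0 k : 0 <= I k.
  by rewrite !mulr_ge0 ?(ltW U0)//; case: ifP => // _; rewrite invr_ge0 ltW.
have HI k : 0 < lam k ->
    (\int[@lebesgue_measure R]_s (chr2 (mu' k) s `^ (2 * lam k)^-1)%:E <= (I k)%:E)%E.
  move=> lk; rewrite /I /mu' mem_enum; case: ifPn => kS.
    rewrite marginal_special// mulr1 integral_scaled_laplace// lee_fin sqrtr1 mul1r.
    rewrite ler_pdivlMr// /C; apply: (@le_trans _ _ (2 * expR 1 * L * pi)).
      by apply: eq_le_refl; field; rewrite gt_eqF.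
    by rewrite /unit_cst le_max lexx orbT.
  apply: (le_trans (integral_chr2_powR L0 (muL k) (mu2 k) lk (marginal_notin_special Z0 kS))).
  by rewrite lee_fin mulr1 ler_wpM2r// /unit_cst le_max lexx.
have H1 := small_ball_fourier Q'mu a b c.
have H2 := integral_amgm (weight_ge0 a b c S) (sum_weight (gram_special_gt0 Z0))
  (fun J wJ => (weight_neq0 wJ).1) I0 HI.
apply: (@le_trans _ _ ((C ^+ size (enum S))%:E * (\sum_J weight a b c S J * (`|det3 a b c J|^-1 * (I J.1.1 * I J.1.2 * I J.2)))%:E)%E).
  apply: lee_wpmul2l; first by rewrite lee_fin exprn_ge0// ltW.
  exact: le_trans H1 H2.
rewrite -EFinM lee_fin -cardE mulr_sumr.
rewrite (_ : small_ball_cst / _ = unit_cst ^+ 3 * (42 / Num.sqrt (gram a b c))); last first.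
  by rewrite /small_ball_cst; ring.
apply: le_trans (ler_wpM2l (exprn_ge0 3 (ltW U0)) (sum_weight_det Z0)).
rewrite mulr_sumr; apply: ler_sum => J _.
have [->|wJ] := eqVneq (weight a b c S J) 0; first by rewrite !(mul0r, mulr0).
have [dJ SJ] := weight_neq0 wJ.
(* A triple of nonzero weight contains S and has distinct entries, so exactly |S| of its three
   entries lie in S. *)
have CS : C ^+ #|S| * ((if J.1.1 \in S then C^-1 else 1) * (if J.1.2 \in S then C^-1 else 1) *
    (if J.2 \in S then C^-1 else 1)) = 1.
  have CE k : (if k \in S then C^-1 else 1) = C^-1 ^+ (k \in S) by case: (k \in S).
  rewrite !CE -!exprD (_ : (_ + _ + _)%N = #|S|); first by rewrite -exprMn divff ?expr1n// gt_eqF.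
  have := sum_mult J (fun k => (k \in S)%:R : R); rewrite -!natrD.
  rewrite (eq_bigr (fun k => (k \in S)%:R)); last first.
    move=> k _; rewrite (mult_entries _ dJ); have [kS|] := boolP (k \in S); last by rewrite mulr0.
    by rewrite (fintype.subsetP SJ _ kS) mulr1.
  rewrite -natr_sum => /eqP; rewrite eqr_nat => /eqP ->.
  by rewrite -sum1_card [RHS]big_mkcond/=; apply: eq_bigr => k _; case: (k \in S).
apply: eq_le_refl; rewrite /I.
exact: (prod_units _ _ _ _ _ _ CS).
Qed.

(** The truncation at N is removed by continuity from below. *)
Lemma small_ball_unit :
  (Q (unit_forms a b c) <= (small_ball_cst / Num.sqrt (gram a b c))%:E)%E.
Proof.
pose B (n : nat) := [set x : vec R K | forall k, k \in enum S -> (`|x k| <= n.+1%:R)%R].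
pose F n : set (vec R K) := unit_forms a b c `&` B n.
have mB n : measurable (B n).
  rewrite (_ : B n = \bigcap_(k in [set` enum S]) [set x : vec R K | `|x k| <= n.+1%:R]); last first.
    by apply/seteqP; split.
  apply: fin_bigcap_measurable; first exact: finite_finset.
  move=> k _.
  have mE : measurable ([set x : R | `|x| <= n.+1%:R] : set rT) by exact: measurable_norm_le.
  rewrite -[X in measurable X]setTI; exact: (measurable_coord k measurableT mE).
have mF n : measurable (F n) by apply: measurableI => //; exact: measurable_unit_forms.
have UF : \bigcup_n F n = unit_forms a b c.
  apply/seteqP; split=> [x [n _ []]//|x xU].
  pose M := \sum_(k in S) `|x k|.
  exists (Num.truncn M) => //; split=> // k; rewrite mem_enum => kS.
  have M0 : 0 <= M by apply: sumr_ge0.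
  apply: (@le_trans _ _ M); last by rewrite ltW// truncnS_gt.
  by rewrite /M (bigD1 k)//= lerDl sumr_ge0.
have ndF : nondecreasing_seq F.
  move=> m n mn; apply/subsetPset => x [xU xB]; split=> // k kS.
  by apply: le_trans (xB k kS) _; rewrite ler_nat ltnS.
have cF : (Q \o F) n @[n --> \oo] --> Q (\bigcup_n F n).
  by apply: nondecreasing_cvg_mu => //; rewrite UF; exact: measurable_unit_forms.
rewrite -UF -(cvg_lim _ cF)//; apply: lime_le; first by apply/cvg_ex; eexists; exact: cF.
by apply: nearW => n; apply: truncated_small_ball.
Qed.

End small_ball.

(** * Orthonormal triples *)

Section dot_product.
Context (R : comPzRingType) (K : finType).
Implicit Types u v : K -> R.

Definition dot u v : R := \sum_k u k * v k.

Lemma dotC u v : dot u v = dot v u.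
Proof. by apply: eq_bigr => k _; rewrite mulrC. Qed.

Lemma dotDl u v w : dot (fun k => u k + v k) w = dot u w + dot v w.
Proof. by rewrite -big_split/=; apply: eq_bigr => k _; rewrite mulrDl. Qed.

Lemma dotZl a u w : dot (fun k => a * u k) w = a * dot u w.
Proof. by rewrite /dot mulr_sumr; apply: eq_bigr => k _; rewrite mulrA. Qed.

Lemma lagrange_identity u v :
  \sum_i \sum_j (u i * v j - u j * v i) ^+ 2 = 2 * (dot u u * dot v v - dot u v ^+ 2).
Proof.
have E f g : \sum_i \sum_j (f i * g j : R) = (\sum_i f i) * (\sum_j g j).
  by rewrite mulr_suml; apply: eq_bigr => i _; rewrite mulr_sumr.
rewrite (eq_bigr (fun i => (\sum_j (u i * u i) * (v j * v j) + \sum_j (v i * v i) * (u j * u j))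
   + \sum_j (- 2 * (u i * v i)) * (u j * v j))); last first.
  by move=> i _; rewrite -!big_split/=; apply: eq_bigr => j _; ring.
by rewrite !big_split/= !E -mulr_sumr /dot; ring.
Qed.

End dot_product.

Section orthonormal_triples.
Context (R : realType) (K : finType).
Implicit Types (v : (K -> R) * (K -> R) * (K -> R)) (p q : R * R * R) (u : K -> R).

Lemma dot_ge0 u : 0 <= dot u u.
Proof. by apply: sumr_ge0 => k _; rewrite -expr2 sqr_ge0. Qed.

Lemma dot_cauchy_schwarz u w : dot u w ^+ 2 <= dot u u * dot w w.
Proof.
rewrite -subr_ge0 -(pmulr_rge0 _ (@ltr0n R 2)) -lagrange_identity.
by apply: sumr_ge0 => i _; apply: sumr_ge0 => j _; exact: sqr_ge0.
Qed.

Definition dot3 p q : R := p.1.1 * q.1.1 + p.1.2 * q.1.2 + p.2 * q.2.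

Definition cross p q : R * R * R :=
  (p.1.2 * q.2 - p.2 * q.1.2, p.2 * q.1.1 - p.1.1 * q.2, p.1.1 * q.1.2 - p.1.2 * q.1.1).

Definition proj v u : R * R * R := (dot v.1.1 u, dot v.1.2 u, dot v.2 u).

Definition orthonormal v : Prop :=
  [/\ dot v.1.1 v.1.1 = 1, dot v.1.2 v.1.2 = 1 & dot v.2 v.2 = 1] /\
  [/\ dot v.1.1 v.1.2 = 0, dot v.1.1 v.2 = 0 & dot v.1.2 v.2 = 0].

Definition comb v p (k : K) : R := p.1.1 * v.1.1 k + p.1.2 * v.1.2 k + p.2 * v.2 k.

Lemma dot_comb v p u : dot (comb v p) u = dot3 p (proj v u).
Proof. by rewrite /comb !dotDl !dotZl. Qed.

Lemma dot_comb_comb v p q : orthonormal v -> dot (comb v p) (comb v q) = dot3 p q.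
Proof.
move=> [[v11 v22 v33] [v12 v13 v23]].
rewrite dot_comb /proj !(dotC _ (comb v q)) !dot_comb /proj /dot3/=.
by rewrite v11 v22 v33 v12 v13 v23 !(dotC v.1.2 v.1.1) !(dotC v.2) v12 v13 v23; ring.
Qed.

(** As a function of its last index the minor is a combination of a, b, c whose coefficients are 2 x
    2 minors, so orthonormality turns the sum over k into three squared 2 x 2 minors. Lagrange's
    identity gives 2 for each of the three pairs. *)
Lemma gram_orthonormal v : orthonormal v -> gram v.1.1 v.1.2 v.2 = 6.
Proof.
case: v => [[a b] c] [/= [aa bb cc] [ab ac bc]]; rewrite /gram.
rewrite -(pair_bigA _ (fun ij k => det3 a b c (ij, k) ^+ 2))/=.
rewrite -(pair_bigA _ (fun i j => \sum_k det3 a b c (i, j, k) ^+ 2))/=.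
pose m (f g : K -> R) i j := f i * g j - f j * g i.
have E i j : \sum_k det3 a b c (i, j, k) ^+ 2 = m a b i j ^+ 2 + m a c i j ^+ 2 + m b c i j ^+ 2.
  pose w := comb (a, b, c) (m b c i j, - m a c i j, m a b i j).
  rewrite (_ : \sum_k _ = dot w w).
    by rewrite dot_comb_comb// /dot3/=; ring.
  by apply: eq_bigr => k _; rewrite /w /comb /det3 /m/=; ring.
under eq_bigr do (under eq_bigr do rewrite E; rewrite !big_split/=).
by rewrite !big_split/= !lagrange_identity aa bb cc ab ac bc; ring.
Qed.

Lemma gram_comb v p q r (e1 e2 e3 : R) : 
  gram (fun k => comb v p k * e1) (fun k => comb v q k * e2) (fun k => comb v r k * e3) =
  (dot3 p (cross q r) * (e1 * e2 * e3)) ^+ 2 * gram v.1.1 v.1.2 v.2.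
Proof.
rewrite /gram mulr_sumr; apply: eq_bigr => J _; rewrite -exprMn; congr (_ ^+ 2).
by rewrite /det3 /comb /dot3 /cross/=; ring.
Qed.

Variables (L : R) (mu : K -> probability (measurableTypeR R) R) (Q : probability (vec R K) R).
Hypotheses (L0 : 0 < L) (Qmu : product_law Q mu) (muL : forall k, bounded_density L (mu k)).
Hypothesis mu2 : forall k, (\int[mu k]_x (x ^+ 2)%:E <= 1)%E.

(** Dividing each form by its width reduces to unit widths, with Gram sum 6 (det / (e1 e2 e3))^2;
    the factor sqrt 6 is given away. *)
Lemma small_ball_proj v p q r (e1 e2 e3 : R) : orthonormal v ->
  0 < e1 -> 0 < e2 -> 0 < e3 -> dot3 p (cross q r) != 0 ->
  (Q [set x : vec R K | (`|dot3 p (proj v x)| <= e1 /\ `|dot3 q (proj v x)| <= e2 /\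
                        `|dot3 r (proj v x)| <= e3)%R]
   <= (small_ball_cst L * (e1 * e2 * e3) / `|dot3 p (cross q r)|)%:E)%E.
Proof.
move=> vo e10 e20 e30 d0.
have gE := gram_comb v p q r e1^-1 e2^-1 e3^-1; rewrite (gram_orthonormal vo) in gE.
set d := dot3 p _ in d0 gE *; set g := gram _ _ _ in gE.
have e0 : 0 < e1 * e2 * e3 by rewrite !mulr_gt0.
have g0 : 0 < g.
  by rewrite gE mulr_gt0// exprn_even_gt0//= mulf_neq0// -!invfM invr_neq0// gt_eqF.
have := small_ball_unit L0 Qmu muL mu2 g0.
rewrite /unit_forms.
have E s (e : R) (x : vec R K) : 0 < e ->
    (`|\sum_k comb v s k * e^-1 * x k| <= 1) = (`|dot3 s (proj v x)| <= e).
  move=> e_gt0; rewrite -dot_comb /dot.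
  under eq_bigr do rewrite mulrAC.
  by rewrite -mulr_suml normrM normfV (gtr0_norm e_gt0) ler_pdivrMr// mul1r.
rewrite (_ : [set _ | _] = [set x : vec R K | `|dot3 p (proj v x)| <= e1 /\
    `|dot3 q (proj v x)| <= e2 /\ `|dot3 r (proj v x)| <= e3]); last first.
  by apply/seteqP; split=> x /=; rewrite !E.
move=> /le_trans; apply; rewrite lee_fin -mulrA ler_wpM2l ?(ltW (small_ball_cst_gt0 L0))//.
have -> : e1 * e2 * e3 / `|d| = (Num.sqrt ((`|d| / (e1 * e2 * e3)) ^+ 2))^-1.
  by rewrite sqrtr_sqr [X in _ = X^-1]ger0_norm ?divr_ge0 ?(ltW e0)// invf_div.
have de0 : 0 < `|d| / (e1 * e2 * e3) by rewrite divr_gt0// normr_gt0.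
rewrite lef_pV2 ?posrE ?sqrtr_gt0 ?exprn_gt0//.
rewrite ler_sqrt ?(ltW g0)// -/g gE -[(d * _) ^+ 2]real_normK ?num_real// normrM.
have -> : `|e1^-1 * e2^-1 * e3^-1| = (e1 * e2 * e3)^-1.
  by rewrite -!invfM gtr0_norm// invr_gt0.
by rewrite -[leLHS]mulr1 ler_wpM2l ?sqr_ge0//; lra.
Qed.

End orthonormal_triples.

(** * Second moments *)

Section second_moment.
Context (R : realType) (K : finType).
Local Notation rT := (measurableTypeR R).
Variables (mu : K -> probability rT R) (Q : probability (vec R K) R).
Hypotheses (Qmu : product_law Q mu).
Hypothesis mu1 : forall k, (\int[mu k]_x x%:E = 0)%E.
Hypothesis mu2 : forall k, (\int[mu k]_x (x ^+ 2)%:E <= 1)%E.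

Lemma integrable_sqr_id k : (mu k).-integrable setT (fun x : rT => (x ^+ 2)%:E).
Proof.
apply/integrableP; split; first by apply/measurable_EFinP; exact: measurable_funX.
under eq_integral => x _ do rewrite gee0_abs ?lee_fin ?sqr_ge0//.
by apply: le_lt_trans (mu2 k) _; rewrite ltry.
Qed.

Lemma integrable_id k : (mu k).-integrable setT (fun x : rT => x%:E).
Proof.
have i1 : (mu k).-integrable setT (EFin \o fun=> 1 : R).
  by apply: (@bounded_integrable _ _ _ _ _ 1) => // x; rewrite normr1.
apply: (le_integrable measurableT _ _ (integrableD measurableT (integrable_sqr_id k) i1)).
  exact/measurable_EFinP.
move=> x _; rewrite /= lee_fin [leRHS]ger0_norm ?addr_ge0 ?sqr_ge0//.
have [x0|x0] := ger0P (x : R).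
  by have := sqr_ge0 (x - 1); rewrite sqrrB; lra.
by have := sqr_ge0 (x + 1); rewrite sqrrD; lra.
Qed.

Lemma integral_affine_sqr k (a b : R) :
  (\int[mu k]_x ((a * x + b) ^+ 2)%:E <= (a ^+ 2 + b ^+ 2)%:E)%E.
Proof.
have i2 := integrable_sqr_id k; have i1 := integrable_id k.
have ib : (mu k).-integrable setT (fun=> (b ^+ 2)%:E).
  by apply: (@bounded_integrable _ _ _ _ _ `|b ^+ 2|) => //.
rewrite (eq_integral (fun x : rT => ((a ^+ 2)%:E * (x ^+ 2)%:E + (2 * a * b)%:E * x%:E) + (b ^+ 2)%:E)%E); last first.
  by move=> x _; rewrite -!EFinM -!EFinD; congr EFin; ring.
rewrite integralD//; last by apply: integrableD => //; exact: integrableZl.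
rewrite integralD//; [|exact: integrableZl|exact: integrableZl].
rewrite !integralZl// mu1 mule0 adde0 integral_probability_cst.
rewrite EFinD leeD2r// -[leRHS]mule1; apply: lee_wpmul2l; last exact: mu2.
by rewrite lee_fin sqr_ge0.
Qed.

(** Independent centred coordinates are orthogonal: integrating one coordinate at a time, the cross
    term with the remaining sum vanishes. *)
Lemma integral_dot_sqr_le (a : K -> R) :
  (\int[Q]_x (dot a x ^+ 2)%:E <= (dot a a)%:E)%E.
Proof.
rewrite /dot; elim: (index_enum K) (index_enum_uniq K) => [_|k s ih /= /andP[ks us]].
  rewrite big_nil (eq_integral (fun=> 0%E)) ?integral0// => x _.
  by rewrite big_nil expr0n.
pose S x := \sum_(j <- s) a j * x j.
have mS : measurable_fun setT (S : vec R K -> rT) by exact: measurable_linear_form.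
have mf : measurable_fun setT (fun x : vec R K => ((\sum_(j <- k :: s) a j * x j) ^+ 2)%:E).
  by apply/measurable_EFinP; apply: measurable_funX; exact: (measurable_linear_form a (k :: s)).
have f0 (x : vec R K) : (0 <= ((\sum_(j <- k :: s) a j * x j) ^+ 2)%:E)%E by rewrite lee_fin sqr_ge0.
have -> : (\int[Q]_x ((\sum_(j <- k :: s) a j * x j) ^+ 2)%:E =
    \int[upd_law k (mu k) Q]_x ((\sum_(j <- k :: s) a j * x j) ^+ 2)%:E)%E.
  by apply: eq_measure_integral => A mA _; apply/esym; exact: upd_law_id.
rewrite integral_upd//.
apply: (@le_trans _ _ (\int[Q]_x ((a k ^+ 2)%:E + (S x ^+ 2)%:E))%E).
  apply: ge0_le_integral => //.
  - by move=> x _; apply: integral_ge0.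
  - have mg : measurable_fun setT (fun p : rT * vec R K => ((\sum_(j <- k :: s) a j * updp k p j) ^+ 2)%:E).
      exact: (measurableT_comp mf (@measurable_updp R K k)).
    exact: (measurable_fun_fubini_tonelli_G _ mg (fun p => f0 _)).
  - by apply: emeasurable_funD => //; apply/measurable_EFinP; exact: measurable_funX.
  move=> x _; rewrite -EFinD; apply: le_trans (integral_affine_sqr k (a k) (S x)).
  apply: eq_le_refl; apply: eq_integral => t _.
  rewrite big_cons /upd eqxx; congr ((_ + _) ^+ 2)%:E; apply: eq_big_seq => j js.
  by case: eqP => // jk; move: ks; rewrite -jk js.
rewrite ge0_integralD//; last 3 first.
- by move=> x _; rewrite lee_fin sqr_ge0.
- by move=> x _; rewrite lee_fin sqr_ge0.
- by apply/measurable_EFinP; exact: measurable_funX.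
rewrite integral_probability_cst big_cons EFinD -expr2.
by rewrite leeD2l// ih.
Qed.

End second_moment.

Section measurable_comparisons.
Context d (T : measurableType d) (R : realType).
Local Notation rT := (measurableTypeR R).
Implicit Types f g : T -> rT.

Lemma measurable_le_set f g : measurable_fun setT f -> measurable_fun setT g ->
  measurable [set x | f x <= g x].
Proof.
move=> mf mg; have mt : measurable [set true] by [].
by have := measurable_fun_ler mf mg measurableT mt; rewrite setTI.
Qed.

Lemma measurable_eq0_set f : measurable_fun setT f -> measurable [set x | f x = 0].
Proof.
move=> mf; have := mf measurableT _ (measurable_set1 (0 : R)).
by rewrite setTI.
Qed.

Lemma measurable_neq0_set f : measurable_fun setT f -> measurable [set x | f x != 0].
Proof.
move=> mf; rewrite (_ : [set _ | _] = ~` [set x | f x = 0]).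
  by apply: measurableC; exact: measurable_eq0_set.
by apply/seteqP; split=> x /= /eqP.
Qed.

End measurable_comparisons.

Section cross_product.
Context (R : realType).
Implicit Types p q : R * R * R.

Lemma dot3_ge0 p : 0 <= dot3 p p.
Proof. by rewrite /dot3 -!expr2 !addr_ge0 ?sqr_ge0. Qed.

Lemma dot3C p q : dot3 p q = dot3 q p.
Proof. by rewrite /dot3; ring. Qed.

Lemma dot3_cross p q : dot3 (cross p q) (cross p q) = dot3 p p * dot3 q q - dot3 p q ^+ 2.
Proof. by rewrite /dot3 /cross/=; ring. Qed.

(** Since c is orthogonal to p and q, the products c x q and c x p are quarter turns of q and p in
    their plane, scaled by |c|; their own cross product is |c|^2 (q x p) = - |c|^2 c. *)
Lemma cross_frame p q : let c := cross p q in
  dot3 c (cross (cross c q) (cross c p)) = - (dot3 c c ^+ 2).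
Proof. by rewrite /dot3 /cross/=; ring. Qed.

Lemma sqrt_dot3_cross p q :
  Num.sqrt (dot3 (cross p q) (cross p q)) <= (dot3 p p + dot3 q q) / 2.
Proof.
have s0 : 0 <= (dot3 p p + dot3 q q) / 2 by apply: divr_ge0 => //; apply: addr_ge0; exact: dot3_ge0.
rewrite -(ger0_norm s0) -sqrtr_sqr ler_sqrt ?sqr_ge0// dot3_cross.
have := sqr_ge0 (dot3 p p - dot3 q q); have := sqr_ge0 (dot3 p q); nra.
Qed.

End cross_product.

(** * Probability of the three constraints on the projected columns *)

Section triple_bound.
Context (R : realType) (K : finType).
Local Notation rT := (measurableTypeR R).
Variables (L : R) (mu : K -> probability rT R) (Q : probability (vec R K) R).
Hypotheses (L0 : 0 < L) (Qmu : product_law Q mu) (muL : forall k, bounded_density L (mu k)).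
Hypothesis mu1 : forall k, (\int[mu k]_x x%:E = 0)%E.
Hypothesis mu2 : forall k, (\int[mu k]_x (x ^+ 2)%:E <= 1)%E.
Variables (u s w : (K -> R) * (K -> R) * (K -> R)) (I : {set K}).
Hypotheses (ou : orthonormal u) (os : orthonormal s) (ow : orthonormal w).
Hypothesis uI : forall k, k \notin I -> [/\ u.1.1 k = 0, u.1.2 k = 0 & u.2 k = 0].
Hypothesis sI : forall k, k \in I -> [/\ s.1.1 k = 0, s.1.2 k = 0 & s.2 k = 0].
Hypothesis wI : forall k, k \in I -> [/\ w.1.1 k = 0, w.1.2 k = 0 & w.2 k = 0].
Variables (X t eta : R).
Hypotheses (X0 : 0 < X) (t0 : 0 < t) (eta0 : 0 < eta).

(** [u] is supported in I, [s] and [w] outside it: once the coordinates outside I are frozen, c is a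
    constant and p is still random. Squares stand for absolute values so that no roots occur. *)
Definition triple_event : set (vec R K) := [set x : vec R K |
  let p := proj u x in let c := cross (proj s x) (proj w x) in
  (dot3 c c != 0 /\ X ^+ 2 * dot3 p c ^+ 2 <= t ^+ 2 * dot3 c c) /\
  (dot3 p (cross c (proj w x)) ^+ 2 <= eta ^+ 2 * dot3 c c ^+ 2 /\
   dot3 p (cross c (proj s x)) ^+ 2 <= eta ^+ 2 * dot3 c c ^+ 2)].

Let mdot (a : K -> R) : measurable_fun setT (dot a : vec R K -> rT).
Proof. exact: measurable_linear_form. Qed.

Let mfun3 (f : vec R K -> R * R * R) : Prop :=
  [/\ measurable_fun setT (fun x => (f x).1.1 : rT), measurable_fun setT (fun x => (f x).1.2 : rT) &
      measurable_fun setT (fun x => (f x).2 : rT)].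

Let mproj v : mfun3 (proj v).
Proof. by split; exact: mdot. Qed.

Let mcross f g : mfun3 f -> mfun3 g -> mfun3 (fun x => cross (f x) (g x)).
Proof.
by move=> [f1 f2 f3] [g1 g2 g3]; split; apply: measurable_funB; exact: measurable_funM.
Qed.

Let mdot3 f g : mfun3 f -> mfun3 g -> measurable_fun setT (fun x => dot3 (f x) (g x) : rT).
Proof.
move=> [f1 f2 f3] [g1 g2 g3].
by apply: measurable_funD; [apply: measurable_funD|]; exact: measurable_funM.
Qed.

Lemma measurable_triple_event : measurable triple_event.
Proof.
have mc := mcross (mproj s) (mproj w).
have mcc := mdot3 mc mc.
have mpc := mdot3 (mproj u) mc.
have mpw := mdot3 (mproj u) (mcross mc (mproj w)).
have mps := mdot3 (mproj u) (mcross mc (mproj s)).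
have mccX := measurable_funX 2 mcc.
rewrite [triple_event](_ : _ = ([set x | dot3 (cross (proj s x) (proj w x)) (cross (proj s x) (proj w x)) != 0] `&`
   [set x | X ^+ 2 * dot3 (proj u x) (cross (proj s x) (proj w x)) ^+ 2 <=
      t ^+ 2 * dot3 (cross (proj s x) (proj w x)) (cross (proj s x) (proj w x))]) `&`
   ([set x | dot3 (proj u x) (cross (cross (proj s x) (proj w x)) (proj w x)) ^+ 2 <=
      eta ^+ 2 * dot3 (cross (proj s x) (proj w x)) (cross (proj s x) (proj w x)) ^+ 2] `&`
    [set x | dot3 (proj u x) (cross (cross (proj s x) (proj w x)) (proj s x)) ^+ 2 <=
      eta ^+ 2 * dot3 (cross (proj s x) (proj w x)) (cross (proj s x) (proj w x)) ^+ 2])); last by [].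
have mcst (r : R) : measurable_fun setT (fun _ : vec R K => r : rT) by exact: measurable_cst.
apply: measurableI; apply: measurableI.
- exact: measurable_neq0_set mcc.
- exact: (measurable_le_set (measurable_funM (mcst _) (measurable_funX 2 mpc)) (measurable_funM (mcst _) mcc)).
- exact: (measurable_le_set (measurable_funX 2 mpw) (measurable_funM (mcst _) mccX)).
- exact: (measurable_le_set (measurable_funX 2 mps) (measurable_funM (mcst _) mccX)).
Qed.

Let proj_mix_in z x : proj u (mix I z x) = proj u z.
Proof.
by congr (_, _, _); apply: eq_bigr => k _; rewrite /mix; case: ifPn => // /uI[h1 h2 h3];
  rewrite ?h1 ?h2 ?h3 !mul0r.
Qed.

Let proj_mix_out (v : (K -> R) * (K -> R) * (K -> R)) z x : (forall k, k \in I -> [/\ v.1.1 k = 0, v.1.2 k = 0 & v.2 k = 0]) ->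
  proj v (mix I z x) = proj v x.
Proof.
by move=> vI; congr (_, _, _); apply: eq_bigr => k _; rewrite /mix; case: ifPn => // /vI[h1 h2 h3];
  rewrite ?h1 ?h2 ?h3 !mul0r.
Qed.

Let sqr_le_norm (a b : R) : 0 <= b -> a ^+ 2 <= b ^+ 2 -> `|a| <= b.
Proof. by move=> b0; rewrite -(ler_sqr (normr_ge0 a) b0)// real_normK ?num_real. Qed.

(** With r = |c| the widths are (t / X) r, eta r^2 and eta r^2, and the determinant has modulus r^4
    by [cross_frame]. What survives is r to the first power, bounded by the mean of the two squared
    lengths. *)
Lemma triple_section_le x : (Q [set z | triple_event (mix I z x)] <=
  (small_ball_cst L * (t / X) * eta ^+ 2 *
     ((dot3 (proj s x) (proj s x) + dot3 (proj w x) (proj w x)) / 2))%:E)%E.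
Proof.
set c := cross (proj s x) (proj w x).
have C0 := small_ball_cst_gt0 L0.
have cst0 := mulr_ge0 (mulr_ge0 (ltW C0) (divr_ge0 (ltW t0) (ltW X0))) (sqr_ge0 eta).
(* The event demands a nonzero c, so the degenerate section is empty. *)
have [c0|c0] := eqVneq (dot3 c c) 0.
  rewrite (_ : [set _ | _] = set0).
    have pq0 := divr_ge0 (addr_ge0 (dot3_ge0 (proj s x)) (dot3_ge0 (proj w x))) (ler0n R 2).
    rewrite measure0 lee_fin; exact: (mulr_ge0 cst0 pq0).
  apply/seteqP; split=> z //=; rewrite /triple_event /mkset; cbv zeta.
  rewrite (proj_mix_out _ _ sI) (proj_mix_out _ _ wI) -/c c0 eqxx.
  by case=> [[]].
have cp : 0 < dot3 c c by rewrite lt_neqAle eq_sym c0 dot3_ge0.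
set r := Num.sqrt (dot3 c c).
have r0 : 0 < r by rewrite sqrtr_gt0.
have rr : dot3 c c = r ^+ 2 by rewrite sqr_sqrtr ?dot3_ge0.
have d : dot3 c (cross (cross c (proj w x)) (cross c (proj s x))) = - r ^+ 4.
  by rewrite cross_frame -/c rr -exprM.
have d0 : dot3 c (cross (cross c (proj w x)) (cross c (proj s x))) != 0.
  by rewrite d oppr_eq0 expf_neq0// gt_eqF.
have e10 : 0 < t / X * r by rewrite !mulr_gt0 ?invr_gt0.
have e20 : 0 < eta * r ^+ 2 by rewrite mulr_gt0 ?exprn_gt0.
have H := small_ball_proj L0 Qmu muL mu2 ou e10 e20 e20 d0.
apply: (@le_trans _ _ (small_ball_cst L * (t / X * r * (eta * r ^+ 2) * (eta * r ^+ 2)) / `|- r ^+ 4|)%:E); last first.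
  rewrite lee_fin normrN (ger0_norm (exprn_ge0 4 (ltW r0))).
  rewrite [leLHS](_ : _ = small_ball_cst L * (t / X) * eta ^+ 2 * r).
    exact: (ler_wpM2l cst0 (sqrt_dot3_cross _ _)).
  by field; rewrite !gt_eqF.
rewrite -d; apply: le_trans H; apply: le_measure; rewrite ?inE.
- rewrite -[X in measurable X]setTI.
  exact: (measurable_mixl I x measurableT measurable_triple_event).
- rewrite (_ : [set _ | _] =
    [set x0 : vec R K | `|dot (comb u c) x0| <= t / X * r] `&`
    ([set x0 : vec R K | `|dot (comb u (cross c (proj w x))) x0| <= eta * r ^+ 2] `&`
     [set x0 : vec R K | `|dot (comb u (cross c (proj s x))) x0| <= eta * r ^+ 2])); last first.
    by apply/seteqP; split=> z /=; rewrite !dot_comb.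
  by apply: measurableI; [|apply: measurableI]; exact: measurable_norm_form_le.
move=> z; rewrite /triple_event /mkset; cbv zeta.
rewrite proj_mix_in (proj_mix_out _ _ sI) (proj_mix_out _ _ wI) -/c => -[[_ h1] [h2 h3]].
split; [|split]; rewrite dot3C; apply: sqr_le_norm; rewrite ?(ltW e10) ?(ltW e20)//.
- rewrite -(ler_pM2l (exprn_gt0 2 X0)); apply: (le_trans h1).
  by rewrite rr; apply: eq_le_refl; field; rewrite gt_eqF.
- by apply: (le_trans h2); rewrite rr [leRHS]exprMn.
- by apply: (le_trans h3); rewrite rr [leRHS]exprMn.
Qed.

Let integral_proj v : orthonormal v -> (\int[Q]_x (dot3 (proj v x) (proj v x))%:E <= 3%:E)%E.
Proof.
move=> [[v1 v2 v3] _].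
have mE (a : K -> R) : measurable_fun setT (fun x : vec R K => (dot a x ^+ 2)%:E).
  by apply/measurable_EFinP; apply: measurable_funX; exact: mdot.
rewrite (eq_integral (fun x : vec R K => ((dot v.1.1 x ^+ 2)%:E + (dot v.1.2 x ^+ 2)%:E) + (dot v.2 x ^+ 2)%:E)%E); last first.
  by move=> x _; rewrite -!EFinD.
have sq0 (a : K -> R) : forall x : vec R K, setT x -> (0 <= (dot a x ^+ 2)%:E)%E.
  by move=> x _; rewrite lee_fin sqr_ge0.
rewrite ge0_integralD//; last 3 first.
- by move=> x xT; apply: adde_ge0; exact: sq0.
- by apply: emeasurable_funD.
- exact: sq0.
rewrite ge0_integralD//; [|exact: sq0|exact: sq0].
rewrite (_ : 3%:E = (1 + 1 + 1)%:E :> \bar R); last by congr EFin; ring.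
rewrite EFinD EFinD -{1}v1 -{1}v2 -v3.
by apply: leeD; [apply: leeD|]; apply: (integral_dot_sqr_le Qmu mu1 mu2).
Qed.

(** Each squared projection length has mean at most 3, being a sum of three second moments of unit
    forms; the half sum of two of them is again at most 3. *)
Lemma triple_bound :
  (Q triple_event <= (3 * small_ball_cst L * (t / X) * eta ^+ 2)%:E)%E.
Proof.
have mT := measurable_triple_event.
rewrite (measure_mix I Qmu mT).
set C := small_ball_cst L * (t / X) * eta ^+ 2 / 2.
have C0 : 0 <= C.
  apply: divr_ge0 => //; apply: mulr_ge0; last exact: sqr_ge0.
  by apply: mulr_ge0; [exact: (ltW (small_ball_cst_gt0 L0))|apply: divr_ge0; exact: ltW].
have md v : measurable_fun setT (fun x : vec R K => (dot3 (proj v x) (proj v x))%:E).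
  by apply/measurable_EFinP; exact: mdot3.
have d0 v : forall x : vec R K, setT x -> (0 <= (dot3 (proj v x) (proj v x))%:E)%E.
  by move=> x _; rewrite lee_fin dot3_ge0.
apply: (@le_trans _ _ (\int[Q]_x (C%:E * ((dot3 (proj s x) (proj s x))%:E + (dot3 (proj w x) (proj w x))%:E)))%E).
  apply: ge0_le_integral => //.
  - exact: measurable_measure_mix.
  - by apply: emeasurable_funM => //; exact: emeasurable_funD.
  move=> x _; apply: (le_trans (triple_section_le x)); rewrite -EFinD -EFinM lee_fin /C.
  by apply: eq_le_refl; ring.
rewrite ge0_integralZl//; last 2 first.
- exact: emeasurable_funD.
- by move=> x xT; apply: adde_ge0; exact: d0.
rewrite ge0_integralD//; [|exact: d0|exact: d0].
apply: (@le_trans _ _ (C%:E * (3%:E + 3%:E))%E).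
  by apply: lee_wpmul2l; rewrite ?lee_fin//; apply: leeD; exact: integral_proj.
by rewrite -EFinD -EFinM lee_fin /C; apply: eq_le_refl; field; rewrite gt_eqF.
Qed.

End triple_bound.

(** * Rows of the adjugate matrix *)

Section adjugate_geometry.
Context (R : realType) (n : nat).
Implicit Types (A : 'M[R]_n) (v : ('I_n -> R) * ('I_n -> R) * ('I_n -> R)) (u : 'I_n -> R).

Definition column A m : 'I_n -> R := fun k => A k m.

Definition adj_row A m : 'I_n -> R := fun k => (\adj A) m k.

Definition adj_norm2 A m : R := dot (adj_row A m) (adj_row A m).

Lemma sum_dot_adj_row A u k :
  \sum_m dot u (column A m) * adj_row A m k = \det A * u k.
Proof.
rewrite (eq_bigr (fun m => \sum_k' u k' * (A k' m * (\adj A) m k))); last first.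
  by move=> m _; rewrite mulr_suml; apply: eq_bigr => k' _; rewrite mulrA.
rewrite exchange_big/=.
rewrite (eq_bigr (fun k' => u k' * ((\det A)%:M : 'M[R]_n) k' k)); last first.
  by move=> k' _; rewrite -mulr_sumr -mul_mx_adj mxE.
rewrite (bigD1 k)//= big1 ?addr0; last first.
  by move=> k' k'k; rewrite mxE (negbTE k'k) mulr0n mulr0.
by rewrite mxE eqxx mulr1n mulrC.
Qed.

Lemma dot_adj_row A m u : \sum_k (\adj A) m k * (\sum_j A k j * u j) = \det A * u m.
Proof.
rewrite (eq_bigr (fun k => \sum_j u j * ((\adj A) m k * A k j))); last first.
  by move=> k _; rewrite mulr_sumr; apply: eq_bigr => j _; ring.
rewrite exchange_big/=.
rewrite (eq_bigr (fun j => u j * ((\det A)%:M : 'M[R]_n) m j)); last first.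
  by move=> j _; rewrite -mulr_sumr -mul_adj_mx mxE.
rewrite (bigD1 m)//= big1 ?addr0; last first.
  by move=> j jm; rewrite mxE eq_sym (negbTE jm) mulr0n mulr0.
by rewrite mxE eqxx mulr1n mulrC.
Qed.

Section three_columns.
Variables (A : 'M[R]_n) (i j l : 'I_n) (v : ('I_n -> R) * ('I_n -> R) * ('I_n -> R)).
Hypotheses (ij : i != j) (il : i != l) (jl : j != l) (vo : orthonormal v).
Hypothesis vA : forall m, m != i -> m != j -> m != l -> proj v (column A m) = (0, 0, 0).
Let p m := proj v (column A m).
Let N := adj_row A.

Let three_terms u k : (forall m, m != i -> m != j -> m != l -> dot u (column A m) = 0) ->
  \det A * u k = dot u (column A i) * N i k + dot u (column A j) * N j k + dot u (column A l) * N l k.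
Proof.
move=> u0; rewrite -sum_dot_adj_row (bigD1 i)//= (bigD1 j) 1?eq_sym//=.
rewrite (bigD1 l) 1?eq_sym ?il 1?eq_sym ?jl//= big1 ?addr0 ?addrA//.
by move=> m /andP[/andP[mi mj] ml]; rewrite u0// mul0r.
Qed.

Let comb_terms q k :
  \det A * comb v q k = dot3 q (p i) * N i k + dot3 q (p j) * N j k + dot3 q (p l) * N l k.
Proof.
rewrite (@three_terms (comb v q)) ?dot_comb// => m mi mj ml.
by rewrite dot_comb vA// /dot3/= !mulr0 !addr0.
Qed.

Let norm_terms q a m : (forall k, \det A * comb v q k = a * N m k) ->
  \det A ^+ 2 * dot3 q q = a ^+ 2 * adj_norm2 A m.
Proof.
move=> E; rewrite -(dot_comb_comb q q vo) /adj_norm2 /dot !mulr_sumr.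
apply: eq_bigr => k _.
rewrite [LHS](_ : _ = (\det A * comb v q k) * (\det A * comb v q k)); last by ring.
by rewrite E /N; ring.
Qed.

Let D := dot3 (p i) (cross (p j) (p l)).

(** Pairing with p_j x p_l kills the columns j and l in the expansion of [comb_terms], leaving D
    times the row i of the adjugate; lengths are then read off in the orthonormal triple. *)
Let normi : \det A ^+ 2 * dot3 (cross (p j) (p l)) (cross (p j) (p l)) = D ^+ 2 * adj_norm2 A i.
Proof. by apply: norm_terms => k; rewrite comb_terms /D /dot3 /cross/=; ring. Qed.

Let normj : \det A ^+ 2 * dot3 (cross (p l) (p i)) (cross (p l) (p i)) = D ^+ 2 * adj_norm2 A j.
Proof. by apply: norm_terms => k; rewrite comb_terms /D /dot3 /cross/=; ring. Qed.

Let norml : \det A ^+ 2 * dot3 (cross (p i) (p j)) (cross (p i) (p j)) = D ^+ 2 * adj_norm2 A l.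
Proof. by apply: norm_terms => k; rewrite comb_terms /D /dot3 /cross/=; ring. Qed.

Let dot3_eq0 (q : R * R * R) : dot3 q q = 0 -> [/\ q.1.1 = 0, q.1.2 = 0 & q.2 = 0].
Proof.
rewrite /dot3 -!expr2 => /eqP; rewrite !paddr_eq0 ?addr_ge0 ?sqr_ge0// !sqrf_eq0.
by move=> /andP[/andP[/eqP -> /eqP ->] /eqP ->].
Qed.

(** If the cross product vanished, so would D, and by the three norm identities so would all three
    cross products. The minors of the first two vectors of [v], times det^2, are combinations of the
    last components of these products, so those two vectors would be parallel, against Lagrange's
    identity for an orthonormal pair. *)
Lemma cross_columns_neq0 : \det A != 0 -> dot3 (cross (p j) (p l)) (cross (p j) (p l)) != 0.
Proof.
move=> d0; apply/eqP => c0.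
have D0 : D = 0 by have [h1 h2 h3] := dot3_eq0 c0; rewrite /D /dot3 h1 h2 h3 !mulr0 !addr0.
have d20 : \det A ^+ 2 != 0 by rewrite expf_neq0.
have z (q : R * R * R) (a : R) : \det A ^+ 2 * dot3 q q = D ^+ 2 * a -> q.2 = 0.
  rewrite D0 expr0n mul0r => /eqP; rewrite mulf_eq0 (negbTE d20)/= => /eqP.
  by move=> /dot3_eq0[].
have zi := z _ _ normi; have zj := z _ _ normj; have zl := z _ _ norml.
have [[v11 v22 _] [v12 _ _]] := vo.
have : \sum_a \sum_b (v.1.1 a * v.1.2 b - v.1.1 b * v.1.2 a) ^+ 2 = 0.
  apply: big1 => a _; apply: big1 => b _; apply/eqP; rewrite sqrf_eq0.
  rewrite -(mulrI_eq0 _ (mulfI d20)).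
  have E1 k : \det A * v.1.1 k = (p i).1.1 * N i k + (p j).1.1 * N j k + (p l).1.1 * N l k.
    by apply: three_terms => m mi mj ml; have /(congr1 (fun q => q.1.1)) := vA mi mj ml.
  have E2 k : \det A * v.1.2 k = (p i).1.2 * N i k + (p j).1.2 * N j k + (p l).1.2 * N l k.
    by apply: three_terms => m mi mj ml; have /(congr1 (fun q => q.1.2)) := vA mi mj ml.
  rewrite (_ : \det A ^+ 2 * _ = (\det A * v.1.1 a) * (\det A * v.1.2 b) -
     (\det A * v.1.1 b) * (\det A * v.1.2 a)); last by ring.
  rewrite !E1 !E2.
  rewrite (_ : _ - _ = (cross (p j) (p l)).2 * (N j a * N l b - N j b * N l a) +
    (cross (p l) (p i)).2 * (N l a * N i b - N l b * N i a) +
    (cross (p i) (p j)).2 * (N i a * N j b - N i b * N j a)); last by rewrite /cross/=; ring.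
  by rewrite zi zj zl !mul0r !addr0.
rewrite lagrange_identity v11 v22 v12 => /eqP; rewrite expr0n/= mulr1 subr0 mulr1.
by rewrite pnatr_eq0.
Qed.

(** The norm identities translate |N_j| <= eta |N_i| into |p_l x p_i| <= eta |c|, and likewise for
    l. The mixed products p_i . (c x p_l) and p_i . (c x p_j) are, up to sign, products of c with
    these vectors, so Cauchy-Schwarz concludes. *)
Lemma adj_rows_projection (X t eta : R) : \det A != 0 ->
  X ^+ 2 * \det A ^+ 2 <= t ^+ 2 * adj_norm2 A i ->
  adj_norm2 A j <= eta ^+ 2 * adj_norm2 A i ->
  adj_norm2 A l <= eta ^+ 2 * adj_norm2 A i ->
  let c := cross (p j) (p l) in
  [/\ X ^+ 2 * dot3 (p i) c ^+ 2 <= t ^+ 2 * dot3 c c,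
      dot3 (p i) (cross c (p l)) ^+ 2 <= eta ^+ 2 * dot3 c c ^+ 2 &
      dot3 (p i) (cross c (p j)) ^+ 2 <= eta ^+ 2 * dot3 c c ^+ 2].
Proof.
move=> d0 hi hj hl c.
have d20 : 0 < \det A ^+ 2 by rewrite exprn_even_gt0.
have cs (q r : R * R * R) : dot3 q r ^+ 2 <= dot3 q q * dot3 r r.
  by have := dot3_ge0 (cross q r); rewrite dot3_cross subr_ge0.
have small q m : \det A ^+ 2 * dot3 q q = D ^+ 2 * adj_norm2 A m ->
    adj_norm2 A m <= eta ^+ 2 * adj_norm2 A i -> dot3 q q <= eta ^+ 2 * dot3 c c.
  move=> E h; rewrite -(ler_pM2l d20) E mulrCA normi mulrCA ler_wpM2l ?sqr_ge0//.
split.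
- rewrite -(ler_pM2l d20) [leRHS]mulrCA normi -/D.
  rewrite [leLHS](_ : _ = D ^+ 2 * (X ^+ 2 * \det A ^+ 2)); last by rewrite -/c /D; ring.
  by rewrite [leRHS]mulrCA ler_wpM2l ?sqr_ge0.
- rewrite (_ : dot3 (p i) _ = dot3 c (cross (p l) (p i))); last first.
    by rewrite /dot3 /cross/=; ring.
  apply: (le_trans (cs _ _)); rewrite (expr2 (dot3 c c)) mulrCA ler_wpM2l ?dot3_ge0//.
  exact: small normj hj.
- rewrite (_ : dot3 (p i) _ = - dot3 c (cross (p i) (p j))); last first.
    by rewrite /dot3 /cross/=; ring.
  rewrite sqrrN.
  apply: (le_trans (cs _ _)); rewrite (expr2 (dot3 c c)) mulrCA ler_wpM2l ?dot3_ge0//.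
  exact: small norml hl.
Qed.

End three_columns.

(** A square matrix whose column l is zero is singular, hence has a nonzero left kernel vector,
    which is then normalised. *)
Lemma exists_unit_orthogonal (f : 'I_n -> 'I_n -> R) (l : 'I_n) :
  exists2 u, dot u u = 1 & forall m, m != l -> dot u (f m) = 0.
Proof.
pose M : 'M[R]_n := \matrix_(k, m) (if m == l then 0 else f m k).
have : \det M == 0.
  by rewrite (expand_det_col M l) big1// => k _; rewrite mxE eqxx mul0r.
move=> /det0P[v v0 vM].
pose w k := v 0 k.
have w0 : 0 < dot w w.
  rewrite lt_neqAle dot_ge0 andbT eq_sym; apply: contra_neq v0 => w0.
  apply/rowP => k; rewrite mxE; apply/eqP.
  have h : w k * w k = 0.
    apply: (@psumr_eq0P R 'I_n xpredT (fun k => w k * w k) _ w0 k isT).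
    by move=> a _; rewrite -expr2 sqr_ge0.
  by have /eqP := h; rewrite mulf_eq0 orbb.
have s0 : 0 < Num.sqrt (dot w w) by rewrite sqrtr_gt0.
exists (fun k => (Num.sqrt (dot w w))^-1 * w k).
  rewrite dotZl dotC dotZl mulrA -invfM -expr2 sqr_sqrtr ?dot_ge0// mulVf// gt_eqF//.
move=> m ml; rewrite dotZl (_ : dot w (f m) = 0) ?mulr0//.
have := congr1 (fun A : 'rV[R]_n => A 0 m) vM; rewrite !mxE => <-.
by apply: eq_bigr => k _; rewrite !mxE (negbTE ml).
Qed.

(** The vectors already found are put in the slots i and j, whose columns impose no constraint; the
    slot l remains free, as each existence step requires. *)
Lemma exists_orthonormal (f : 'I_n -> 'I_n -> R) (i j l : 'I_n) :
  i != j -> i != l -> j != l ->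
  exists2 v, orthonormal v & forall m, m != i -> m != j -> m != l -> proj v (f m) = (0, 0, 0).
Proof.
move=> ij il jl.
have [v1 v11 v1f] := exists_unit_orthogonal f l.
have [v2 v22 v2f] := exists_unit_orthogonal (fun m => if m == i then v1 else f m) l.
have [v3 v33 v3f] := exists_unit_orthogonal
  (fun m => if m == i then v1 else if m == j then v2 else f m) l.
exists (v1, v2, v3).
  split; split=> //=.
  - by have := v2f _ il; rewrite eqxx dotC.
  - by have := v3f _ il; rewrite eqxx dotC.
  - by have := v3f _ jl; rewrite eq_sym (negbTE ij) eqxx dotC.
move=> m mi mj ml; rewrite /proj/= v1f//.
have := v2f _ ml; rewrite (negbTE mi) => ->.
by have := v3f _ ml; rewrite (negbTE mi) (negbTE mj) => ->.
Qed.

End adjugate_geometry.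

(** * Events on three rows of the adjugate of a random matrix *)

Section random_matrix.
Context (R : realType) (n : nat).
Local Notation rT := (measurableTypeR R).
Local Notation K := ('I_n * 'I_n)%type.

Definition mat (x : vec R K) : 'M[R]_n := \matrix_(i, j) x (i, j).

Lemma measurable_det d (T : measurableType d) m (f : T -> 'M[R]_m) :
  (forall i j, measurable_fun setT (fun t => f t i j : rT)) ->
  measurable_fun setT (fun t => \det (f t) : rT).
Proof.
move=> mf; apply: measurable_sum => s; apply: measurable_funM; first exact: measurable_cst.
by apply: measurable_prod => i _; exact: mf.
Qed.

Lemma measurable_mat i j : measurable_fun setT (fun x : vec R K => mat x i j : rT).
Proof.
rewrite (_ : (fun x => _) = (fun x : vec R K => x (i, j))); first exact: measurable_coord.
by apply/funext => x; rewrite mxE.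
Qed.

Lemma measurable_cofactor i j :
  measurable_fun setT (fun x : vec R K => cofactor (mat x) i j : rT).
Proof.
apply: measurable_funM; first exact: measurable_cst.
apply: measurable_det => a b.
rewrite (_ : (fun x => _) = (fun x : vec R K => x (lift i a, lift j b))); first exact: measurable_coord.
by apply/funext => x; rewrite !mxE.
Qed.

Lemma measurable_adj_norm2 m :
  measurable_fun setT (fun x : vec R K => adj_norm2 (mat x) m : rT).
Proof.
rewrite (_ : (fun x => _) = (fun x : vec R K => \sum_k (cofactor (mat x) k m * cofactor (mat x) k m))).
  by apply: measurable_sum => k; apply: measurable_funM; exact: measurable_cofactor.
by apply/funext => x; apply: eq_bigr => k _; rewrite /adj_row mxE.
Qed.

Variables (L : R) (mu : K -> probability rT R) (Q : probability (vec R K) R).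
Hypotheses (L0 : 0 < L) (Qmu : product_law Q mu) (muL : forall k, bounded_density L (mu k)).
Hypothesis mu1 : forall k, (\int[mu k]_x x%:E = 0)%E.
Hypothesis mu2 : forall k, (\int[mu k]_x (x ^+ 2)%:E <= 1)%E.

Definition adj_event (i j l : 'I_n) (X t eta : R) : set (vec R K) := [set x : vec R K |
  (\det (mat x) != 0 /\ X ^+ 2 * \det (mat x) ^+ 2 <= t ^+ 2 * adj_norm2 (mat x) i) /\
  (adj_norm2 (mat x) j <= eta ^+ 2 * adj_norm2 (mat x) i /\
   adj_norm2 (mat x) l <= eta ^+ 2 * adj_norm2 (mat x) i)].

Lemma measurable_adj_event i j l X t eta : measurable (adj_event i j l X t eta).
Proof.
rewrite [adj_event _ _ _ _ _ _](_ : _ = ([set x : vec R K | \det (mat x) != 0] `&`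
  [set x | X ^+ 2 * \det (mat x) ^+ 2 <= t ^+ 2 * adj_norm2 (mat x) i]) `&`
  ([set x | adj_norm2 (mat x) j <= eta ^+ 2 * adj_norm2 (mat x) i] `&`
   [set x | adj_norm2 (mat x) l <= eta ^+ 2 * adj_norm2 (mat x) i])); last by [].
have md := measurable_det measurable_mat.
have mcst (r : R) : measurable_fun setT (fun _ : vec R K => r : rT) by exact: measurable_cst.
have mi r := measurable_funM (mcst r) (measurable_adj_norm2 i).
apply: measurableI; apply: measurableI.
- exact: measurable_neq0_set md.
- exact: (measurable_le_set (measurable_funM (mcst _) (measurable_funX 2 md)) (mi _)).
- exact: (measurable_le_set (measurable_adj_norm2 j) (mi _)).
- exact: (measurable_le_set (measurable_adj_norm2 l) (mi _)).
Qed.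

Definition in_column (m : 'I_n) (u : 'I_n -> R) : K -> R :=
  fun k => if k.2 == m then u k.1 else 0.

Lemma dot_in_column m u (x : vec R K) : dot (in_column m u) x = dot u (column (mat x) m).
Proof.
rewrite /dot (eq_bigr (fun k => in_column m u (k.1, k.2) * x (k.1, k.2))); last by case.
rewrite -(pair_bigA _ (fun i j => in_column m u (i, j) * x (i, j)))/=.
apply: eq_bigr => i _; rewrite (bigD1 m)//= big1 ?addr0; last first.
  by move=> j jm; rewrite /in_column/= (negbTE jm) mul0r.
by rewrite /in_column/= eqxx /column mxE.
Qed.

Definition in_column3 m (v : ('I_n -> R) * ('I_n -> R) * ('I_n -> R)) :=
  (in_column m v.1.1, in_column m v.1.2, in_column m v.2).

Lemma proj_in_column m v (x : vec R K) : proj (in_column3 m v) x = proj v (column (mat x) m).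
Proof. by rewrite /proj !dot_in_column. Qed.

Lemma orthonormal_in_column m v : orthonormal v -> orthonormal (in_column3 m v).
Proof.
have E u w : dot (in_column m u) (in_column m w) = dot u w.
  rewrite dot_in_column; apply: eq_bigr => k _.
  by rewrite /column mxE /in_column/= eqxx.
by move=> [[v1 v2 v3] [v4 v5 v6]]; split; split; rewrite /= E.
Qed.

Lemma adj_event_bound i j l X t eta : i != j -> i != l -> j != l ->
  0 < X -> 0 < t -> 0 < eta ->
  (Q (adj_event i j l X t eta) <= (3 * small_ball_cst L * (t / X) * eta ^+ 2)%:E)%E.
Proof.
move=> ij il jl X0 t0 eta0.
pose I : {set K} := [set k : K | k.2 \in [:: i; j; l]]%SET.
rewrite (measure_mix I Qmu (measurable_adj_event i j l X t eta)).
set C := (_ * _ * _ * _)%R.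
apply: (@le_trans _ _ (\int[Q]_x (C%:E)%E)%E); last by rewrite integral_probability_cst.
have C0 : 0 <= C.
  apply: mulr_ge0; last exact: sqr_ge0.
  by apply: mulr_ge0; [apply: mulr_ge0 => //; exact: (ltW (small_ball_cst_gt0 L0))|apply: divr_ge0; exact: ltW].
apply: ge0_le_integral => //.
- apply: measurable_measure_mix; exact: measurable_adj_event.
move=> y _.
have [v vo vy] := exists_orthonormal (fun m => column (mat y) m) ij il jl.
(* In [triple_bound] the column i is resampled in turn, while the columns j and l fix the cross
   product. *)
pose S : {set K} := [set k : K | k.2 == i]%SET.
have H := @triple_bound R K L mu Q L0 Qmu muL mu1 mu2 (in_column3 i v) (in_column3 j v)
  (in_column3 l v) S (orthonormal_in_column i vo) (orthonormal_in_column j vo)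
  (orthonormal_in_column l vo).
apply: le_trans (H _ _ _ X t eta X0 t0 eta0); last 3 first.
- by move=> k; rewrite inE => /negbTE ki; rewrite /in_column3 /in_column/= ki.
- by move=> k; rewrite inE => /eqP ki; rewrite /in_column3 /in_column/= ki (negbTE ij).
- by move=> k; rewrite inE => /eqP ki; rewrite /in_column3 /in_column/= ki (negbTE il).
apply: le_measure; rewrite ?inE.
- rewrite -[X in measurable X]setTI.
  exact: (measurable_mixl I y measurableT (measurable_adj_event i j l X t eta)).
- exact: measurable_triple_event.
move=> z; set x := mix I z y => -[[d0 h1] [h2 h3]].
have col m : m \in [:: i; j; l] -> column (mat x) m = column (mat z) m.
  by move=> mI; apply/funext => k; rewrite /column !mxE /x /mix inE/= mI.
have vx m : m != i -> m != j -> m != l -> proj v (column (mat x) m) = (0, 0, 0).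
  move=> mi mj ml; rewrite -(vy m mi mj ml); congr (proj v _); apply/funext => k.
  by rewrite /column !mxE /x /mix inE/= !inE (negbTE mi) (negbTE mj) (negbTE ml).
have [g1 g2 g3] := adj_rows_projection ij il jl vo vx d0 h1 h2 h3.
have c0 := cross_columns_neq0 ij il jl vo vx d0.
rewrite /triple_event /mkset; cbv zeta.
rewrite !proj_in_column -!col ?inE ?eqxx ?orbT//.
Qed.

End random_matrix.

(** * Flat events *)

Section union_bounds.
Context d (T : measurableType d) (R : realType) (Q : probability T R).

(** Markov's inequality for the weighted number of events [W i] that occur. *)
Lemma markov_sum (I : finType) (w : I -> R) (W : I -> set T) (E : set T) (c : R) :
  0 <= c -> (forall i, 0 <= w i) -> (forall i, measurable (W i)) -> measurable E ->
  (forall x, E x -> c <= \sum_i w i * \1_(W i) x) ->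
  (c%:E * Q E <= \sum_i (w i)%:E * Q (W i))%E.
Proof.
move=> c0 w0 mW mE H.
have mI (A : set T) : measurable A -> measurable_fun setT (fun x => (\1_A x)%:E : \bar R).
  by move=> mA; apply/measurable_EFinP; exact: measurable_indic.
have I0 (A : set T) (x : T) : setT x -> (0 <= (\1_A x)%:E :> \bar R)%E by rewrite lee_fin.
have -> : (c%:E * Q E = \int[Q]_x (c%:E * (\1_E x)%:E))%E.
  by rewrite ge0_integralZl//; [rewrite integral_indic// setIT|exact: mI].
have -> : (\sum_i (w i)%:E * Q (W i) = \int[Q]_x (\sum_i (w i)%:E * (\1_(W i) x)%:E))%E.
  rewrite ge0_integral_sum//.
  - apply: eq_bigr => i _; rewrite ge0_integralZl ?lee_fin//; last exact: mI.
    by rewrite integral_indic// setIT.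
  - by move=> i; apply: emeasurable_funM => //; exact: mI.
  - by move=> i x xT; apply: mule_ge0; [rewrite lee_fin|exact: I0].
apply: ge0_le_integral => //.
- by move=> x xT; apply: mule_ge0; [rewrite lee_fin|exact: I0].
- by apply: emeasurable_funM => //; exact: mI.
- by apply: emeasurable_sum => i; apply: emeasurable_funM => //; exact: mI.
move=> x _; under eq_bigr do rewrite -EFinM; rewrite sumEFin -EFinM lee_fin.
have [xE|xE] := pselect (E x); first by rewrite indicE mem_set// mulr1 H.
by rewrite indicE memNset// mulr0 sumr_ge0// => i _; rewrite mulr_ge0.
Qed.

End union_bounds.

Section slabs.
Context (R : realType) (K : finType).
Local Notation rT := (measurableTypeR R).
Variables (L : R) (mu : K -> probability rT R) (Q : probability (vec R K) R).
Hypotheses (L0 : 0 < L) (Qmu : product_law Q mu) (muL : forall k, bounded_density L (mu k)).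

(** For F affine in one coordinate with slope H, membership says that this coordinate lies within e
    of the root of F. *)
Definition slab (F H : vec R K -> R) (e : R) : set (vec R K) :=
  [set x | H x != 0 /\ `|F x| <= e * `|H x|].

Lemma measurable_slab F H e : measurable_fun setT (F : vec R K -> rT) ->
  measurable_fun setT (H : vec R K -> rT) -> measurable (slab F H e).
Proof.
move=> mF mH; rewrite (_ : slab F H e = [set x | H x != 0] `&` [set x | `|F x| <= e * `|H x|])//.
apply: measurableI; first exact: measurable_neq0_set mH.
have mnF : measurable_fun setT (fun x => `|F x| : rT) by exact: measurableT_comp.
have mnH : measurable_fun setT (fun x => e * `|H x| : rT).
  by apply: measurable_funM; [exact: measurable_cst|exact: measurableT_comp].
exact: measurable_le_set mnF mnH.
Qed.

(** With the other coordinates fixed, the section in the coordinate k is empty or contained in an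
    interval of length 2e. *)
Lemma slab_bound F H k e : 0 <= e ->
  measurable_fun setT (F : vec R K -> rT) -> measurable_fun setT (H : vec R K -> rT) ->
  (forall x t, H (upd k t x) = H x) ->
  (forall x t, F (upd k t x) = F x + (t - x k) * H x) ->
  (Q (slab F H e) <= (2 * L * e)%:E)%E.
Proof.
move=> e0 mF mH Hk Fk; have mS := measurable_slab e mF mH.
rewrite -(upd_law_id k Qmu mS) measure_upd//.
have C0 : 0 <= 2 * L * e by rewrite !mulr_ge0// ltW.
apply: (@le_trans _ _ (\int[Q]_x (2 * L * e)%:E)%E); last by rewrite integral_probability_cst.
apply: ge0_le_integral => //; first exact: measurable_measure_upd.
move=> x _; rewrite /slab /mkset.
have [H0|H0] := eqVneq (H x) 0.
  rewrite (_ : (fun t => _) = set0) ?measure0 ?lee_fin//.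
  by apply/seteqP; split=> t //=; rewrite Hk H0 eqxx => -[].
pose a := x k - F x / H x.
have mI : measurable (`[a - e, a + e]%classic : set rT) by exact: measurable_itv.
apply: (@le_trans _ _ (mu k `[a - e, a + e]%classic)).
  apply: le_measure; rewrite ?inE; [exact: (measurable_upd_section k x mS)|exact: mI|].
  move=> t /= [_]; rewrite Hk Fk.
  have -> : F x + (t - x k) * H x = (t - a) * H x by rewrite /a; field.
  rewrite normrM ler_pM2r ?normr_gt0// => h.
  by rewrite in_itv/= -ler_distlC distrC.
apply: (le_trans (muL k mI)).
rewrite lebesgue_measure_itv/= lte_fin; case: ifPn => _; last by rewrite mule0 lee_fin.
by rewrite -EFinB -EFinM lee_fin; apply: eq_le_refl; ring.
Qed.

End slabs.

(** * Almost sure invertibility, and dimensions one and two *)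

Section determinants.
Context (R : realType) (n : nat).
Local Notation rT := (measurableTypeR R).
Local Notation K := ('I_n * 'I_n)%type.
Variables (L : R) (mu : K -> probability rT R) (Q : probability (vec R K) R).
Hypotheses (L0 : 0 < L) (Qmu : product_law Q mu) (muL : forall k, bounded_density L (mu k)).

Definition submat r (f g : 'I_r -> 'I_n) (x : vec R K) : 'M[R]_r := \matrix_(i, j) x (f i, g j).

Section submatrix.
Variables (r : nat) (f g : 'I_r -> 'I_n).
Hypotheses (fI : injective f) (gI : injective g).

Lemma measurable_det_submat : measurable_fun setT (fun x => \det (submat f g x) : rT).
Proof.
apply: measurable_det => i j.
rewrite (_ : (fun x => _) = (fun x : vec R K => x (f i, g j))); first exact: measurable_coord.
by apply/funext => x; rewrite mxE.
Qed.

Lemma measurable_cofactor_submat a b :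
  measurable_fun setT (fun x => cofactor (submat f g x) a b : rT).
Proof.
apply: measurable_funM; first exact: measurable_cst.
apply: measurable_det => i j.
rewrite (_ : (fun x => _) = (fun x : vec R K => x (f (lift a i), g (lift b j)))).
  exact: measurable_coord.
by apply/funext => x; rewrite !mxE.
Qed.

Lemma cofactor_submat_upd a b j x t :
  cofactor (submat f g (upd (f a, g b) t x)) a j = cofactor (submat f g x) a j.
Proof.
congr (_ * \det _); apply/matrixP => i k; rewrite !mxE /upd xpair_eqE.
by rewrite (inj_eq fI) eq_sym (negbTE (neq_lift a i)).
Qed.

Lemma det_submat_upd a b x t : \det (submat f g (upd (f a, g b) t x)) =
  \det (submat f g x) + (t - x (f a, g b)) * cofactor (submat f g x) a b.
Proof.
rewrite !(expand_det_row _ a).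
under eq_bigr do rewrite cofactor_submat_upd.
rewrite (bigD1 b)//= [X in _ = X + _](bigD1 b)//= !mxE /upd eqxx.
rewrite (eq_bigr (fun j => submat f g x a j * cofactor (submat f g x) a j)); last first.
  by move=> j jb; rewrite !mxE xpair_eqE eqxx (inj_eq gI) (negbTE jb).
by ring.
Qed.

Lemma submat_slab a b e : 0 <= e ->
  (Q (slab (fun x => \det (submat f g x)) (fun x => cofactor (submat f g x) a b) e) <=
    (2 * L * e)%:E)%E.
Proof.
move=> e0; apply: (@slab_bound R K L mu Q L0 Qmu muL _ _ (f a, g b)) => //.
- exact: measurable_det_submat.
- exact: measurable_cofactor_submat.
- by move=> x t; exact: cofactor_submat_upd.
- exact: det_submat_upd.
Qed.

End submatrix.

(** Induction on the size: either the corner minor vanishes, or the determinant is affine in the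
    corner entry with nonzero slope and its zero set is a slab of width 0. *)
Lemma det_submat_null r (f g : 'I_r -> 'I_n) : injective f -> injective g ->
  Q [set x | \det (submat f g x) = 0] = 0%E.
Proof.
elim: r f g => [|r ih] f g fI gI.
  rewrite (_ : [set _ | _] = set0) ?measure0//.
  by apply/seteqP; split=> x //=; rewrite det_mx00 => /eqP; rewrite oner_eq0.
pose f' i := f (lift ord0 i); pose g' i := g (lift ord0 i).
have f'I : injective f' by move=> i j /fI; exact: lift_inj.
have g'I : injective g' by move=> i j /gI; exact: lift_inj.
have cofE x : cofactor (submat f g x) ord0 ord0 = \det (submat f' g' x).
  rewrite /cofactor addn0 expr0 mul1r; congr (\det _).
  by apply/matrixP => i j; rewrite !mxE.
have md := measurable_det_submat f g; have md' := measurable_det_submat f' g'.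
pose D := [set x | \det (submat f g x) = 0].
pose D' := [set x | \det (submat f' g' x) = 0].
have mD : measurable D by exact: measurable_eq0_set md.
have mD' : measurable D' by exact: measurable_eq0_set md'.
pose S e := slab (fun x => \det (submat f g x)) (fun x => cofactor (submat f g x) ord0 ord0) e.
have mS e : measurable (S e).
  by apply: measurable_slab; [exact: md|exact: measurable_cofactor_submat].
have DS : D `<=` D' `|` S 0.
  move=> x /= Dx; have [h|h] := eqVneq (\det (submat f' g' x)) 0; [by left|right].
  by rewrite /S /slab /mkset cofE h Dx normr0 mul0r.
apply/eqP; rewrite eq_le measure_ge0 andbT.
have mDS : measurable (D' `|` S 0) by exact: measurableU.
apply: (@le_trans _ _ (Q (D' `|` S 0))); first by apply: le_measure; rewrite ?inE.
apply: le_trans (measureU2 _ mD' (mS 0)) _.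
have QD' : (Q D' <= 0)%E by apply: eq_le_refl; exact: ih.
have QS : (Q (S 0%R) <= 0)%E by have := submat_slab fI gI ord0 ord0 (lexx 0); rewrite mulr0.
by apply: (le_trans (leeD QD' QS)); rewrite adde0.
Qed.

Lemma det_null : Q [set x : vec R K | \det (mat x) = 0] = 0%E.
Proof. exact: (@det_submat_null n id id). Qed.

(** For an invertible matrix this says that the Hilbert-Schmidt norm of the inverse is at least sqrt
    n / t, which a small [smin] implies; the infimum has disappeared. *)
Definition flat_event (t : R) : set (vec R K) := [set x : vec R K |
  \det (mat x) != 0 /\ n%:R * \det (mat x) ^+ 2 <= t ^+ 2 * \sum_m adj_norm2 (mat x) m].

Lemma measurable_flat_event t : measurable (flat_event t).
Proof.
have md := measurable_det (@measurable_mat R n).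
have mcst (r : R) : measurable_fun setT (fun _ : vec R K => r : rT) by exact: measurable_cst.
rewrite (_ : flat_event t = [set x : vec R K | \det (mat x) != 0] `&`
  [set x | n%:R * \det (mat x) ^+ 2 <= t ^+ 2 * \sum_m adj_norm2 (mat x) m])//.
apply: measurableI; first exact: measurable_neq0_set md.
apply: (measurable_le_set (measurable_funM (mcst _) (measurable_funX 2 md))).
apply: (measurable_funM (mcst _)).
by apply: measurable_sum => m; exact: measurable_adj_norm2.
Qed.

(** There are no triples of columns here, but a crude union bound is affordable: some cofactor has
    at least the average square, so an entry lies in a slab with e = t sqrt n <= 2t. At most four
    entries, each of cost 2L * 2t, give 16. *)
Lemma flat_event_small t : (0 < n)%N -> (n <= 2)%N -> 0 < t ->
  (Q (flat_event t) <= (16 * L * t)%:E)%E.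
Proof.
move=> n0 n2 t0; pose e := t * Num.sqrt n%:R.
have e0 : 0 <= e by rewrite mulr_ge0 ?sqrtr_ge0// ltW.
have nR : 0 < n%:R :> R by rewrite ltr0n.
pose W (km : K) := slab (fun x => \det (submat id id x)) (fun x => cofactor (submat id id x) km.1 km.2) e.
have mW km : measurable (W km).
  by apply: measurable_slab; [exact: measurable_det_submat|exact: measurable_cofactor_submat].
have H := @markov_sum _ (vec R K) R Q K (fun=> 1) W (flat_event t) 1 ler01 (fun=> ler01) mW
  (measurable_flat_event t).
rewrite -[leLHS]mul1e; apply: le_trans (H _) _.
  move=> x [d0 hx].
  have [km hkm] : exists km : K, \det (mat x) ^+ 2 <= e ^+ 2 * cofactor (mat x) km.1 km.2 ^+ 2.
    apply: contrapT => /forallNP h.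
    have h' km : e ^+ 2 * cofactor (mat x) km.1 km.2 ^+ 2 < \det (mat x) ^+ 2.
      by rewrite ltNge; apply/negP; exact: h.
    have sumE : \sum_m adj_norm2 (mat x) m = \sum_(km : K) cofactor (mat x) km.1 km.2 ^+ 2.
      rewrite -(pair_bigA _ (fun k m => cofactor (mat x) k m ^+ 2))/= exchange_big/=.
      apply: eq_bigr => m _; apply: eq_bigr => k _.
      by rewrite /adj_row mxE expr2.
    have : e ^+ 2 * \sum_m adj_norm2 (mat x) m < n%:R ^+ 2 * \det (mat x) ^+ 2.
      rewrite sumE mulr_sumr (_ : n%:R ^+ 2 * _ = \sum_(km : K) \det (mat x) ^+ 2); last first.
        by rewrite sumr_const card_prod card_ord -[RHS]mulr_natl natrM expr2.
      apply: ltr_sum => //; apply/hasP; exists ((Ordinal n0, Ordinal n0) : K) => //.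
    rewrite (_ : e ^+ 2 * _ = n%:R * (t ^+ 2 * \sum_m adj_norm2 (mat x) m)); last first.
      by rewrite /e exprMn sqr_sqrtr ?ler0n//; ring.
    rewrite (expr2 n%:R) -[ltRHS]mulrA ltr_pM2l//.
    by rewrite ltNge hx.
  rewrite (bigD1 km)//= mul1r indicE mem_set ?lerDl ?sumr_ge0//.
  rewrite /W /slab /mkset; split.
    apply: contraNneq d0 => c0; have := hkm; rewrite c0 expr0n mulr0.
    by rewrite -sqrf_eq0 eq_le sqr_ge0 => ->.
  have eh0 := mulr_ge0 e0 (normr_ge0 (cofactor (submat id id x) km.1 km.2)).
  by rewrite -(ler_sqr (normr_ge0 _) eh0) exprMn !real_normK ?num_real.
apply: (@le_trans _ _ (\sum_(km : K) (2 * L * e)%:E)%E).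
  by apply: lee_sum => km _; rewrite mul1e; exact: submat_slab.
rewrite sumEFin lee_fin sumr_const card_prod card_ord -[leLHS]mulr_natl.
have nn : (n * n)%:R <= 4 :> R by rewrite ler_nat; exact: (@leq_mul n n 2 2).
have s2 : Num.sqrt n%:R <= 2 :> R.
  rewrite -[leRHS]ger0_norm// -sqrtr_sqr ler_sqrt ?sqr_ge0// -natrX ler_nat.
  exact: leq_trans n2 _.
have Le : 2 * L * e <= 4 * L * t.
  rewrite /e (_ : 4 * L * t = 2 * L * (t * 2)); last by ring.
  by rewrite ler_wpM2l ?mulr_ge0 ?(ltW L0)// ler_wpM2l// ltW.
apply: (@le_trans _ _ (4 * (4 * L * t))); last by apply: eq_le_refl; ring.
by apply: ler_pM => //; rewrite !mulr_ge0// ltW.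
Qed.

End determinants.

(** * Counting dyadic levels and pairs of indices *)

Section counting.
Context (R : realType).

(** If r >= 1/4, the largest power 4^k below 4r already exceeds r; otherwise the constant 1/4
    suffices. *)
Lemma dyadic_sum (r : R) N : r < 4 ^+ N ->
  r <= 4^-1 + \sum_(k < N.+1) 4 ^+ k * ((4 ^+ k <= 4 * r)%R)%:R.
Proof.
have F0 k : 0 <= 4 ^+ k * ((4 ^+ k <= 4 * r)%R)%:R :> R by rewrite mulr_ge0 ?exprn_ge0.
elim: N => [|N ih] rN.
  rewrite big_ord_recl big_ord0 addr0/= !expr0 mul1r; rewrite expr0 in rN.
  by case: (leP 1 (4 * r)) => /= h; lra.
rewrite big_ord_recr/=; have [h|h] := ltP r (4 ^+ N).
  by apply: le_trans (ih h) _; rewrite addrA lerDl F0.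
have h' : 4 ^+ N.+1 <= 4 * r by rewrite exprS ler_pM2l.
rewrite h' mulr1 addrA; apply: (le_trans (ltW rN)); rewrite lerDr addr_ge0//.
by apply: sumr_ge0 => k _; exact: F0.
Qed.

(** Removing i leaves at least |G| - 1 choices of j, and removing j as well leaves at least |G| - 2
    choices of l. *)
Lemma count_pairs (I : finType) (G : {set I}) (i : I) :
  ((#|G| - 1) * (#|G| - 2) <=
   \sum_j \sum_l [&& i != j, i != l, j != l, j \in G & l \in G])%N.
Proof.
have C (A : {set I}) a : (#|A| - 1 <= #|A :\ a|)%N by rewrite (cardsD1 a A); case: (a \in A) => /=; rewrite ?add0n ?leq_subr// add1n subn1.
have E (P : pred I) : (\sum_j P j = #|[set j | P j]%SET|)%N.
  by rewrite -sum1_card [RHS]big_mkcond/=; apply: eq_bigr => j _; rewrite inE; case: (P j).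
apply: (@leq_trans (\sum_j ((i != j) && (j \in G)) * (#|G| - 2))%N).
  rewrite -big_distrl/= leq_mul2r E (_ : [set j | _]%SET = (G :\ i)%SET) ?C ?orbT//.
  by apply/setP => j; rewrite !inE eq_sym.
apply: leq_sum => j _; case: (boolP ((i != j) && (j \in G))) => [/andP[ij jG]|//].
rewrite mul1n E (_ : [set l | _]%SET = (G :\ i :\ j)%SET).
  apply: leq_trans (C (G :\ i)%SET j); rewrite -[2%N]/(1 + 1)%N subnDA leq_sub2r// C.
by apply/setP => l; rewrite !inE ij jG/= (eq_sym i l) (eq_sym j l); case: (l == i); case: (l == j).
Qed.

Lemma square_le_pairs (n g : nat) : (3 <= n)%N -> (3 * n <= 4 * g)%N ->
  (n * n <= 8 * ((g - 1) * (g - 2)))%N.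
Proof.
move=> h2 h1; have g3 : (3 <= g)%N by lia.
have h3 : (2 * g <= 3 * (g - 1))%N by lia.
have h4 : (g <= 3 * (g - 2))%N by lia.
have := leq_mul h3 h4; have := leq_mul h1 h1; nia.
Qed.

End counting.

(** * The flat event in dimension at least three *)

Section flat_event_large.
Context (R : realType) (n : nat).
Local Notation rT := (measurableTypeR R).
Local Notation K := ('I_n * 'I_n)%type.
Variables (L : R) (mu : K -> probability rT R) (Q : probability (vec R K) R).
Hypotheses (L0 : 0 < L) (Qmu : product_law Q mu) (muL : forall k, bounded_density L (mu k)).
Hypothesis mu1 : forall k, (\int[mu k]_x x%:E = 0)%E.
Hypothesis mu2 : forall k, (\int[mu k]_x (x ^+ 2)%:E <= 1)%E.
Hypothesis n3 : (3 <= n)%N.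
Variable t : R.
Hypothesis t0 : 0 < t.

Definition distinct (ijl : 'I_n * 'I_n * 'I_n) : bool :=
  [&& ijl.1.1 != ijl.1.2, ijl.1.1 != ijl.2 & ijl.1.2 != ijl.2].

Let I := (('I_n * 'I_n * 'I_n) * 'I_n.+1)%type.
Let w (a : I) : R := 4 ^+ a.2 * (distinct a.1)%:R.
(** 2^k / 2 is the lower bound for rho_i at level k, and 4 / 2^k is its ratio to the upper bound 2
    for rho_j and rho_l. *)
Let W (a : I) : set (vec R K) :=
  adj_event a.1.1.1 a.1.1.2 a.1.2 (2 ^+ a.2 / 2) t (4 / 2 ^+ a.2).

Let w0 a : 0 <= w a.
Proof. by rewrite mulr_ge0 ?exprn_ge0. Qed.

Let nR : 0 < n%:R :> R. Proof. by rewrite ltr0n; exact: leq_trans n3. Qed.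

(** 4^k * 3 * (2t / 2^k) * (16 / 4^k) = 96 t / 2^k: the weight is absorbed by the two constraints on
    rows j and l, and the decay 2^(-k) of the remaining one is left over. *)
Let wW a : ((w a)%:E * Q (W a) <= (96 * small_ball_cst L * t / 2 ^+ a.2)%:E)%E.
Proof.
have k0 : 0 < 2 ^+ a.2 :> R by rewrite exprn_gt0.
have D0 := mulr_ge0 (mulr_ge0 (ler0n R 96) (ltW (small_ball_cst_gt0 L0))) (ltW t0).
rewrite /w; case: (boolP (distinct a.1)) => [/and3P[ij il jl]|_]; last first.
  by rewrite mulr0 mul0e lee_fin; apply: divr_ge0 (ltW k0); exact: D0.
rewrite mulr1.
have X0 : 0 < 2 ^+ a.2 / 2 :> R by rewrite divr_gt0.
have e0 : 0 < 4 / 2 ^+ a.2 :> R by rewrite divr_gt0.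
have H := adj_event_bound L0 Qmu muL mu1 mu2 ij il jl X0 t0 e0.
apply: le_trans (lee_wpmul2l _ H) _; first by rewrite lee_fin exprn_ge0.
rewrite -EFinM lee_fin; apply: eq_le_refl.
have -> : 4 ^+ a.2 = 2 ^+ a.2 * 2 ^+ a.2 :> R by rewrite -exprMn; congr (_ ^+ _); ring.
by field; rewrite gt_eqF.
Qed.

Let geometric_le N : \sum_(k < N) (2 ^+ k)^-1 <= 2 :> R.
Proof.
have -> : \sum_(k < N) (2 ^+ k)^-1 = 2 - 2 / 2 ^+ N :> R.
  elim: N => [|N ih]; first by rewrite big_ord0 expr0; field.
  by rewrite big_ord_recr/= ih exprS; field; rewrite expf_neq0.
by rewrite gerBl divr_ge0// exprn_ge0.
Qed.

Let upper : (\sum_a (w a)%:E * Q (W a) <= (n%:R ^+ 3 * (192 * small_ball_cst L * t))%:E)%E.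
Proof.
apply: (le_trans (lee_sum _ (fun a _ => wW a))).
rewrite sumEFin lee_fin.
rewrite -(pair_bigA _ (fun (_ : 'I_n * 'I_n * 'I_n) (k : 'I_n.+1) => 96 * small_ball_cst L * t / 2 ^+ k))/=.
rewrite sumr_const !card_prod card_ord -[leLHS]mulr_natl !natrM -mulr_sumr.
have -> : n%:R ^+ 3 = n%:R * n%:R * n%:R :> R by ring.
rewrite ler_wpM2l ?mulr_ge0//.
have D0 := mulr_ge0 (mulr_ge0 (ler0n R 96) (ltW (small_ball_cst_gt0 L0))) (ltW t0).
rewrite (_ : 192 * _ * t = 96 * small_ball_cst L * t * 2); last by ring.
exact: (ler_wpM2l D0 (geometric_le _)).
Qed.

Section lower_bound.
Variable x : vec R K.
Hypothesis xE : flat_event t x.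
Let q m := adj_norm2 (mat x) m.
Let s := \sum_m q m.
Let r m := n%:R * q m / s.
Let G : {set 'I_n} := [set m | r m <= 4]%SET.

Let q0 m : 0 <= q m. Proof. exact: dot_ge0. Qed.

Let s0 : 0 < s.
Proof.
have [d0 h] := xE; have t20 : 0 < t ^+ 2 by rewrite exprn_gt0.
by rewrite -(pmulr_rgt0 _ t20); apply: lt_le_trans h; rewrite mulr_gt0// exprn_even_gt0.
Qed.

Let r0 m : 0 <= r m. Proof. by rewrite divr_ge0 ?mulr_ge0// ltW. Qed.

Let sum_r : \sum_m r m = n%:R.
Proof. by rewrite -mulr_suml -mulr_sumr -/s mulfK// gt_eqF. Qed.

Let r_le m : r m <= n%:R.
Proof. by rewrite -sum_r (bigD1 m)//= lerDl sumr_ge0. Qed.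

(** Markov's inequality for [r], of mean 1: at most a quarter of the indices exceed 4. *)
Let card_good : (3 * n <= 4 * #|G|)%N.
Proof.
have : 4 * #|~: G|%:R <= n%:R :> R.
  rewrite -sum_r mulr_natr -sumr_const [leLHS]big_mkcond/=; apply: ler_sum => m _.
  by rewrite !inE; case: ifPn => //; rewrite -ltNge => /ltW.
rewrite -natrM ler_nat; have := cardsC G; rewrite card_ord; lia.
Qed.

(** The lower bound on [r i] implies the determinant condition of [W]; together with r_j, r_l <= 4
    it implies the two comparisons of rows. *)
Let term_ge i j l (k : 'I_n.+1) :
  [&& i != j, i != l, j != l, j \in G & l \in G]%:R * (4 ^+ k * ((4 ^+ k <= 4 * r i)%R)%:R)
  <= w (i, j, l, k) * \1_(W (i, j, l, k)) x.
Proof.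
have rhs0 : 0 <= w (i, j, l, k) * \1_(W (i, j, l, k)) x by rewrite mulr_ge0.
case: (boolP [&& _, _, _, _ & _]) => [/and5P[ij il jl jG lG]|_]; last by rewrite mul0r.
case: (boolP (4 ^+ k <= 4 * r i)) => [h|_]; last by rewrite !mulr0.
rewrite mul1r mulr1 /w /distinct/= ij il jl mulr1 indicE mem_set ?mulr1//.
have [d0 hx] := xE.
have k0 : 0 < 2 ^+ k :> R by rewrite exprn_gt0.
have k4 : 4 ^+ k = (2 ^+ k) ^+ 2 :> R by rewrite -exprM mulnC exprM; congr (_ ^+ _); ring.
have hs : 4 ^+ k * s <= 4 * n%:R * q i.
  by rewrite -ler_pdivlMr// -!mulrA; move: h; rewrite /r !mulrA.
have eta2 : (4 / 2 ^+ k) ^+ 2 = 16 / 4 ^+ k :> R by rewrite expr_div_n k4; congr (_ / _); ring.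
have good m : m \in G -> q m <= (4 / 2 ^+ k) ^+ 2 * q i.
  rewrite inE /r ler_pdivrMr// => hm.
  rewrite eta2 mulrAC ler_pdivlMr ?exprn_gt0// -(ler_pM2l nR).
  apply: (@le_trans _ _ (4 * s * 4 ^+ k)).
    by rewrite mulrA ler_wpM2r ?exprn_ge0.
  rewrite -mulrA (mulrC s); apply: (le_trans (ler_wpM2l _ hs)) => //.
  by apply: eq_le_refl; ring.
split; split; [by []| |exact: good|exact: good].
rewrite expr_div_n -k4 -(ler_pM2l nR).
apply: (@le_trans _ _ (4 ^+ k / 2 ^+ 2 * (t ^+ 2 * s))).
  by rewrite mulrCA ler_wpM2l ?divr_ge0 ?exprn_ge0.
rewrite (_ : 4 ^+ k / 2 ^+ 2 * (t ^+ 2 * s) = t ^+ 2 / 4 * (4 ^+ k * s)); last by field.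
apply: (le_trans (ler_wpM2l _ hs)); first by rewrite divr_ge0 ?sqr_ge0.
by apply: eq_le_refl; rewrite -/(q i); field.
Qed.

(** For every i the good pairs number at least n^2 / 8, and the dyadic weights summed over i reach n
    - n/4; hence 3/32 = (1/8) (3/4). *)
Lemma flat_count : n%:R ^+ 3 * (3 / 32) <= \sum_a w a * \1_(W a) x.
Proof.
pose b i (k : 'I_n.+1) : R := 4 ^+ k * ((4 ^+ k <= 4 * r i)%R)%:R.
pose a i j l := [&& i != j, i != l, j != l, j \in G & l \in G].
have b0 i k : 0 <= b i k by rewrite mulr_ge0 ?exprn_ge0.
have step1 : \sum_i (\sum_j \sum_l (a i j l)%:R) * \sum_k b i k <= \sum_a w a * \1_(W a) x.
  rewrite -(pair_bigA _ (fun ijl k => w (ijl, k) * \1_(W (ijl, k)) x))/=.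
  rewrite -(pair_bigA _ (fun ij l => \sum_k w (ij, l, k) * \1_(W (ij, l, k)) x))/=.
  rewrite -(pair_bigA _ (fun i j => \sum_l \sum_k w (i, j, l, k) * \1_(W (i, j, l, k)) x))/=.
  apply: ler_sum => i _; rewrite mulr_suml; apply: ler_sum => j _.
  rewrite mulr_suml; apply: ler_sum => l _; rewrite mulr_sumr; apply: ler_sum => k _.
  exact: term_ge.
apply: le_trans step1.
(* Since r_i <= n < 4^n, the levels k <= n suffice, whence the index type ['I_n.+1]. *)
have npow m : (m < 4 ^ m)%N by exact: ltn_expl.
have sumb : n%:R * (3 / 4) <= \sum_i \sum_k b i k.
  have H : \sum_i r i <= \sum_i (4^-1 + \sum_k b i k).
    apply: ler_sum => i _; apply: dyadic_sum; apply: le_lt_trans (r_le i) _.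
    by rewrite -natrX ltr_nat npow.
  move: H; rewrite sum_r big_split/= sumr_const card_ord -mulr_natr; lra.
pose g := #|G|.
have M i : ((g - 1) * (g - 2))%:R <= \sum_j \sum_l (a i j l)%:R :> R.
  have := count_pairs G i; rewrite -/g -(ler_nat R) natr_sum.
  by under [X in _ <= X -> _]eq_bigr do rewrite natr_sum.
have gn : n%:R ^+ 2 / 8 <= ((g - 1) * (g - 2))%:R :> R.
  have h := square_le_pairs n3 card_good.
  by rewrite ler_pdivrMr// expr2 -!natrM ler_nat mulnC.
apply: (@le_trans _ _ (\sum_i ((g - 1) * (g - 2))%:R * \sum_k b i k)).
  rewrite -mulr_sumr (_ : n%:R ^+ 3 * (3 / 32) = (n%:R ^+ 2 / 8) * (n%:R * (3 / 4))); last by field.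
  by apply: ler_pM => //; rewrite ?mulr_ge0 ?sqr_ge0.
by apply: ler_sum => i _; rewrite ler_wpM2r// sumr_ge0.
Qed.

End lower_bound.

(** The total weight n^3 (3/32) is compared with its mean, at most 192 n^3 times the small ball
    constant times t; the powers of n cancel and 2048 = 192 * 32 / 3. *)
Lemma flat_event_large : (Q (flat_event t) <= (2048 * small_ball_cst L * t)%:E)%E.
Proof.
have c0 : 0 < n%:R ^+ 3 * (3 / 32) :> R by rewrite mulr_gt0 ?exprn_gt0.
have H := @markov_sum _ (vec R K) R Q I w W (flat_event t) _ (ltW c0) w0
  (fun a => measurable_adj_event _ _ _ _ _ _) (measurable_flat_event t) flat_count.
have := le_trans H upper.
rewrite -lee_pdivlMl// => /le_trans; apply.
rewrite -EFinM lee_fin; apply: eq_le_refl; field.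
by rewrite gt_eqF.
Qed.

End flat_event_large.

(** * The smallest singular value *)

Section smallest_singular_value.
Context (R : realType) (n : nat).
Implicit Types (A : 'M[R]_n) (v : 'cV[R]_n).

Definition norm2 m (v : 'cV[R]_m) : R := \sum_i v i 0 ^+ 2.

Lemma norm2_ge0 m (v : 'cV[R]_m) : 0 <= norm2 v.
Proof. by apply: sumr_ge0 => i _; exact: sqr_ge0. Qed.

Lemma norm2Z m (a : R) (v : 'cV[R]_m) : norm2 (a *: v) = a ^+ 2 * norm2 v.
Proof. by rewrite /norm2 mulr_sumr; apply: eq_bigr => i _; rewrite mxE exprMn. Qed.

Lemma unit_sphereP v : unit_sphere R n v <-> norm2 v = 1.
Proof.
rewrite /unit_sphere /euclidean_norm /mkset -/(norm2 v); split=> [h|->]; last exact: sqrtr1.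
by rewrite -(sqr_sqrtr (norm2_ge0 v)) h expr1n.
Qed.

(** Row m of adj(A) paired with A v is det(A) v_m; apply Cauchy-Schwarz in each row and sum. *)
Lemma det_sqr_le A v : norm2 v = 1 ->
  \det A ^+ 2 <= (\sum_m adj_norm2 A m) * norm2 (A *m v).
Proof.
move=> v1; rewrite -[leLHS]mulr1 -v1 mulr_sumr mulr_suml; apply: ler_sum => m _.
rewrite -exprMn -(dot_adj_row A m (fun j => v j 0)).
rewrite (_ : norm2 _ = dot (fun k => (A *m v) k 0) (fun k => (A *m v) k 0)); last first.
  by apply: eq_bigr => k _; rewrite expr2.
apply: le_trans (dot_cauchy_schwarz _ _); apply: eq_le_refl.
congr (_ ^+ 2); rewrite /dot; apply: eq_bigr => k _; congr (_ * _).
by rewrite mxE.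
Qed.

Hypothesis n0 : (0 < n)%N.

Lemma unit_sphere_neq0 : exists v, unit_sphere R n v.
Proof.
exists (delta_mx (Ordinal n0) 0); apply/unit_sphereP.
rewrite /norm2 (bigD1 (Ordinal n0))//= mxE !eqxx expr1n big1 ?addr0// => i i0.
by rewrite mxE (negbTE i0) expr0n.
Qed.

Let has_inf_image A : has_inf [set euclidean_norm (A *m x) | x in unit_sphere R n].
Proof.
split; first by have [v hv] := unit_sphere_neq0; exists (euclidean_norm (A *m v)); exists v.
by exists 0 => _ [v _ <-]; exact: sqrtr_ge0.
Qed.

Lemma smin_det A (s : R) : 0 <= s -> smin A <= s -> \det A != 0 ->
  \det A ^+ 2 <= s ^+ 2 * \sum_m adj_norm2 A m.
Proof.
move=> s0 As d0; set S := \sum_m _.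
have d20 : 0 < \det A ^+ 2 by rewrite exprn_even_gt0.
have S0 : 0 < S.
  have [v /unit_sphereP v1] := unit_sphere_neq0.
  have := lt_le_trans d20 (det_sqr_le A v1); rewrite -/S => h.
  rewrite lt_neqAle sumr_ge0 ?andbT => [|m _]; last exact: dot_ge0.
  by apply: contraTneq h => <-; rewrite mul0r ltxx.
have c0 : 0 <= `|\det A| / Num.sqrt S by rewrite divr_ge0 ?sqrtr_ge0.
have : `|\det A| / Num.sqrt S <= s.
  apply: le_trans As; apply: lb_le_inf; first by have [] := has_inf_image A.
  move=> _ [v /unit_sphereP v1 <-].
  rewrite ler_pdivrMr ?sqrtr_gt0// -sqrtr_sqr /euclidean_norm -sqrtrM ?norm2_ge0//.
  by rewrite ler_sqrt ?mulr_ge0 ?norm2_ge0 ?(ltW S0)// [leRHS]mulrC; exact: det_sqr_le.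
rewrite -(ler_sqr c0 s0) expr_div_n sqr_sqrtr ?(ltW S0)// ler_pdivrMr//.
by rewrite real_normK ?num_real.
Qed.

Let sum_continuous (T : topologicalType) (I : Type) (r : seq I) (f : I -> T -> R) :
  (forall i, continuous (f i)) -> continuous (fun x => \sum_(i <- r) f i x).
Proof.
move=> cf; elim: r => [|i r ih] x.
  under eq_fun do rewrite big_nil; exact: cvg_cst.
by under eq_fun do rewrite big_cons; apply: cvgD; [exact: cf|exact: ih].
Qed.

Let gap_continuous A (c : R) : continuous (fun v => c * norm2 v - norm2 (A *m v)).
Proof.
have ce i : continuous (fun v : 'cV[R]_n => v i 0) by exact: coord_continuous.
have cA k : continuous (fun v : 'cV[R]_n => (A *m v) k 0).
  under eq_fun do rewrite mxE; apply: sum_continuous => j v.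
  by apply: continuousM; [exact: cst_continuous|exact: ce].
have sq (f : 'cV[R]_n -> R) : continuous f -> continuous (fun v => f v ^+ 2).
  by move=> cf v; under eq_fun do rewrite expr2; apply: continuousM; exact: cf.
have c1 : continuous (fun v : 'cV[R]_n => norm2 v : R) by apply: sum_continuous => k; exact: sq.
have c2 : continuous (fun v : 'cV[R]_n => norm2 (A *m v) : R).
  by apply: sum_continuous => k; exact: sq.
have c3 : continuous (fun v : 'cV[R]_n => c * norm2 v : R).
  by move=> v; apply: continuousM; [exact: cst_continuous|exact: c1].
by move=> v; exact: (cvgB (c3 v) (c2 v)).
Qed.

Definition real_of_rat (q : 'cV[rat]_n) : 'cV[R]_n := map_mx ratr q.

Let rat_dense (h : 'cV[R]_n -> R) v : continuous h -> 0 < h v ->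
  exists q : 'cV[rat]_n, 0 < h (real_of_rat q).
Proof.
move=> ch hv.
have /nbhs_ballP[e /= e0 he] : \forall u \near v, 0 < h u by exact: (cvgr_gt _ (ch v)).
have H i : exists q : rat, ball (v i 0) e (ratr q : R).
  have /rat_in_itvoo[q] : v i 0 - e < v i 0 + e by rewrite ltrD2l; lra.
  by rewrite in_itv/= => /andP[q1 q2]; exists q; rewrite /ball/= ltr_distlC q1.
have [f hf] := choice H.
exists (\col_i f i); apply: he; split=> // i j; rewrite !mxE (ord1 j); exact: hf.
Qed.

(** Homogeneity replaces the sphere by all vectors, and the margin 1 / (p + 1) makes the condition
    open, so that rational vectors suffice. The uncountable infimum thus becomes a countable
    combination of measurable conditions. *)
Lemma smin_leP A (s : R) : 0 <= s -> smin A <= s <-> forall p : nat,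
  exists q : 'cV[rat]_n,
    norm2 (A *m real_of_rat q) < (s + p.+1%:R^-1) ^+ 2 * norm2 (real_of_rat q).
Proof.
move=> s0; split=> [As p|H].
  have p0 : 0 < p.+1%:R^-1 :> R by rewrite invr_gt0.
  have [v vA] : exists v, 0 < (s + p.+1%:R^-1) ^+ 2 * norm2 v - norm2 (A *m v).
    have [_ [v /unit_sphereP v1 <-] hv] := inf_adherent p0 (has_inf_image A).
    exists v; rewrite v1 mulr1 subr_gt0.
    rewrite -(sqr_sqrtr (norm2_ge0 (A *m v))) ltr_sqr ?nnegrE ?sqrtr_ge0 ?addr_ge0 ?(ltW p0)//.
    by apply: (lt_le_trans hv); rewrite lerD2r.
  have [q hq] := rat_dense (@gap_continuous A _) vA.
  by exists q; rewrite -subr_gt0.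
apply/ler_addgt0Pr => e e0.
have [p pe] : exists p : nat, p.+1%:R^-1 <= e.
  exists (Num.truncn e^-1); rewrite -[leRHS]invrK lef_pV2 ?posrE ?invr_gt0 ?ltr0n//.
  by rewrite ltW// truncnS_gt.
have [q hq] := H p; set u := real_of_rat q in hq.
have p0 : 0 < p.+1%:R^-1 :> R by rewrite invr_gt0.
have sp0 : 0 < (s + p.+1%:R^-1) ^+ 2 by rewrite exprn_gt0// ltr_wpDl.
have u0 : 0 < norm2 u.
  by rewrite -(pmulr_rgt0 _ sp0); apply: le_lt_trans hq; exact: norm2_ge0.
pose a := (Num.sqrt (norm2 u))^-1.
have a2 : a ^+ 2 = (norm2 u)^-1 by rewrite exprVn sqr_sqrtr ?norm2_ge0.
apply: (@le_trans _ _ (euclidean_norm (A *m (a *: u)))).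
  apply: ge_inf; first by have [] := has_inf_image A.
  by exists (a *: u) => //; apply/unit_sphereP; rewrite norm2Z a2 mulVf// gt_eqF.
have se0 : 0 <= s + e by rewrite addr_ge0// ltW.
apply: (@le_trans _ _ (s + p.+1%:R^-1)); last by rewrite lerD2l.
have sp : 0 <= s + p.+1%:R^-1 by rewrite addr_ge0// ltW.
rewrite -[leRHS]ger0_norm// -sqrtr_sqr /euclidean_norm ler_sqrt ?sqr_ge0//.
rewrite -/(norm2 (A *m _)) -scalemxAr norm2Z a2 mulrC ler_pdivrMr//.
exact: ltW.
Qed.

Lemma measurable_smin_le (s : R) : 0 <= s ->
  measurable [set x : vec R ('I_n * 'I_n)%type | smin (mat x) <= s].
Proof.
move=> s0.
pose B p q := [set x : vec R ('I_n * 'I_n)%type |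
  norm2 (mat x *m real_of_rat q) < (s + p.+1%:R^-1) ^+ 2 * norm2 (real_of_rat q)].
rewrite (_ : [set x | _] = \bigcap_p \bigcup_q B p q); last first.
  apply/seteqP; split=> x /=.
    by move=> /(smin_leP _ s0) h p _; have [q hq] := h p; exists q.
  by move=> h; apply/(smin_leP _ s0) => p; have [q _ hq] := h p I; exists q.
apply: bigcapT_measurable => p; apply: countable_bigcupT_measurable => [|q]; first exact: countableP.
pose f (x : vec R ('I_n * 'I_n)%type) : measurableTypeR R := norm2 (mat x *m real_of_rat q).
have mf : measurable_fun setT f.
  apply: measurable_sum => i; apply: measurable_funX.
  rewrite (_ : (fun x => _) = (fun x : vec R ('I_n * 'I_n)%type => \sum_j mat x i j * real_of_rat q j 0)).
    apply: measurable_sum => j; apply: measurable_funM; last exact: measurable_cst.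
    exact: measurable_mat.
  by apply/funext => x; rewrite mxE.
rewrite (_ : B p q = ~` [set x | (s + p.+1%:R^-1) ^+ 2 * norm2 (real_of_rat q) <= f x]).
  apply: measurableC; apply: measurable_le_set => //; exact: measurable_cst.
by apply/seteqP; split=> x /=; rewrite /B /mkset ltNge => /negP.
Qed.

End smallest_singular_value.

(** * Laws of the entries *)

Section law_of_entries.
Context d (T : measurableType d) (R : realType) (P : probability T R).
Local Notation rT := (measurableTypeR R).

Lemma measurable_RV (X : {RV P >-> R}) : measurable_fun setT (X : T -> rT).
Proof. by move=> mT B mB; exact: (@measurable_funP _ _ _ _ setT X mT B mB). Qed.

(* [R] and [measurableTypeR R] carry the same sigma-algebra under different displays. *)
Definition RV_measurableTypeR (X : {RV P >-> R}) : {mfun T >-> rT} :=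
  HB.pack_for {mfun T >-> rT} (X : T -> rT)
    (isMeasurableFun.Build _ _ _ _ (X : T -> rT) (measurable_RV X)).

Definition law (X : {RV P >-> R}) : probability rT R := distribution P (RV_measurableTypeR X).

Lemma bounded_density_law (X : {RV P >-> R}) (f : R -> R) (L : R) :
  is_density X f -> (forall x, f x <= L) -> bounded_density L (law X).
Proof.
move=> [mf f0 Xf] fL B mB.
rewrite [leLHS](_ : _ = \int[lebesgue_measure]_(x in B) (f x)%:E)%E; last exact: (Xf B mB).
rewrite -[leRHS]/(L%:E * lebesgue_measure B)%E -integral_cst//.
apply: ge0_le_integral => //.
- by move=> x _; rewrite lee_fin.
- by apply/measurable_EFinP; exact: measurable_funTS.
- by move=> x _; rewrite lee_fin.
Qed.

Lemma second_moment_law (X : {RV P >-> R}) : ('E_P[X] = 0)%E -> ('V_P[X] = 1)%E ->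
  (\int[law X]_x (x ^+ 2)%:E <= 1)%E.
Proof.
move=> E0 V1; rewrite ge0_integral_pushforward//; last 2 first.
- by apply/measurable_EFinP; exact: measurable_funX.
- by move=> x _; rewrite lee_fin sqr_ge0.
rewrite preimage_setT -V1 /variance covariance.unlock E0 expectation.unlock.
apply: eq_le_refl; apply: eq_integral => w _.
by transitivity (((X w - 0) * (X w - 0))%:E); first by rewrite !subr0 -expr2.
Qed.

Lemma first_moment_law (X : {RV P >-> R}) : ('E_P[X] = 0)%E -> ('V_P[X] = 1)%E ->
  (\int[law X]_x x%:E = 0)%E.
Proof.
move=> E0 V1; have mu2 := second_moment_law E0 V1.
(* [integrable_id] is stated for a family of laws; the family here is indexed by [unit]. *)
have /integrableP[mid iid] := @integrable_id R unit (fun=> law X) (fun=> mu2) tt.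
rewrite -E0 expectation.unlock integral_distribution//.
apply/integrableP; split; first by apply/measurable_EFinP; exact: measurable_RV.
move: iid; rewrite ge0_integral_pushforward//.
exact: measurableT_comp.
Qed.

End law_of_entries.

Theorem corollary1p2 (R : realType) (L : R) (hL : 0 < L) :
  exists2 v : R, 0 < v &
  forall (n : nat) (hn : (0 < n)%N)
    (d : measure_display) (T : measurableType d) (P : probability T R)
    (A : 'I_n -> 'I_n -> {RV P >-> R}),
    mutually_independent (fun ij : 'I_n * 'I_n => A ij.1 ij.2) ->
    (forall i j, ('E_P[A i j] = 0)%E) ->
    (forall i j, ('V_P[A i j] = 1)%E) ->
    (forall i j, exists2 f : R -> R,
       is_density (A i j) f & forall x, f x <= L) ->
    forall t : R, 0 < t ->
      (P [set w | (smin (\matrix_(i, j) A i j w) <= t / Num.sqrt n%:R)%R]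
        <= (v * t)%:E)%E.
Proof.
have a0 : 0 < 16 * L by rewrite mulr_gt0.
have b0 : 0 < 2048 * small_ball_cst L.
  by apply: mulr_gt0; [rewrite ltr0n|exact: small_ball_cst_gt0].
(* The first summand serves n <= 2, the second n >= 3. *)
exists (16 * L + 2048 * small_ball_cst L); first exact: addr_gt0 a0 b0.
move=> n hn d T P A indA E0 V1 dens t t0.
pose K := ('I_n * 'I_n)%type.
pose X (w : T) : vec R K := fun ij => A ij.1 ij.2 w.
have mX : measurable_fun setT X by apply: measurable_fun_vec => k; exact: measurable_RV.
pose X' : {mfun T >-> vec R K} := HB.pack_for {mfun T >-> vec R K} X
  (isMeasurableFun.Build _ _ _ _ X mX).
pose Q : probability (vec R K) R := distribution P X'.
pose mu (k : K) : probability (measurableTypeR R) R := law (A k.1 k.2).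
(* The rectangle formula is mutual independence for the full index set. *)
have Qmu : product_law Q mu.
  move=> B mB; have := indA [set: K]%SET B (fun k _ => mB k).
  rewrite (_ : \bigcap_(i in _) _ = X @^-1` [set x | forall k, B k (x k)]); last first.
    by apply/seteqP; split=> w /= h k; [apply: h; rewrite /= inE|move=> _; exact: h].
  by rewrite big_mkcond/= => H; rewrite [LHS]H; apply: eq_bigr => k _; rewrite inE.
have muL k : bounded_density L (mu k).
  by have [f fA fL] := dens k.1 k.2; exact: bounded_density_law fA fL.
have mu2 k : (\int[mu k]_x (x ^+ 2)%:E <= 1)%E by exact: second_moment_law.
have mu1 k : (\int[mu k]_x x%:E = 0)%E by exact: first_moment_law.
have sn0 : 0 < Num.sqrt n%:R :> R by rewrite sqrtr_gt0 ltr0n.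
have s0 : 0 <= t / Num.sqrt n%:R by rewrite divr_ge0 ?ltW.
have flat : (Q (flat_event t) <= ((16 * L + 2048 * small_ball_cst L) * t)%:E)%E.
  have [n3|n2] := leqP 3 n.
    apply: le_trans (flat_event_large hL Qmu muL mu1 mu2 n3 t0) _.
    by rewrite lee_fin; apply: (ler_wpM2r (ltW t0)); rewrite lerDr; exact: ltW a0.
  apply: le_trans (flat_event_small hL Qmu muL hn n2 t0) _.
  by rewrite lee_fin; apply: (ler_wpM2r (ltW t0)); rewrite lerDl; exact: ltW b0.
have mS := measurable_smin_le hn s0.
rewrite -[leLHS]/(Q [set x : vec R K | (smin (mat x) <= t / Num.sqrt n%:R)%R]).
(* The comparison of [smin] with the adjugate assumes det(A) nonzero, so the null set of singular
   matrices is split off. *)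
pose D := [set x : vec R K | \det (mat x) = 0].
have mD : measurable D := measurable_eq0_set (measurable_det (@measurable_mat R n)).
have mF := @measurable_flat_event R n t.
have D0 : (Q D <= 0)%E by apply: eq_le_refl; exact: det_null Qmu muL.
apply: (@le_trans _ _ (Q (D `|` flat_event t))).
  apply: le_measure; rewrite ?inE//; first exact: measurableU.
  move=> x /= xs; have [|d0] := eqVneq (\det (mat x)) 0; [by left|right].
  split=> //; have := smin_det hn s0 xs d0.
  rewrite expr_div_n sqr_sqrtr ?ler0n// mulrAC ler_pdivlMr ?ltr0n//.
  by rewrite mulrC.
apply: (le_trans (measureU2 _ mD mF)).
by apply: (le_trans (leeD D0 flat)); rewrite add0e.
Qed.
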